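(* Let $f(u)=u-u^q$ with $q\ge3$ an odd integer, let $g\in C^1(\mathbb{R})$ be globally Lipschitz, and let $\{u_h^n\}_{n=0}^N$ be the solution of the fully discrete finite element scheme described in the context. Suppose the mesh assumption given in the context holds. Then for any real $p\ge2$ there is a constant $C>0$, independent of $h$ and $\tau$, such that $$\sup_{0\le n\le N}\mathbb{E}\bigl[\|\nabla u_h^n\|_{L^2}^p\bigr]\le C.$$
   Context: **Setting.** $\mathcal{D}\subset\mathbb{R}^d$ ($d=1,2,3$) is a bounded domain, $T>0$, $(\Omega,\mathcal{F},\{\mathcal{F}_t\}_{t\ge0},\mathbb{P})$ is a filtered probability space carrying a standard real-valued Wiener process $W$, $\mathbb{E}$ is expectation, $(\cdot,\cdot)$ is the $L^2(\mathcal{D})$ inner product, and $\|\cdot\|_{L^2}=\|\cdot\|_{L^2(\mathcal{D})}$. The scheme approximates the SPDE $du=[\Delta u+f(u)]dt+g(u)dW(t)$ with $\partial u/\partial\nu=0$ on $\partial\mathcal{D}$ and $u(\cdot,0)=u_0$, where $f(u)=u-u^q$, $q\ge3$ odd, $g\in C^1(\mathbb{R})$ satisfies $|g(a)-g(b)|\le\kappa_1|a-b|$ for all $a,b\in\mathbb{R}$ and some $\kappa_1>0$, and $u_0$ is a sufficiently smooth initial function. **Mesh.** $t_n=n\tau$, $n=0,\dots,N$, is a uniform partition of $[0,T]$ ($\tau=T/N$). $\mathcal{T}_h$ is a conforming simplicial triangulation of $\mathcal{D}$ of mesh size $h$. Mesh assumption (for $d\ge2$): for every edge $E$ of the triangulation,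 $$\frac{1}{d(d-1)}\sum_{K\supset E}|\kappa_E^K|\cot\theta_E^K\ge0,$$ where the sum is over simplices $K\in\mathcal{T}_h$ containing $E$; if $a_1,\dots,a_{d+1}$ are the vertices of $K$, $E$ joins $a_i$ and $a_j$, and $F_i$ denotes the $(d-1)$-dimensional face of $K$ opposite $a_i$, then $\theta_E^K$ is the angle between $F_i$ and $F_j$, $\kappa_E^K=F_i\cap F_j$ is the $(d-2)$-dimensional simplex opposite to $E$, and $|\kappa_E^K|$ is its $(d-2)$-dimensional measure. **Scheme.** $V_h=\{v_h\in H^1(\mathcal{D}):v_h|_K\in\mathcal{P}_1(K)\ \forall K\in\mathcal{T}_h\}$. $I_h:C(\overline{\mathcal{D}})\to V_h$ is the nodal interpolation $I_hv=\sum_iv(a_i)\varphi_i$, with $\varphi_i$ the nodal basis function at vertex $a_i$. $P_h:L^2(\mathcal{D})\to V_h$ is the $L^2$-projection; it satisfies the standard estimates $\|w-P_hw\|_{L^2}+h\|\nabla(w-P_hw)\|_{L^2}\le Ch^{\min\{2,s\}}\|w\|_{H^s}$ for $w\in H^s(\mathcal{D})$ and $\|w-P_hw\|_{L^\infty}\le Ch^{2-d/2}\|w\|_{H^2}$. The discrete solution is an $\mathcal{F}_{t_n}$-adapted $V_h$-valued process $\{u_h^n\}$ with $u_h^0=P_hu_0$ such that, $\mathbb{P}$-almost surely, for $n=0,\dots,N-1$, $$(u_h^{n+1},v_h)+\tau(\nabla u_h^{n+1},\nabla v_h)=(u_h^n,v_h)+\tau(I_hf^{n+1},v_h)+(g(u_h^n),v_h)\,\bar\Delta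 W_{n+1}\quad\forall v_h\in V_h,$$ where $f^{n+1}=u_h^{n+1}-(u_h^{n+1})^q$ and $\bar\Delta W_{n+1}=W(t_{n+1})-W(t_n)$. *)

(* Defs.v *)
From HB Require Import structures.
From mathcomp Require Import all_boot all_order all_algebra.
From mathcomp Require Import all_classical all_reals all_analysis.

Set Implicit Arguments.
Unset Strict Implicit.
Unset Printing Implicit Defensive.
Import Order.TTheory GRing.Theory Num.Theory.
Import numFieldNormedType.Exports.
Local Open Scope classical_set_scope.
Local Open Scope ring_scope.

Definition rV_display : measure_display. Proof. exact. Qed.

Section rV_measurable.
Context {R : realType} {n : nat}.

Let coord : 'I_n -> 'rV[R]_n -> R := fun i x => x ord0 i.

Let rV_set0 : g_sigma_preimage coord set0.
Proof. exact: sigma_algebra0. Qed.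

Let rV_setC A : g_sigma_preimage coord A -> g_sigma_preimage coord (~` A).
Proof. exact: sigma_algebraC. Qed.

Let rV_bigcup (F : (set 'rV[R]_n)^nat) :
  (forall i, g_sigma_preimage coord (F i)) ->
  g_sigma_preimage coord (\bigcup_i F i).
Proof. exact: sigma_algebra_bigcup. Qed.

(* The product sigma-algebra, as the library does for tuples; it is the
   Borel sigma-algebra of ['rV[R]_n]. *)
HB.instance Definition _ := @isMeasurable.Build rV_display
  'rV[R]_n (g_sigma_preimage coord) rV_set0 rV_setC rV_bigcup.

End rV_measurable.

Section rV_lebesgue.
Context {R : realType}.

Lemma measurable_rV_coord n (i : 'I_n) :
  measurable_fun setT (fun x : 'rV[R]_n => x ord0 i).
Proof.
move=> _ Y mY; rewrite setTI; apply: sub_sigma_algebra => /=.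
rewrite -bigcup_seq/=; exists i => /=; first by rewrite mem_index_enum.
by exists Y => //; rewrite setTI.
Qed.

Definition rV_snoc n (z : 'rV[R]_n * measurableTypeR R) : 'rV[R]_n.+1 :=
  \row_i oapp (z.1 ord0) (z.2 : R) (unlift ord_max i).

Lemma measurable_rV_snoc n : measurable_fun setT (@rV_snoc n).
Proof.
set coord := fun (i : 'I_n.+1) (x : 'rV[R]_n.+1) => x ord0 i.
have coordS i : measurable_fun setT (coord i \o @rV_snoc n).
  have -> : coord i \o @rV_snoc n = fun z =>
      oapp (z.1 ord0) (z.2 : R) (unlift ord_max i).
    by apply/funext => z; rewrite /coord /= mxE.
  case: (unlift ord_max i) => [j|] /=; last exact: measurable_snd.
  exact: (measurableT_comp (measurable_rV_coord j) measurable_fst).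
move=> _ Y mY.
have sub : g_sigma_preimage coord `<=`
    [set B | measurable (setT `&` @rV_snoc n @^-1` B)].
  apply: smallest_sub => /=.
    split => /=; first by rewrite preimage_set0 setI0.
    - move=> A mA; rewrite setTI setTD preimage_setC; apply: measurableC.
      by rewrite setTI in mA.
    - move=> F mF; rewrite setTI preimage_bigcup.
      by apply: bigcupT_measurable => k; have := mF k; rewrite setTI.
  rewrite -bigcup_seq => B [i _ [C mC <-]] /=.
  rewrite setTI setTI -comp_preimage -[X in measurable X]setTI.
  exact: coordS.
exact: sub.
Qed.

Definition lebesgue_snoc n (mu : {measure set 'rV[R]_n -> \bar R}) :
    set 'rV[R]_n.+1 -> \bar R :=
  pushforward (mu \x lebesgue_measure)%E (@rV_snoc n).

HB.instance Definition _ n (mu : {measure set 'rV[R]_n -> \bar R}) :=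
  Measure.copy (lebesgue_snoc mu)
    (measure_function_pushforward__canonical__measure_function_Measure
      (mu \x lebesgue_measure)%E (@measurable_rV_snoc n)).

Fixpoint leb n : {measure set 'rV[R]_n -> \bar R} :=
  match n with
  | 0%N => dirac (0 : 'rV[R]_0)
  | m.+1 => lebesgue_snoc (leb m)
  end.

End rV_lebesgue.

Section Euclidean.
Context {R : realType} {d : nat}.
Implicit Types x y : 'rV[R]_d.

(* The library's norm on ['rV[R]_d] is the max norm (same topology). *)
Definition dot x y : R := \sum_(i < d) x ord0 i * y ord0 i.
Definition enorm x : R := Num.sqrt (dot x x).

Definition bounded_domain (D : set 'rV[R]_d) : Prop :=
  [/\ D !=set0, open D, connected D & bounded_set D].

End Euclidean.

Section Sobolev.
Context {R : realType} {d : nat} (D : set 'rV[R]_d).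
Implicit Types v w : 'rV[R]_d -> R.

Definition in_L2 v : Prop :=
  measurable_fun D v /\ (\int[leb d]_(x in D) ((v x) ^+ 2)%:E < +oo)%E.

Definition ip v w : R := \int[leb d]_(x in D) (v x * w x).
Definition L2norm v : R := Num.sqrt (ip v v).
Definition Linfnorm v : \bar R := 'N[leb d]_+oo [EFin \o (v \_ D)]%E.

Definition pd (i : 'I_d) (phi : 'rV[R]_d -> R) : 'rV[R]_d -> R :=
  fun x => 'D_(delta_mx ord0 i) phi x.

Definition smooth phi : Prop := forall s : seq 'I_d,
  let psi := foldr pd phi s in
  continuous psi /\ forall i x, derivable psi x (delta_mx ord0 i).

Definition test_function phi : Prop := smooth phi /\
  exists K, [/\ compact K, K `<=` D & forall x, ~ K x -> phi x = 0].

Definition mpd (al : 'I_d -> nat) phi : 'rV[R]_d -> R :=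
  foldr (fun i => iter (al i) (pd i)) phi (enum 'I_d).

Definition mdeg (al : 'I_d -> nat) : nat := (\sum_(i < d) al i)%N.

Definition is_weak_deriv (al : 'I_d -> nat) v w : Prop :=
  forall phi, test_function phi ->
    ip v (mpd al phi) = (-1) ^+ mdeg al * ip w phi.

(* The weak derivative of order al (unique up to a null set), when there is
   one in L^2(D). *)
Definition weak_deriv (al : 'I_d -> nat) v : 'rV[R]_d -> R :=
  get [set w | in_L2 w /\ is_weak_deriv al v w].

Definition sobolev (s : nat) : set ('rV[R]_d -> R) :=
  [set v | in_L2 v /\ forall al, (mdeg al <= s)%N ->
    exists w, in_L2 w /\ is_weak_deriv al v w].

Definition sobolev_norm (s : nat) v : R :=
  Num.sqrt (\sum_(al : {ffun 'I_d -> 'I_s.+1} | (mdeg (al \; val) <= s)%N)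
              L2norm (weak_deriv (al \; val) v) ^+ 2).

Definition grad v (i : 'I_d) : 'rV[R]_d -> R :=
  weak_deriv (fun j => (j == i : nat)) v.
Definition grad_ip v w : R := \sum_(i < d) ip (grad v i) (grad w i).
Definition grad_norm v : R := Num.sqrt (grad_ip v v).

End Sobolev.

(* A simplex is given by the set of the indices of its vertices. *)
Record mesh (R : realType) (d : nat) := Mesh {
  nvert : nat;
  vert : 'I_nvert -> 'rV[R]_d;
  simplices : {set {set 'I_nvert}}
}.

Section Mesh.
Context {R : realType} {d : nat} (Th : mesh R d).
Local Notation index := ('I_(nvert Th)).
Local Notation a := (vert (m := Th)).
Implicit Types (K : {set index}) (i j : index).

Definition hull K : set 'rV[R]_d :=
  [set x | exists c : index -> R,
    [/\ forall i, 0 <= c i, forall i, i \notin K -> c i = 0,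
        \sum_i c i = 1 & x = \sum_i c i *: a i]].

Definition affinely_independent K : Prop :=
  forall c : index -> R, (forall i, i \notin K -> c i = 0) ->
    \sum_i c i = 0 -> \sum_i c i *: a i = 0 -> forall i, c i = 0.

Definition mesh_domain : set 'rV[R]_d :=
  \bigcup_(K in [set K | K \in simplices Th]) hull K.

(* The last clause says that D is a polyhedral domain which agrees with the
   interior of its closure (no slits or other exotic boundary inside the
   mesh). *)
Definition conforming_triangulation (D : set 'rV[R]_d) : Prop :=
  [/\ forall K, K \in simplices Th -> #|K| = d.+1 /\ affinely_independent K,
      forall i, exists2 K, K \in simplices Th & i \in K,
      forall K L, K \in simplices Th -> L \in simplices Th ->
        hull K `&` hull L = hull (K :&: L),
      closure D = mesh_domain
    & D = interior mesh_domain].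

Definition diam (A : set 'rV[R]_d) : R :=
  sup [set r | exists x y, [/\ A x, A y & r = enorm (x - y)]].

Definition mesh_size : R := \big[Num.max/0]_(K in simplices Th) diam (hull K).

(* The face of K opposite to vertex i is the simplex K :\ i. *)
Definition outward_normal K i : 'rV[R]_d :=
  get [set n | [/\ enorm n = 1,
    forall k l, k \in K :\ i -> l \in K :\ i -> dot n (a k - a l) = 0
  & forall k, k \in K :\ i -> dot n (a i - a k) < 0]].

(* The angle, measured inside K, between the faces opposite to i and to j: it
   is supplementary to the angle between their outward normals. *)
Definition dihedral_angle K i j : R :=
  pi - acos (dot (outward_normal K i) (outward_normal K j)).

Definition cot (t : R) : R := cos t / sin t.

(* Gram determinant formula for the k-dimensional measure of a k-simplex with
   k.+1 vertices s; it is 1 for a single point (counting measure). *)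
Definition simplex_measure (s : seq 'rV[R]_d) : R :=
  if s is b :: s' then
    Num.sqrt (\det (\matrix_(p < size s', q < size s')
                      dot (s'`_p - b) (s'`_q - b))) / ((size s')`!)%:R
  else 0.

Definition opposite_measure K i j : R :=
  simplex_measure [seq a k | k <- enum (K :\ i :\ j)].

Definition edge i j : Prop :=
  i != j /\ exists2 K, K \in simplices Th & (i \in K) && (j \in K).

Definition mesh_assumption : Prop :=
  (2 <= d)%N -> forall i j, edge i j ->
    0 <= (d * d.-1)%:R^-1 *
      \sum_(K in simplices Th | (i \in K) && (j \in K))
        opposite_measure K i j * cot (dihedral_angle K i j).

End Mesh.

Section FiniteElements.
Context {R : realType} {d : nat} (D : set 'rV[R]_d) (Th : mesh R d).
Implicit Types v w : 'rV[R]_d -> R.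

(* Functions are considered on the closure of D; being affine on each closed
   simplex, elements of [Vh] are the continuous representatives. Their values
   outside of the closure of D are irrelevant. *)
Definition Vh : set ('rV[R]_d -> R) :=
  [set v | sobolev D 1 v /\
    forall K, K \in simplices Th -> exists (c : 'rV[R]_d) (b : R),
      forall x, hull K x -> v x = dot c x + b].

Definition nodal_basis (i : 'I_(nvert Th)) : 'rV[R]_d -> R :=
  get [set phi | Vh phi /\ forall j, phi (vert j) = (i == j)%:R].

Definition Ih v : 'rV[R]_d -> R :=
  fun x => \sum_i v (vert i) * nodal_basis i x.

Definition Ph w : 'rV[R]_d -> R :=
  get [set p | Vh p /\ forall v, Vh v -> ip D p v = ip D w v].

Definition Ph_estimates (C : R) : Prop :=
  (forall (s : nat) w, (1 <= s)%N -> sobolev D s w ->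
    L2norm D (w \- Ph w) + mesh_size Th * grad_norm D (w \- Ph w) <=
      C * mesh_size Th ^+ minn 2 s * sobolev_norm D s w) /\
  (forall w, sobolev D 2 w ->
    (Linfnorm D (w \- Ph w)%R <=
      (C * mesh_size Th `^ (2 - d%:R / 2) * sobolev_norm D 2 w)%:E)%E).

End FiniteElements.

Section Stochastic.
Context {R : realType} {dO : measure_display} {Omega : measurableType dO}.
Variable P : probability Omega R.

(* Only times t >= 0 are meaningful. *)
Definition filtration (F : R -> set (set Omega)) : Prop :=
  (forall t, 0 <= t -> sigma_algebra setT (F t) /\ F t `<=` measurable) /\
  (forall s t, 0 <= s -> s <= t -> F s `<=` F t).

Definition adapted_at (G : set (set Omega)) (X : Omega -> R) : Prop :=
  forall B : set R, measurable B -> G (X @^-1` B).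

Definition wiener (F : R -> set (set Omega)) (W : R -> Omega -> R) : Prop :=
  [/\ forall t, 0 <= t -> adapted_at (F t) (W t),
      {ae P, forall om, W 0 om = 0},
      {ae P, forall om, {within `[0, +oo[, continuous (W ^~ om)}},
      forall s t (B : set R), 0 <= s -> s < t -> measurable B ->
        P ((W t \- W s) @^-1` B) = normal_prob 0 (Num.sqrt (t - s)) B
    & forall s t (A : set Omega) (B : set R), 0 <= s -> s < t -> F s A ->
        measurable B ->
        P (A `&` (W t \- W s) @^-1` B) =
          (P A * P ((W t \- W s)%R @^-1` B))%E].

Context {d : nat} (D : set 'rV[R]_d) (Th : mesh R d).

(* A V_h-valued variable is measurable (for the Borel sigma-algebra of the
   finite-dimensional space V_h) iff all its point values are. *)
Definition fe_solution (F : R -> set (set Omega)) (W : R -> Omega -> R)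
    (q : nat) (g : R -> R) (u0 : 'rV[R]_d -> R) (T : R) (N : nat)
    (u : nat -> Omega -> 'rV[R]_d -> R) : Prop :=
  let tau := T / N%:R in
  let t n := n%:R * tau in
  [/\ forall n om, (n <= N)%N -> Vh D Th (u n om),
      forall n x, (n <= N)%N -> closure D x ->
        adapted_at (F (t n)) (fun om => u n om x),
      forall om x, closure D x -> u 0%N om x = Ph D Th u0 x
    & {ae P, forall om, forall n, (n < N)%N -> forall v, Vh D Th v ->
        ip D (u n.+1 om) v + tau * grad_ip D (u n.+1 om) v =
          ip D (u n om) v
          + tau * ip D (Ih D Th (fun x => u n.+1 om x - u n.+1 om x ^+ q)) v
          + ip D (g \o u n om) v * (W (t n.+1) om - W (t n) om)}].

End Stochastic.

Definition C1 (R : realType) (g : R -> R) : Prop :=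
  (forall x, derivable g x 1) /\ continuous (derive1 g).

(* Main.v *)
(* Besides the stiffness form A and the mass form, V_h carries the lumped mass
   form (U, V)_m = sum_i m_i U_i V_i with m_i the total volume of the simplices
   at a_i; the two mass forms are equivalent uniformly in the mesh. The energy is
   Q = A + (., .)_m. Let L be the discrete Laplacian of U = u_h^{n+1}, so that the
   scheme reads U - u_h^n = tau L + tau f(U) + Delta W G with G the nodal values
   of P_h g(u_h^n). The diffusion contributes Q(L, U) = - |L|^2 + (L, U)_m; by the
   cotangent formula the mesh assumption says that the off-diagonal entries of A
   are nonpositive, hence A(U^q, U) >= 0; and - (U^q, U)_m absorbs all the
   remaining quadratic terms, since k x^2 - x^{q+1} is bounded above. Therefore,
   for every tau,
     Q(U, U) <= Q(u_h^n, u_h^n) + c tau + 2 Delta W Q(G, u_h^n) + Delta W^2 Q(G, G),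
   and the H^1 stability of P_h, together with the chain rule for g(u_h^n), bounds
   Q(G, G) by a multiple of Y_n := 1 + Q(u_h^n, u_h^n). So
     Y_{n+1} <= Y_n (1 + a tau + b Delta W^2 + 2 xi Delta W)
   with xi bounded and F_{t_n}-measurable. Since Delta W is Gaussian and
   independent of F_{t_n}, E[Y_{n+1}^{2m}] <= (1 + K tau) E[Y_n^{2m}], and it
   remains to iterate. *)
Require Import Defs.
From HB Require Import structures.
From mathcomp Require Import all_boot all_order all_algebra.
From mathcomp Require Import all_classical all_reals all_analysis.
From mathcomp Require Import measurable_realfun ring lra.

Set Implicit Arguments.
Unset Strict Implicit.
Unset Printing Implicit Defensive.
Import Order.TTheory GRing.Theory Num.Theory.
Import numFieldNormedType.Exports.
Local Open Scope classical_set_scope.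
Local Open Scope ring_scope.

(** * Lebesgue measure on row vectors *)

(** Weak derivatives, the nodal basis and the projection are all chosen by [get], so each must be
    identified before it can be computed with: weak gradients only almost everywhere, which calls
    for the fundamental lemma of the calculus of variations and for a chain rule for g(u_h); the
    projection by inverting the mass matrix. Volumes enter through affine changes of variables. The
    energy uses the lumped form because the reaction is interpolated: its nodal values then appear
    one vertex at a time, and the only uniformity in the mesh to be proved is the comparison with
    the L^2 form, with constant [c0]. The H^1 stability of the projection is the case s = 1 of the
    assumed estimates, divided by h. In place of conditional expectations, the joint law of the past
    and of an increment is a product measure, to which Fubini's theorem applies. Only even integer
    moments are propagated; since Y_n >= 1, one of them dominates the p-th. Every constant is fixed
    before the mesh and the time step. *)

Lemma measurable_fun_rV d (T : measurableType d) (R : realType) n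
    (D : set T) (f : T -> 'rV[R]_n) :
  (forall i, measurable_fun D (fun t => f t ord0 i)) -> measurable_fun D f.
Proof.
move=> mf mD Y mY.
set coord := fun (i : 'I_n) (x : 'rV[R]_n) => x ord0 i.
have sub : g_sigma_preimage coord `<=` [set B | measurable (D `&` f @^-1` B)].
  apply: smallest_sub => /=.
    split => /=; first by rewrite preimage_set0 setI0.
    - move=> A mA; rewrite setTD (_ : _ `&` _ = D `\` (D `&` f @^-1` A)).
        exact: measurableD.
      by apply/seteqP; split=> x /=; tauto.
    - move=> F mF; rewrite preimage_bigcup setI_bigcupr.
      by apply: bigcupT_measurable => k; exact: mF.
  rewrite -bigcup_seq => B [i _ [C mC <-]] /=.
  by rewrite setTI -comp_preimage; exact: mf.
exact: sub.
Qed.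

Definition rV_init (R : realType) n (x : 'rV[R]_n.+1) : 'rV[R]_n :=
  \row_i x ord0 (lift ord_max i).

Lemma rV_snocK_init (R : realType) n (z : 'rV[R]_n * R) :
  rV_init (rV_snoc z) = z.1.
Proof. by apply/rowP => i; rewrite !mxE liftK. Qed.

Lemma rV_snocK_last (R : realType) n (z : 'rV[R]_n * R) :
  rV_snoc z ord0 ord_max = z.2.
Proof. by rewrite mxE unlift_none. Qed.

Lemma rV_snoc_lift (R : realType) n (z : 'rV[R]_n * R) i :
  rV_snoc z ord0 (lift ord_max i) = z.1 ord0 i.
Proof. by rewrite mxE liftK. Qed.

Lemma rV_snocE (R : realType) n (x : 'rV[R]_n.+1) :
  x = rV_snoc (rV_init x, x ord0 ord_max).
Proof.
apply/rowP => i; rewrite mxE; case: unliftP => [j ->|->] //=.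
by rewrite mxE.
Qed.

Lemma leb_snocX (R : realType) n (A : set 'rV[R]_n) (B : set R) :
  measurable A -> measurable (B : set (measurableTypeR R)) ->
  leb n.+1 [set x | A (rV_init x) /\ B (x ord0 ord_max)] =
  (leb n A * lebesgue_measure B)%E.
Proof.
move=> mA mB; rewrite -(product_measure1E (leb n) lebesgue_measure mA mB).
rewrite /= /lebesgue_snoc /pushforward; congr (_ _).
by apply/seteqP; split => -[x y]; rewrite /= rV_snocK_init rV_snocK_last.
Qed.

Definition rV_box (R : realType) n (a b : 'rV[R]_n) : set 'rV[R]_n :=
  [set x | forall i, a ord0 i <= x ord0 i <= b ord0 i].

Lemma measurable_coord_preim (R : realType) n (i : 'I_n) (B : set (measurableTypeR R)) :
  measurable B -> measurable [set x : 'rV[R]_n | B (x ord0 i)].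
Proof.
move=> mB; rewrite -[X in measurable X]setTI.
exact: (measurable_rV_coord i).
Qed.

Lemma measurable_forall_fin d (T : measurableType d) (I : finType) (F : I -> set T) :
  (forall i, measurable (F i)) -> measurable [set x | forall i, F i x].
Proof.
move=> mF; rewrite (_ : mkset _ = \bigcap_(i in [set` I]) F i); last first.
  by apply/seteqP; split => [x Fx i _|x Fx i] //; exact: Fx.
by apply: fin_bigcap_measurable.
Qed.

Lemma rV_boxE (R : realType) n (a b : 'rV[R]_n) :
  rV_box a b = [set x | forall i, `[a ord0 i, b ord0 i]%classic (x ord0 i)].
Proof.
by apply/seteqP; split => x xab i; have := xab i; rewrite /= in_itv.
Qed.

Lemma measurable_rV_box (R : realType) n (a b : 'rV[R]_n) :
  measurable (rV_box a b).
Proof.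
rewrite rV_boxE; apply: (@measurable_forall_fin _ _ _ (fun i => [set x : 'rV[R]_n | `[a ord0 i, b ord0 i]%classic (x ord0 i)])) => i.
exact: measurable_coord_preim.
Qed.

Lemma leb_box (R : realType) n (a b : 'rV[R]_n) :
  (forall i, a ord0 i <= b ord0 i) ->
  leb n (rV_box a b) = (\prod_(i < n) (b ord0 i - a ord0 i))%:E.
Proof.
elim: n a b => [|n IH] a b ab.
  by rewrite big_ord0 /= /dirac indicE mem_set//; case.
rewrite (_ : rV_box a b = [set x | rV_box (rV_init a) (rV_init b) (rV_init x)
    /\ `[a ord0 ord_max, b ord0 ord_max]%classic (x ord0 ord_max)]); last first.
  apply/seteqP; split => [x xab|x [xab]].
    by split=> [i|]; [rewrite !mxE; exact: xab|rewrite /= in_itv; exact: xab].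
  rewrite /= in_itv /= => xm i; case: (unliftP ord_max i) => [j ->|->//].
  by have := xab j; rewrite !mxE.
rewrite leb_snocX//; last exact: measurable_rV_box.
rewrite IH => [|i]; last by rewrite !mxE.
rewrite lebesgue_measure_itv /= lte_fin.
have -> : (if a ord0 ord_max < b ord0 ord_max
  then ((b ord0 ord_max)%:E - (a ord0 ord_max)%:E)%E else 0%E) =
    (b ord0 ord_max - a ord0 ord_max)%:E.
  case: ltP => // h; have -> : b ord0 ord_max = a ord0 ord_max.
    by apply/eqP; rewrite eq_le h ab.
  by rewrite subrr.
rewrite -EFinM big_ord_recr /=; congr (_ * _)%:E.
apply: eq_bigr => i _; rewrite !mxE; congr (b _ _ - a _ _);
  by apply: val_inj; rewrite /= /bump leqNgt ltn_ord.
Qed.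

Lemma leb_sigma_finite (R : realType) n :
  sigma_finite setT (leb n : set 'rV[R]_n -> \bar R).
Proof.
exists (fun k => rV_box (const_mx (- k%:R)) (const_mx k%:R)).
  apply/seteqP; split=> // x _.
  have [k kx] : exists k : nat, forall i, `|x ord0 i| <= k%:R.
    pose m := \big[Num.max/0]_i `|x ord0 i|.
    exists (Num.trunc m).+1 => i; apply: (@le_trans _ _ m).
      by rewrite /m; exact: le_bigmax.
    by apply: ltW; exact: truncnS_gt.
  by exists k => // i; rewrite !mxE -ler_norml kx.
move=> k; split; first exact: measurable_rV_box.
rewrite leb_box ?ltry// => i.
by rewrite !mxE lerNl (le_trans _ (ler0n _ k))// oppr_le0.
Qed.

(** A named copy of [leb] to which sigma-finiteness can be attached; Fubini's theorem is always
    applied with it as first factor. *)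
Definition lebf (R : realType) n : set 'rV[R]_n -> \bar R := leb n.

HB.instance Definition _ (R : realType) n :=
  Measure.copy (@lebf R n) (@leb R n).
HB.instance Definition _ (R : realType) n :=
  @Measure_isSigmaFinite.Build _ _ _ (@lebf R n) (@leb_sigma_finite R n).

Lemma measurable_rV_snoc_comp d (T' : measurableType d) (R : realType) n
    (f : 'rV[R]_n.+1 -> T') :
  measurable_fun setT f ->
  measurable_fun setT (fun z : 'rV[R]_n * measurableTypeR R => f (rV_snoc z)).
Proof. by move=> mf; apply: measurableT_comp => //; exact: measurable_rV_snoc. Qed.

Lemma leb_integral_snoc (R : realType) n (f : 'rV[R]_n.+1 -> \bar R) :
  measurable_fun setT f -> (forall x, 0 <= f x)%E ->
  (\int[leb n.+1]_x f x =
   \int[leb n]_x \int[lebesgue_measure]_y f (rV_snoc (x, y)))%E.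
Proof.
move=> mf f0.
transitivity (\int[(leb n \x lebesgue_measure)%E]_z (f \o @rV_snoc R n) z)%E.
  rewrite /= /lebesgue_snoc.
  rewrite (ge0_integral_pushforward (@measurable_rV_snoc R n)
    (leb n \x lebesgue_measure)%E measurableT)//.
exact: (fubini_tonelli1 (m1 := @lebf R n) (fun z => f (rV_snoc z))
  (measurable_rV_snoc_comp mf) (fun z => f0 _)).
Qed.

Lemma leb_integral_snoc2 (R : realType) n (f : 'rV[R]_n.+1 -> \bar R) :
  measurable_fun setT f -> (forall x, 0 <= f x)%E ->
  (\int[leb n.+1]_x f x =
   \int[lebesgue_measure]_y \int[leb n]_x f (rV_snoc (x, y)))%E.
Proof.
move=> mf f0; rewrite leb_integral_snoc//.
exact: (fubini_tonelli (m1 := @lebf R n) (fun z => f (rV_snoc z))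
  (measurable_rV_snoc_comp mf) (fun z => f0 _)).
Qed.

Notation pushforward_measure :=
  measure_function_pushforward__canonical__measure_function_Measure.

(** By uniqueness of Lebesgue measure it is enough to compare both sides on half-open intervals; for
    negative [a] the preimage is half-open on the other side. *)
Lemma lebesgue_measure_affine (R : realType) (a t : R) (A : set R) : a != 0 ->
  measurable (A : set (measurableTypeR R)) ->
  lebesgue_measure A =
  (`|a|%:E * lebesgue_measure ((fun x => (a * x + t)%R) @^-1` A))%E.
Proof.
move=> a0 mA.
have mf : measurable_fun [set: measurableTypeR R]
    (fun x => (a * x + t)%R : measurableTypeR R).
  by apply: measurable_funD => //; exact: measurable_funM.
have na : 0 <= `|a| by [].
apply: (lebesgue_measure_unique (mu := mscale (NngNum na)
  
  (pushforward_measure lebesgue_measure mf))) => // _ [[x y] ab <-] /=.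
rewrite /mscale /= /pushforward.
have [xy|yx] := ltP x y; last first.
  by rewrite set_itv_ge ?bnd_simp -?leNgt// preimage_set0 !measure0 mule0.
rewrite lebesgue_measure_itv /= lte_fin xy.
have [a_gt0|a_lt0|/eqP] := ltgtP a 0; last by rewrite (negbTE a0).
- rewrite [X in lebesgue_measure X](_ : _ = `[(y - t) / a, (x - t) / a[%classic).
    rewrite lebesgue_measure_itv /= lte_fin ltr_nM2r ?invr_lt0// ltrD2r xy.
    rewrite -!EFinB -EFinM ltr0_norm//; congr EFin.
    by field.
  apply/seteqP; split => z /=; rewrite !in_itv /= ler_ndivrMr// ltr_ndivlMr//;
    rewrite [a * z]mulrC ltrBlDr lerBrDr andbC; exact.
- rewrite [X in lebesgue_measure X](_ : _ = `](x - t) / a, (y - t) / a]%classic).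
    rewrite lebesgue_measure_itv /= lte_fin ltr_pM2r ?invr_gt0// ltrD2r xy.
    rewrite -!EFinB -EFinM gtr0_norm//; congr EFin.
    by field.
  apply/seteqP; split => z /=; rewrite !in_itv /= ler_pdivlMr// ltr_pdivrMr//;
    rewrite [a * z]mulrC ltrBlDr lerBrDr; exact.
Qed.

Lemma lebesgue_integral_affine (R : realType) (a t : R) (f : R -> \bar R) :
  a != 0 -> measurable_fun setT f -> (forall x, 0 <= f x)%E ->
  (\int[lebesgue_measure]_x f x =
   `|a|%:E * \int[lebesgue_measure]_x f (a * x + t)%R)%E.
Proof.
move=> a0 mf f0.
have mg : measurable_fun [set: measurableTypeR R]
    (fun x => (a * x + t)%R : measurableTypeR R).
  by apply: measurable_funD => //; exact: measurable_funM.
have na : 0 <= `|a| by [].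
pose nu := mscale (NngNum na) 
  (pushforward_measure lebesgue_measure mg).
transitivity (\int[nu]_x f x)%E.
  by apply: eq_measure_integral => A mA _; exact: lebesgue_measure_affine.
rewrite ge0_integral_mscale//=; congr (_ * _)%E.
by rewrite (ge0_integral_pushforward mg lebesgue_measure measurableT).
Qed.

(** * Square matrices with the last row and column split off *)

Section block_cast.
Context {R : realType} (n : nat).

(** Blocks matching [rV_snoc]; the cast goes from size n + 1, where [block_mx] lives, to size
    n.+1. *)
Definition snoc_mx (B : 'M[R]_n) (c : 'cV[R]_n) (r : 'rV[R]_n) (a : R) : 'M[R]_n.+1 :=
  castmx (addn1 n, addn1 n) (block_mx B c r a%:M).

Lemma det_cast m m' (e : m = m') (M : 'M[R]_m) : \det (castmx (e, e) M) = \det M.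
Proof. by case: _ / e; rewrite castmx_id. Qed.

Lemma mulmx_castr m m' p (e : m = m') (x : 'M[R]_(p, m)) (M : 'M[R]_m) :
  castmx (erefl p, e) x *m castmx (e, e) M = castmx (erefl p, e) (x *m M).
Proof. by case: _ / e; rewrite !castmx_id. Qed.

Lemma mulmx_cast m m' (e : m = m') (x : 'M[R]_m) (M : 'M[R]_m) :
  castmx (e, e) x *m castmx (e, e) M = castmx (e, e) (x *m M).
Proof. by case: _ / e; rewrite !castmx_id. Qed.

Lemma rV_snoc_castE (x : 'rV[R]_n) (y : R) :
  rV_snoc (x, y) = castmx (erefl 1%N, addn1 n) (row_mx x y%:M).
Proof.
apply/rowP => i; rewrite castmxE /=.
have -> : cast_ord (esym (erefl 1%N)) ord0 = ord0 by apply: val_inj.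
case: (unliftP ord_max i) => [j ->|->].
  rewrite rV_snoc_lift /= (_ : cast_ord _ _ = lshift 1 j) ?row_mxEl//.
  by apply: val_inj; rewrite /= /bump leqNgt ltn_ord.
rewrite rV_snocK_last /= (_ : cast_ord _ _ = rshift n ord0) ?row_mxEr ?mxE ?eqxx ?mulr1n//.
by apply: val_inj; rewrite /= addn0.
Qed.

Lemma mulmx_snoc (B : 'M[R]_n) c r a x y :
  rV_snoc (x, y) *m snoc_mx B c r a =
  rV_snoc (x *m B + y *: r, (x *m c) ord0 ord0 + y * a).
Proof.
rewrite !rV_snoc_castE mulmx_castr mul_row_block; congr (castmx _ (row_mx _ _)).
  by rewrite mul_scalar_mx.
rewrite mul_scalar_mx; apply/matrixP => i j; rewrite !mxE !ord1 eqxx !mulr1n.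
by [].
Qed.

Lemma snoc_mxE (M : 'M[R]_n.+1) :
  exists B c r a, M = snoc_mx B c r a.
Proof.
pose N := castmx (esym (addn1 n), esym (addn1 n)) M.
exists (ulsubmx N), (ursubmx N), (dlsubmx N), (drsubmx N ord0 ord0).
by rewrite /snoc_mx -mx11_scalar submxK /N castmxKV.
Qed.

Lemma snoc_mxM B c r a B' c' r' a' :
  snoc_mx B c r a *m snoc_mx B' c' r' a' =
  snoc_mx (B *m B' + c *m r') (B *m c' + a' *: c) (r *m B' + a *: r')
    ((r *m c') ord0 ord0 + a * a').
Proof.
rewrite /snoc_mx mulmx_cast mulmx_block; congr (castmx _ (block_mx _ _ _ _)).
- by rewrite mul_mx_scalar.
- by rewrite mul_scalar_mx.
- by rewrite {1}[r *m c']mx11_scalar -scalar_mxM raddfD.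
Qed.

Lemma det_snoc_ublock B c a : \det (snoc_mx B c 0 a) = \det B * a.
Proof. by rewrite det_cast det_ublock det_scalar1. Qed.

Lemma det_snoc_lblock B r a : \det (snoc_mx B 0 r a) = \det B * a.
Proof. by rewrite det_cast det_lblock det_scalar1. Qed.

(** With a zero corner, a zero last row would make the determinant vanish; and r r^T is the sum of
    the squares of the entries of r. *)
Lemma snoc_mx_unit_row B c r : \det (snoc_mx B c r 0) != 0 -> r *m r^T != 0.
Proof.
apply: contra_neq => rr0.
suff -> : r = 0 by rewrite det_snoc_ublock mulr0.
apply/rowP => i; apply/eqP; rewrite mxE -sqrf_eq0; apply/eqP.
have : (r *m r^T) ord0 ord0 = 0 by rewrite rr0 mxE.
rewrite mxE; under eq_bigr do rewrite mxE -expr2.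
by move/psumr_eq0P => -> // j _; exact: sqr_ge0.
Qed.

End block_cast.

(** * Affine change of variables *)

Section leb_affine.
Context {R : realType}.

Lemma measurable_mulmx_addr m n (A : 'M[R]_(m, n)) (t : 'rV[R]_n) :
  measurable_fun setT (fun x : 'rV[R]_m => x *m A + t).
Proof.
apply: measurable_fun_rV => i.
rewrite (_ : (fun _ => _) = fun x : 'rV[R]_m => \sum_j x ord0 j * A j i + t ord0 i); last first.
  by apply/funext => x; rewrite !mxE.
apply: measurable_funD => //; apply: measurable_sum => j.
by apply: measurable_funM => //; exact: measurable_rV_coord.
Qed.

Lemma measurable_addr_rV n (t : 'rV[R]_n) :
  measurable_fun setT (fun x : 'rV[R]_n => x + t).
Proof.
have := measurable_mulmx_addr 1%:M t.
by under eq_fun do rewrite mulmx1.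
Qed.

Lemma measurable_snoc_part n (f : 'rV[R]_n.+1 -> \bar R) :
  measurable_fun setT f -> (forall x, 0 <= f x)%E ->
  measurable_fun setT (fun y : measurableTypeR R => \int[leb n]_x f (rV_snoc (x, y)))%E.
Proof.
move=> mf f0; exact: (measurable_fun_fubini_tonelli_G (m1 := @lebf R n)
  (fun z => f (rV_snoc z)) (measurable_rV_snoc_comp mf) (fun z => f0 _)).
Qed.

Lemma measurable_snoc_section n (f : 'rV[R]_n.+1 -> \bar R) (x : 'rV[R]_n) :
  measurable_fun setT f ->
  measurable_fun setT (fun y : measurableTypeR R => f (rV_snoc (x, y))).
Proof.
by move=> mf; have /measurable_fun_pair2 := measurable_rV_snoc_comp mf; exact.
Qed.

Lemma measurable_snoc_section2 n (f : 'rV[R]_n.+1 -> \bar R) (y : R) :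
  measurable_fun setT f ->
  measurable_fun setT (fun x : 'rV[R]_n => f (rV_snoc (x, y))).
Proof.
by move=> mf; have /measurable_fun_pair1 := measurable_rV_snoc_comp mf; exact.
Qed.

(** Induction on the dimension: the last coordinate is shifted by the one-dimensional case, the
    others under the integral. *)
Lemma leb_integral_translation n (t : 'rV[R]_n) (f : 'rV[R]_n -> \bar R) :
  measurable_fun setT f -> (forall x, 0 <= f x)%E ->
  (\int[leb n]_x f x = \int[leb n]_x f (x + t)%R)%E.
Proof.
elim: n t f => [|n IH] t f mf f0.
  by apply: eq_integral => x _; congr f; apply/rowP => -[].
have mft : measurable_fun setT (fun x : 'rV[R]_n.+1 => f (x + t)).
  exact: measurableT_comp mf (measurable_addr_rV t).
rewrite (leb_integral_snoc2 mf f0) (leb_integral_snoc2 mft (fun _ => f0 _)).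
transitivity (\int[lebesgue_measure]_(y in [set: R])
    \int[leb n]_x f (rV_snoc (x, y + t ord0 ord_max)%R))%E.
  rewrite (lebesgue_integral_affine (t ord0 ord_max) (oner_neq0 _))//.
  - rewrite normr1 mul1e; apply: eq_integral => y _.
    by rewrite mul1r.
  - exact: measurable_snoc_part.
  - by move=> y; exact: integral_ge0.
apply: eq_integral => y _.
rewrite (IH (rV_init t))//; last exact: measurable_snoc_section2.
apply: eq_integral => x _; congr f.
rewrite [RHS]rV_snocE; congr rV_snoc; congr pair.
  by apply/rowP => i; rewrite !mxE liftK.
by rewrite mxE rV_snocK_last.
Qed.

(* Induction through the Schur complement of the last diagonal entry, which a
   shear makes nonzero if needed. *)
Lemma leb_integral_linear n (A : 'M[R]_n) (f : 'rV[R]_n -> \bar R) :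
  A \in unitmx -> measurable_fun setT f -> (forall x, 0 <= f x)%E ->
  (\int[leb n]_x f x = `|\det A|%:E * \int[leb n]_x f (x *m A))%E.
Proof.
elim: n A f => [|n IH] A f uA mf f0.
  rewrite det_mx00 normr1 mul1e.
  by apply: eq_integral => x _; congr f; apply/rowP => -[].
pose good (M : 'M[R]_n.+1) := forall f : 'rV[R]_n.+1 -> \bar R,
  measurable_fun setT f -> (forall x, 0 <= f x)%E ->
  (\int[leb n.+1]_x f x = `|\det M|%:E * \int[leb n.+1]_x f (x *m M))%E.
have mcomp (M : 'M[R]_n.+1) (h : 'rV[R]_n.+1 -> \bar R) :
    measurable_fun setT h -> measurable_fun setT (fun x => h (x *m M)).
  move=> mh; apply: measurableT_comp => //.
  have := measurable_mulmx_addr M 0.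
  by under eq_fun do rewrite addr0.
have goodM M1 M2 : good M1 -> good M2 -> good (M1 *m M2).
  move=> g1 g2 h mh h0; rewrite g2// g1//; last exact: mcomp.
  rewrite muleA det_mulmx normrM mulrC EFinM; congr (_ * _)%E.
  by apply: eq_integral => x _; rewrite mulmxA.
(* A shear: for fixed leading coordinates x, the last one is translated by x c. *)
have goodU c : good (snoc_mx 1%:M c 0 1).
  move=> h mh h0; rewrite det_snoc_ublock det1 mulr1 normr1 mul1e.
  rewrite (leb_integral_snoc mh h0) (leb_integral_snoc (mcomp _ _ mh) (fun _ => h0 _)).
  apply: eq_integral => x _.
  rewrite (lebesgue_integral_affine ((x *m c) ord0 ord0) (oner_neq0 _))//; last first.
    exact: measurable_snoc_section.
  rewrite normr1 mul1e; apply: eq_integral => y _.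
  by rewrite mulmx_snoc mulmx1 scaler0 addr0 mulr1 mul1r addrC.
(* With the last coordinate y integrated outermost, y is scaled by a; inside, the leading
   coordinates are translated by y r and transformed by B, where the induction hypothesis
   applies. *)
have goodL B r a : B \in unitmx -> a != 0 -> good (snoc_mx B 0 r a).
  move=> uB a0 h mh h0; rewrite det_snoc_lblock normrM EFinM.
  rewrite (leb_integral_snoc2 mh h0) (leb_integral_snoc2 (mcomp _ _ mh) (fun _ => h0 _)).
  have g0 y : (0 <= \int[leb n]_x h (rV_snoc (x, y)))%E by exact: integral_ge0.
  rewrite (lebesgue_integral_affine 0 a0 (measurable_snoc_part mh h0) g0).
  rewrite [(`|\det B|%:E * _)%E]muleC -muleA; congr (_ * _)%E.
  rewrite -ge0_integralZl//; last 2 first.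
    exact: measurable_snoc_part (mcomp _ _ mh) (fun _ => h0 _).
    by move=> y _; exact: integral_ge0.
  apply: eq_integral => y _; rewrite addr0.
  rewrite (leb_integral_translation (y *: r))//; last exact: measurable_snoc_section2.
  rewrite (IH B)//; last first.
    exact: measurableT_comp (measurable_snoc_section2 (a * y) mh)
      (measurable_addr_rV (y *: r)).
  congr (_ * _)%E; apply: eq_integral => x _; congr h.
  by rewrite mulmx_snoc mulmx0 mxE add0r mulrC.
suff: good A by apply.
(* For a nonzero corner a, M is a shear times a lower block matrix whose leading block is the Schur
   complement B - c r / a. *)
have goodA M : M \in unitmx -> (exists B c r a, a != 0 /\ M = snoc_mx B c r a) -> good M.
  move=> uM [B [c [r [a [a0 ME]]]]].
  have E : M = snoc_mx 1%:M (a^-1 *: c) 0 1 *m snoc_mx (B - a^-1 *: (c *m r)) 0 r a.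
    rewrite ME snoc_mxM !mul1mx -scalemxAl subrK mulmx0 add0r scalerA.
    by rewrite divff// !scale1r mul0mx add0r mxE add0r mul1r.
  rewrite E; apply: goodM; first exact: goodU.
  apply: goodL => //; move: uM; rewrite !unitmxE !unitfE E det_mulmx.
  by rewrite det_snoc_lblock !mulf_eq0 !negb_or => /andP[_ /andP[]].
have [B [c [r [a E]]]] := snoc_mxE A.
have [a0|a0] := eqVneq a 0; last by apply: goodA => //; exists B, c, r, a.
have dA : \det A != 0 by rewrite -unitfE -unitmxE.
have rr : (r *m r^T) ord0 ord0 != 0.
  apply: contraTneq dA => rr0; rewrite E a0 negbK.
  apply: contraT => /snoc_mx_unit_row; rewrite (_ : _ *m _ = 0) ?eqxx//.
  by rewrite [LHS]mx11_scalar rr0 raddf0.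
(* The corner is zero: the shear with column r^T puts r r^T there, which is nonzero, and the
   opposite shear undoes it. *)
have -> : A = (A *m snoc_mx 1%:M r^T 0 1) *m snoc_mx 1%:M (- r^T) 0 1.
  rewrite -mulmxA snoc_mxM !mulmx1 !mul1mx mulmx0 addr0 scale1r.
  rewrite addNr scaler0 add0r mul0mx mxE add0r mulr1.
  rewrite (_ : snoc_mx _ _ _ _ = 1%:M) ?mulmx1//.
  by rewrite /snoc_mx -scalar_mx_block; case: _ / (addn1 n); rewrite castmx_id.
apply: goodM; last exact: goodU.
apply: goodA.
  rewrite unitmx_mul uA unitmxE det_snoc_ublock det1 mulr1.
  exact: unitr1.
rewrite E snoc_mxM; do 4 eexists; split; last reflexivity.
by rewrite a0 mulr1 addr0.
Qed.

Lemma leb_integral_affine n (A : 'M[R]_n) (t : 'rV[R]_n) (f : 'rV[R]_n -> \bar R) :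
  A \in unitmx -> measurable_fun setT f -> (forall x, 0 <= f x)%E ->
  (\int[leb n]_x f x = `|\det A|%:E * \int[leb n]_x f (x *m A + t)%R)%E.
Proof.
move=> uA mf f0; rewrite (leb_integral_translation t)//.
rewrite (leb_integral_linear uA)//.
exact: measurableT_comp mf (measurable_addr_rV t).
Qed.

Lemma leb_affine n (A : 'M[R]_n) (t : 'rV[R]_n) (S : set 'rV[R]_n) :
  A \in unitmx -> measurable S ->
  (leb n S = `|\det A|%:E * leb n ((fun x => x *m A + t)%R @^-1` S))%E.
Proof.
move=> uA mS.
have m1 : measurable_fun setT (EFin \o \1_S : 'rV[R]_n -> \bar R).
  by apply/measurable_EFinP; exact: measurable_indic.
have mpre : measurable ((fun x => x *m A + t)%R @^-1` S).
  by rewrite -[X in measurable X]setTI; exact: measurable_mulmx_addr.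
rewrite -{1}(setIT S) -integral_indic//.
rewrite (leb_integral_affine t uA m1) => [|x]; last by rewrite lee_fin.
congr (_ * _)%E.
by rewrite -[in RHS](setIT (_ @^-1` _)) -[RHS]integral_indic.
Qed.

End leb_affine.

(** * Open sets, bounded sets and hyperplanes *)

Lemma indic_iff (R : numDomainType) (T T' : Type) (A : set T) (B : set T') x y :
  (A x <-> B y) -> \1_A x = \1_B y :> R.
Proof.
by move=> AB; rewrite !indicE; congr (nat_of_bool _)%:R; apply/idP/idP; rewrite !inE => /AB.
Qed.

Lemma coord_le_norm (R : realType) n (x : 'rV[R]_n) i : `|x ord0 i| <= `|x|.
Proof.
rewrite /Num.Def.normr /= mx_normrE.
exact: (le_bigmax _ (fun ij : 'I_1 * 'I_n => `|x ij.1 ij.2|) (ord0, i)).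
Qed.

Lemma rV_ballP (R : realType) n (x y : 'rV[R]_n) e :
  0 < e -> ball x e y <-> forall i, `|x ord0 i - y ord0 i| < e.
Proof.
move=> e0; split=> [[_ h] i|h]; first exact: h.
by split=> // i j; rewrite ord1; exact: h.
Qed.

Lemma measurable_rV_ball (R : realType) n (x : 'rV[R]_n) e :
  0 < e -> measurable (ball x e).
Proof.
move=> e0; rewrite (_ : ball x e =
    [set y | forall i, (ball (x ord0 i) e : set R) (y ord0 i)]); last first.
  by apply/seteqP; split=> y /rV_ballP; apply.
apply: (@measurable_forall_fin _ _ _
  (fun i => [set y : 'rV[R]_n | (ball (x ord0 i) e : set R) (y ord0 i)])) => i.
by apply: measurable_coord_preim; exact: measurable_ball.
Qed.

Definition rat_center (R : realType) n (z : 'rV[rat]_n * nat) : 'rV[R]_n :=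
  map_mx ratr z.1.

Definition rat_radius (R : realType) n (z : 'rV[rat]_n * nat) : R := z.2.+1%:R^-1.

Lemma rat_radius_gt0 (R : realType) n (z : 'rV[rat]_n * nat) : 0 < rat_radius R z.
Proof. by rewrite invr_gt0. Qed.

(** The index set asks for the closed cube, not just the open ball, to lie in U: the fundamental
    lemma below needs compact cubes inside the domain. *)
Lemma open_rV_bigcup_rat (R : realType) n (U : set 'rV[R]_n) : open U ->
  U = \bigcup_(z in [set z | rV_box (rat_center R z - const_mx (rat_radius R z))
                                   (rat_center R z + const_mx (rat_radius R z)) `<=` U])
        ball (rat_center R z) (rat_radius R z).
Proof.
move=> oU; apply/seteqP; split=> [x Ux|x [z /= zU] zx]; last first.
  apply: zU => i; rewrite !mxE; move/rV_ballP: zx => /(_ (rat_radius_gt0 _ _) i).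
  by rewrite mxE ltr_distlC => /andP[h1 h2]; rewrite !ltW.
have /nbhs_ballP[e /= e0 eU] := open_nbhs_nbhs (conj oU Ux).
(* A rational center within r of x has its closed cube of radius r within 2 r < e of x. *)
have [k _ ke] := near_infty_natSinv_lt (PosNum (divr_gt0 e0 (ltr0Sn R 1))).
have {}ke : k.+1%:R^-1 < e / 2 :> R by have /= := ke k; apply.
pose r : R := k.+1%:R^-1.
have r0 : 0 < r by rewrite invr_gt0.
have /choice[q qx] i : exists q : rat, ratr q \in `]x ord0 i - r, x ord0 i + r[.
  by apply: rat_in_itvoo; rewrite ltrD2l gtrN.
have rE : rat_radius R (\row_i q i, k) = r by [].
exists (\row_i q i, k); last first.
  apply/rV_ballP => // i; rewrite !mxE /= rE ltr_distlC.
  by have := qx i; rewrite in_itv /= => /andP[h1 h2]; apply/andP; split; lra.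
move=> y /= yz; apply: eU; apply/rV_ballP => // i.
have := yz i; have := qx i; rewrite !mxE !rE in_itv /= => /andP[h1 h2] /andP[h3 h4].
by rewrite ltr_distlC; apply/andP; split; rewrite -/r in ke; lra.
Qed.

Lemma open_measurable_rV (R : realType) n (U : set 'rV[R]_n) :
  open U -> measurable U.
Proof.
move=> /open_rV_bigcup_rat ->; rewrite bigcup_mkcond.
apply: countable_bigcupT_measurable => [|z]; first exact: countableP.
by case: ifPn => // _; apply: measurable_rV_ball; exact: rat_radius_gt0.
Qed.

Lemma continuous_measurable_rV (R : realType) n (f : 'rV[R]_n -> R) :
  continuous f -> measurable_fun setT f.
Proof.
move=> cf; apply: (measurability _ (RGenOInfty.measurableE R)) => //.
move=> _ [_ [x ->] <-]; rewrite setTI; apply: open_measurable_rV.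
have /continuousP := cf; apply; exact: rray_open.
Qed.

Lemma leb_open_gt0 (R : realType) n (U : set 'rV[R]_n) x :
  open U -> U x -> (0 < leb n U)%E.
Proof.
move=> oU Ux; have /nbhs_ballP[e /= e0 eU] := open_nbhs_nbhs (conj oU Ux).
pose b : 'rV[R]_n := const_mx (e / 2).
have e20 : 0 < e / 2 by rewrite divr_gt0.
apply: (@lt_le_trans _ _ (leb n (rV_box (x - b) (x + b)))).
  rewrite leb_box => [|i]; last by rewrite !mxE; lra.
  by rewrite lte_fin prodr_gt0// => i _; rewrite !mxE; lra.
apply: le_measure; rewrite ?inE; [exact: measurable_rV_box|exact: open_measurable_rV|].
move=> y xy; apply: eU; apply/rV_ballP => // i; have := xy i; rewrite !mxE => /andP[h1 h2].
rewrite ltr_distlC; apply/andP; split; lra.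
Qed.

Lemma bounded_sub_box (R : realType) n (D : set 'rV[R]_n) :
  bounded_set D -> exists2 M : R, 0 < M & D `<=` rV_box (const_mx (- M)) (const_mx M).
Proof.
move=> [M [_ DM]]; exists (`|M| + 1); first by rewrite ltr_wpDl.
move=> x Dx i; rewrite !mxE -ler_norml; apply: le_trans (coord_le_norm _ _) _.
by apply: DM Dx; rewrite (le_lt_trans (ler_norm M))// ltrDl.
Qed.

Lemma leb_bounded_lty (R : realType) n (D : set 'rV[R]_n) :
  measurable D -> bounded_set D -> (leb n D < +oo)%E.
Proof.
move=> mD /bounded_sub_box[M M0 DM].
apply: (@le_lt_trans _ _ (leb n (rV_box (const_mx (- M)) (const_mx M)))).
  by apply: le_measure => //; rewrite inE//; exact: measurable_rV_box.
by rewrite leb_box ?ltry// => i; rewrite !mxE lerNl (le_trans _ (ltW M0))// oppr_le0 ltW.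
Qed.

Lemma measurable_dot (R : realType) n (c : 'rV[R]_n) :
  measurable_fun setT (fun x => dot c x).
Proof.
apply: measurable_sum => i; apply: measurable_funM => //.
exact: measurable_rV_coord.
Qed.

Lemma continuous_sumr (R : realType) (T : topologicalType) (I : finType)
    (f : I -> T -> R) :
  (forall i, continuous (f i)) -> continuous (fun x => \sum_i f i x).
Proof.
move=> cf; elim: (index_enum I) => [|i s IH].
  by under eq_fun do rewrite big_nil; exact: cst_continuous.
under eq_fun do rewrite big_cons.
by move=> x; apply: cvgD; [exact: cf|exact: IH].
Qed.

Lemma continuous_dot (R : realType) n (c : 'rV[R]_n) :
  continuous (fun x => dot c x).
Proof.
apply: continuous_sumr => i x.
by apply: (@continuousM _ _ (cst (c ord0 i)) (fun y : 'rV[R]_n => y ord0 i));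
  [exact: cst_continuous|exact: coord_continuous].
Qed.

(** Slicing by the last coordinate: if its coefficient vanishes, the slices are hyperplanes of lower
    dimension; otherwise each line in that direction meets the hyperplane in one point. *)
Lemma leb_hyperplane (R : realType) n (c : 'rV[R]_n) (b : R) :
  c != 0 -> leb n [set x | dot c x = b] = 0%E.
Proof.
have mH m (c' : 'rV[R]_m) b' : measurable [set x | dot c' x = b'].
  rewrite -[X in measurable X]setTI.
  exact: (measurable_dot c' measurableT (measurable_set1 b')).
elim: n c b => [|n IH] c b c0.
  by case/eqP: c0; apply/rowP => -[].
rewrite -[X in leb _ X]setIT -integral_indic//; last exact: mH.
have m1 : measurable_fun setT (EFin \o \1_[set x | dot c x = b] : 'rV[R]_n.+1 -> \bar R).
  by apply/measurable_EFinP; apply: measurable_indic; exact: mH.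
have dE x y : dot c (rV_snoc (x, y)) = dot (rV_init c) x + c ord0 ord_max * y.
  rewrite /dot big_ord_recr /= rV_snocK_last; congr (_ + _).
  apply: eq_bigr => i _; rewrite [rV_init _ _ _]mxE.
  have -> : widen_ord (leqnSn n) i = lift ord_max i.
    by apply: val_inj; rewrite /= /bump leqNgt ltn_ord.
  by rewrite rV_snoc_lift.
have [cm0|cm0] := eqVneq (c ord0 ord_max) 0.
  rewrite leb_integral_snoc2//.
  apply: integral0_eq => y _.
  rewrite -[RHS](IH (rV_init c) b); last first.
    apply: contra_neq c0 => ci0; apply/rowP => i.
    case: (unliftP ord_max i) => [j ->|->]; last by rewrite cm0 mxE.
    by have /rowP/(_ j) := ci0; rewrite !mxE.
  rewrite -[in RHS](setIT [set _ | _]) -integral_indic//; last exact: mH.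
  apply: eq_integral => x _; congr EFin; apply: indic_iff => /=.
  by rewrite dE cm0 mul0r addr0.
rewrite leb_integral_snoc//.
apply: integral0_eq => x _.
rewrite -[RHS](lebesgue_measure_set1 ((b - dot (rV_init c) x) / c ord0 ord_max)).
rewrite -[in RHS](setIT [set _]) -integral_indic//.
apply: eq_integral => y _; congr EFin; apply: indic_iff => /=.
rewrite dE; split=> [<-|->]; last by rewrite mulrC divfK// addrC subrK.
by rewrite addrC addKr mulrC mulKf.
Qed.

(** * Smooth bumps and the fundamental lemma of the calculus of variations *)

Lemma is_derive_cvg (R : realType) (V : normedModType R) (f : V -> R) (x v : V) (l : R) :
  h^-1 *: (f (h *: v + x) - f x) @[h --> 0^'] --> l -> is_derive x v f l.
Proof.
move=> h; apply: DeriveDef; first by apply/cvg_ex; exists l.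
exact: cvg_lim h.
Qed.

Section flat_exp.
Context {R : realType} (s : R) (s0 : 0 < s).
Implicit Types (P : {poly R}) (t y : R).

(* The class of these functions is closed under differentiation, hence
   consists of smooth functions vanishing for [t <= 0]. *)
Definition flat_exp P t : R := if 0 < t then P.[t^-1] * expR (- s / t) else 0.

(** With y = 1/t one has d/dt = - y^2 d/dy, which sends P(y) exp(- s y) to y^2 (s P - P')(y) exp(- s
    y). *)
Definition flat_next P : {poly R} := 'X^2 * (s *: P - P^`()).

(** Monomial by monomial: y^i is at most 1 for y <= 1, and for y > 1 at most y^(i+1), which a single
    term of the exponential series controls. *)
Lemma poly_expR_bounded P : exists2 C, 0 < C &
  forall y, 0 <= y -> `|P.[y]| * expR (- s * y) <= C.
Proof.
exists (1 + \sum_(i < size P) `|P`_i| * (i.+1`!%:R / s ^+ i.+1 + 1)).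
  rewrite ltr_wpDr// sumr_ge0// => i _; rewrite mulr_ge0//.
  by rewrite addr_ge0// divr_ge0// exprn_ge0// ltW.
move=> y y0; rewrite horner_coef; apply: le_trans (_ : _ <= \sum_(i < size P) `|P`_i| * (i.+1`!%:R / s ^+ i.+1 + 1)) _; last by rewrite lerDr.
apply: (@le_trans _ _ (\sum_(i < size P) (`|P`_i| * (y ^+ i * expR (- s * y))))).
  apply: (@le_trans _ _ ((\sum_(i < size P) `|P`_i| * y ^+ i) * expR (- s * y))).
    apply: ler_wpM2r; first exact: expR_ge0.
    apply: le_trans (ler_norm_sum _ _ _) _; apply: ler_sum => i _.
    by rewrite normrM normrX (ger0_norm y0).
  by rewrite mulr_suml; apply: ler_sum => i _; rewrite mulrA.
apply: ler_sum => i _; apply: ler_wpM2l => //.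
have sy0 : 0 <= s * y by rewrite mulr_ge0// ltW.
have e1 : expR (- s * y) <= 1 by rewrite -expR0 ler_expR mulNr oppr_le0.
have h := expR_ge1Dxn i sy0.
have f0 : 0 < i.+1`!%:R :> R by rewrite ltr0n fact_gt0.
have [y1|y1] := leP y 1.
  apply: (@le_trans _ _ 1); last by rewrite lerDr divr_ge0// exprn_ge0// ltW.
  rewrite -[leRHS]mulr1; apply: ler_pM => //.
  - exact: exprn_ge0.
  - exact: exprn_ile1.
apply: (@le_trans _ _ (i.+1`!%:R / s ^+ i.+1)); last by rewrite lerDl.
rewrite mulNr expRN ler_pdivrMr ?expR_gt0//.
apply: (@le_trans _ _ (i.+1`!%:R / s ^+ i.+1 * ((s * y) ^+ i.+1 / i.+1`!%:R))); last first.
  apply: ler_wpM2l; last by apply: le_trans h; rewrite lerDr.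
  by rewrite divr_ge0// exprn_ge0// ltW.
have sn : s ^+ i.+1 != 0 by rewrite expf_eq0 gt_eqF.
have -> : i.+1`!%:R / s ^+ i.+1 * ((s * y) ^+ i.+1 / i.+1`!%:R) = y ^+ i.+1.
  by rewrite exprMn; field; rewrite sn gt_eqF.
by rewrite exprS ler_peMl ?exprn_ge0// ltW.
Qed.

(** Bounding P X^2 in place of P gains the factor t^2, which makes the difference quotient at 0 tend
    to 0. *)
Lemma flat_exp_near0 P : exists2 C, 0 < C & forall t, `|flat_exp P t| <= C * t ^+ 2.
Proof.
have [C C0 PC] := poly_expR_bounded (P * 'X^2).
exists C => // t; rewrite /flat_exp; case: ifPn => [t0|_]; last first.
  by rewrite normr0 mulr_ge0// ?sqr_ge0// ltW.
have := PC t^-1; rewrite invr_ge0 ltW// => /(_ isT).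
rewrite hornerM hornerXn normrM normrX normfV (gtr0_norm t0).
rewrite exprVn mulrAC ler_pdivrMr ?exprn_gt0//.
by rewrite normrM (ger0_norm (expR_ge0 _)) mulNr.
Qed.

Lemma is_derive_flat_exp P t : is_derive t 1 (flat_exp P) (flat_exp (flat_next P) t).
Proof.
have [t0|t0|->] := ltgtP t 0.
- rewrite {2}/flat_exp ltNge (ltW t0) /=.
  apply: (@near_eq_is_derive _ _ _ (cst 0)) => //.
  + by near=> u; rewrite /flat_exp ltNge ltW//; near: u; exact: lt_nbhsl.
- rewrite {2}/flat_exp t0.
  have D1 : is_derive t 1 (fun u : R => u^-1) (- t ^- 2).
    have := @is_deriveV R id t 1 1; rewrite scaler1; apply; first by rewrite gt_eqF.
  apply: (@near_eq_is_derive _ _ _ ((fun y => P.[y] * expR (- s * y)) \o (fun u : R => u^-1))).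
  + near=> u; rewrite /flat_exp ifT//; near: u; exact: lt_nbhsr.
  + have -> : (flat_next P).[t^-1] * expR (- s / t) =
      (P^`().[t^-1] * expR (- s * t^-1) - s * (P.[t^-1] * expR (- s * t^-1))) * (- t ^- 2).
      rewrite /flat_next !(hornerM, hornerX, hornerD, hornerN, hornerZ).
      by field; rewrite gt_eqF.
    apply: is_derive1_comp D1.
    have D2 : is_derive (t^-1) 1 (fun y => expR (- s * y)) (expR (- s * t^-1) * - s).
      apply: is_derive1_comp.
      have := @is_deriveZ R R R id (- s) t^-1 1 1 (is_derive_id _ _).
      by rewrite /GRing.scale /= mulr1.
    have := is_deriveM (is_derive_poly P t^-1) D2.
    move=> H; apply: (@is_derive_eq _ _ _ _ _ _ _ _ H).
    by rewrite /GRing.scale /=; ring.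
- rewrite {2}/flat_exp ltxx.
  apply: is_derive_cvg; have [C C0 PC] := flat_exp_near0 P.
  apply/cvgr0Pnorm_lt => e e0; near=> h.
  rewrite /= addr0 /flat_exp ltxx subr0 -/(flat_exp P _) /GRing.scale /= mulr1.
  have h0 : h != 0 by near: h; exact: nbhs_dnbhs_neq.
  rewrite normrM normfV ltr_pdivrMl ?normr_gt0//.
  apply: le_lt_trans (PC h) _.
  rewrite -(ger0_norm (sqr_ge0 h)) normrX expr2 mulrA [ltRHS]mulrC.
  rewrite ltr_pM2r ?normr_gt0// mulrC -ltr_pdivlMr//.
  near: h; apply: dnbhs0_lt; exact: divr_gt0.
Unshelve. all: by end_near. Qed.

End flat_exp.

Section tame.
Context {R : realType}.

(** [H] lists the successive derivatives, so that shifting it shows the derivative to be smooth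
    again. *)
Definition smooth1 (h : R -> R) : Prop :=
  exists2 H : nat -> R -> R, H 0%N = h & forall n (t : R), is_derive t 1 (H n) (H n.+1 t).

Lemma smooth1_flat_exp (s : R) (P : {poly R}) (a b : R) : 0 < s ->
  smooth1 (fun t => flat_exp s P (a * t + b)).
Proof.
move=> s0; exists (fun n t => a ^+ n * flat_exp s (iter n (flat_next s) P) (a * t + b)).
  by apply/funext => t; rewrite expr0 mul1r.
move=> n t.
have D0 : is_derive t 1 (fun u : R => a * u + b) a.
  have := @is_deriveD R R R (a \*: id) (cst b) t 1 _ _
    (@is_deriveZ R R R id a t 1 1 (is_derive_id _ _)) (is_derive_cst _ _ _).
  by rewrite addr0 /GRing.scale /= mulr1.
have D1 := @is_derive1_comp R _ (fun u => a * u + b) t _ _ (is_derive_flat_exp s0 (iter n (flat_next s) P) (a * t + b)) D0.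
have := @is_deriveZ R R R _ (a ^+ n) t 1 _ D1.
move=> D2; apply: (is_derive_eq D2); rewrite /GRing.scale /= exprS; ring.
Qed.

(** A class of functions stable under partial derivatives and containing the bumps below: smoothness
    follows by induction, without computing any iterated derivative. *)
Inductive tame d : ('rV[R]_d -> R) -> Prop :=
| tame_cst c : tame (fun=> c)
| tame_coord h i : smooth1 h -> tame (fun x => h (x ord0 i))
| tame_add f g : tame f -> tame g -> tame (fun x => f x + g x)
| tame_mul f g : tame f -> tame g -> tame (fun x => f x * g x).

Lemma tame_prod d (I : finType) (f : I -> 'rV[R]_d -> R) :
  (forall i, tame (f i)) -> tame (fun x => \prod_i f i x).
Proof.
move=> tf; elim: (index_enum I) => [|i r IH].
  by under eq_fun do rewrite big_nil; exact: tame_cst.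
by under eq_fun do rewrite big_cons; exact: tame_mul.
Qed.

Lemma tame_derive d (f : 'rV[R]_d -> R) (j : 'I_d) : tame f ->
  exists2 f', tame f' & forall x, is_derive x (delta_mx ord0 j) f (f' x).
Proof.
elim=> [c|h i [H Hh HD]|g1 g2 _ [g1' t1 D1] _ [g2' t2 D2]|g1 g2 tg1 [g1' t1 D1] tg2 [g2' t2 D2]].
- by exists (fun=> 0); [exact: tame_cst|move=> x; exact: is_derive_cst].
- have [ij|ij] := eqVneq i j.
    exists (fun x => H 1%N (x ord0 i)).
      by apply: tame_coord; exists (fun n => H n.+1).
    move=> x; have [/cvg_ex[l hl] lE] := HD 0%N (x ord0 i).
    have El : l = H 1%N (x ord0 i) by rewrite -lE; apply/esym/cvg_lim.
    apply: is_derive_cvg; rewrite -Hh -El; move: hl => /=.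
    under eq_fun do rewrite [_ *: 1]mulr1.
    apply: cvg_trans; apply: near_eq_cvg; near=> u.
    by rewrite !mxE ij !eqxx /= mulr1.
  exists (fun=> 0); first exact: tame_cst.
  move=> x; apply: is_derive_cvg.
  rewrite (_ : (fun _ => _) = cst 0); first exact: cvg_cst.
  apply/funext => u /=; rewrite !mxE eqxx /= (negbTE ij) mulr0 add0r.
  by rewrite subrr scaler0.
- exists (fun x => g1' x + g2' x); first exact: tame_add.
  by move=> x; exact: is_deriveD.
- exists (fun x => g1 x * g2' x + g2 x * g1' x).
    by apply: tame_add; exact: tame_mul.
  by move=> x; exact: is_deriveM.
Unshelve. all: by end_near. Qed.

Lemma is_derive1_continuous (h : R -> R) (h' : R -> R) :
  (forall t : R, is_derive t 1 h (h' t)) -> continuous h.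
Proof.
move=> hD t; apply: differentiable_continuous.
by apply/derivable1_diffP; exact: ex_derive.
Qed.

Lemma tame_continuous d (f : 'rV[R]_d -> R) : tame f -> continuous f.
Proof.
elim=> [c|h i [H <- HD]|g1 g2 _ c1 _ c2|g1 g2 _ c1 _ c2] x.
- exact: cst_continuous.
- apply: (@continuous_comp _ _ _ (fun x : 'rV[R]_d => x ord0 i) (H 0%N)).
    exact: coord_continuous.
  exact: is_derive1_continuous (HD 0%N) _.
- by apply: continuousD; [exact: c1|exact: c2].
- by apply: continuousM; [exact: c1|exact: c2].
Qed.

Lemma tame_smooth d (f : 'rV[R]_d -> R) : tame f -> smooth f.
Proof.
move=> tf; suff tame_pds s : tame (foldr pd f s).
  move=> s /=; split; first exact: tame_continuous.
  move=> i x; have [f' _ /(_ x) Df] := tame_derive i (tame_pds s).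
  exact: ex_derive.
elim: s => [//|i s IH] /=.
have [f' tf' D] := tame_derive i IH.
rewrite (_ : pd i _ = f')//; apply/funext => x.
exact: derive_val.
Qed.

End tame.

Section bump.
Context {R : realType} {d : nat}.
Implicit Types (a b x : 'rV[R]_d) (s : R).

Definition rV_obox a b : set 'rV[R]_d :=
  [set x | forall i, a ord0 i < x ord0 i < b ord0 i].

Lemma rV_obox_sub a b : rV_obox a b `<=` rV_box a b.
Proof. by move=> x xab i; have /andP[/ltW-> /ltW->] := xab i. Qed.

Lemma measurable_rV_obox a b : measurable (rV_obox a b).
Proof.
rewrite (_ : rV_obox a b =
    [set x | forall i, `]a ord0 i, b ord0 i[%classic (x ord0 i)]); last first.
  by apply/seteqP; split => x xab i; have := xab i; rewrite /= in_itv.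
apply: (@measurable_forall_fin _ _ _
  (fun i => [set x : 'rV[R]_d | `]a ord0 i, b ord0 i[%classic (x ord0 i)])) => i.
exact: measurable_coord_preim.
Qed.

Lemma compact_rV_box a b : compact (rV_box a b).
Proof. rewrite rV_boxE.
exact: (rV_compact (fun i => @segment_compact R (a ord0 i) (b ord0 i))). Qed.

(** Smooth functions vanishing outside the open box, which tend to its indicator as s tends to 0.
    The coefficients 1 and -1 match the affine arguments of [smooth1_flat_exp]. *)
Definition bump s a b x : R := \prod_i
  (flat_exp s 1 (1 * x ord0 i + - a ord0 i) * flat_exp s 1 (-1 * x ord0 i + b ord0 i)).

Lemma flat_exp1_ge0 s t : 0 <= flat_exp s 1 t.
Proof. by rewrite /flat_exp; case: ifP => // _; rewrite hornerC mul1r expR_ge0. Qed.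

Lemma flat_exp1_le1 s t : 0 < s -> flat_exp s 1 t <= 1.
Proof.
move=> s0; rewrite /flat_exp; case: ifPn => // t0; rewrite hornerC mul1r.
by rewrite -expR0 ler_expR mulNr oppr_le0 divr_ge0// ltW.
Qed.

Lemma bump_ge0 s a b x : 0 <= bump s a b x.
Proof. by apply: prodr_ge0 => i _; rewrite mulr_ge0// flat_exp1_ge0. Qed.

Lemma bump_le1 s a b x : 0 < s -> bump s a b x <= 1.
Proof.
move=> s0; rewrite (_ : 1 = \prod_(i < d) 1 :> R); last by rewrite big1_eq.
apply: ler_prod => i _; rewrite mulr_ge0 ?flat_exp1_ge0//=.
by apply: mulr_ile1; rewrite ?flat_exp1_ge0 ?flat_exp1_le1.
Qed.

Lemma bump_out s a b x : ~ rV_obox a b x -> bump s a b x = 0.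
Proof.
move=> /existsNP[i /negP]; rewrite negb_and -!leNgt => xi.
apply/eqP/prodf_eq0; exists i => //; rewrite mulf_eq0 /flat_exp mul1r mulN1r.
rewrite subr_gt0 [- _ + _]addrC subr_gt0 !ltNge.
by case/orP: xi => ->; rewrite eqxx ?orbT.
Qed.

Lemma tame_bump s a b : 0 < s -> tame (bump s a b).
Proof.
move=> s0; apply: tame_prod => i; apply: tame_mul;
  by apply: (tame_coord (h := fun t => flat_exp s 1 (_ * t + _))); exact: smooth1_flat_exp.
Qed.

Lemma test_bump (D : set 'rV[R]_d) s a b : 0 < s -> rV_box a b `<=` D ->
  test_function D (bump s a b).
Proof.
move=> s0 abD; split; first exact/tame_smooth/tame_bump.
exists (rV_box a b); split => //; first exact: compact_rV_box.
by move=> x xab; apply: bump_out => /rV_obox_sub.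
Qed.

Lemma bump_cvg a b x : (bump n.+1%:R^-1 a b x) @[n --> \oo] --> (\1_(rV_obox a b) x : R).
Proof.
rewrite indicE; have [xab|xab] := boolP (x \in rV_obox a b); last first.
  rewrite notin_setE in xab.
  rewrite (_ : (fun _ => _) = cst 0); first exact: cvg_cst.
  by apply/funext => n; rewrite bump_out.
rewrite inE in xab.
have flat_cvg (t : R) : 0 < t -> flat_exp n.+1%:R^-1 1 t @[n --> \oo] --> (1 : R).
  move=> t0; rewrite /flat_exp t0.
  under eq_fun do rewrite hornerC mul1r.
  have c1 : (- (n.+1%:R^-1 : R) / t) @[n --> \oo] --> (0 : R).
    rewrite -(mul0r t^-1) -[in X in X * _]oppr0; apply: cvgMl.
    by apply: cvgN; exact: cvg_harmonic.
  have := cvg_comp _ _ c1 (@continuous_expR R 0).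
  by rewrite expR0.
rewrite /bump (_ : true%:R = \prod_(i < d) 1 :> R); last by rewrite big1_eq.
elim: (index_enum _) => [|i r IH].
  by rewrite big_nil; under eq_fun do rewrite big_nil; exact: cvg_cst.
rewrite big_cons; under eq_fun do rewrite big_cons.
apply: cvgM IH.
have := xab i => /andP[ai bi].
have ai' : 0 < 1 * x ord0 i + - a ord0 i by rewrite mul1r subr_gt0.
have bi' : 0 < -1 * x ord0 i + b ord0 i by rewrite mulN1r addrC subr_gt0.
have := cvgM (flat_cvg _ ai') (flat_cvg _ bi'); rewrite mulr1; exact.
Qed.

End bump.

Section density.
Context d (T : measurableType d) {R : realType} (mu : {measure set T -> \bar R}).
Context (f : T -> \bar R) (mf : measurable_fun setT f) (f0 : forall x, (0 <= f x)%E).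

(** The measure with density f. The two hypotheses are arguments of the definition so that its
    measure structure, which depends on them, is found from the term. *)
Definition density_of (_ : measurable_fun setT f) (_ : forall x, (0 <= f x)%E) :
  set T -> \bar R := fun A => (\int[mu]_(x in A) f x)%E.

Let density0 : density_of mf f0 set0 = 0%E.
Proof. exact: integral_set0. Qed.

Let density_ge0 A : (0 <= density_of mf f0 A)%E.
Proof. exact: integral_ge0. Qed.

Let density_sigma_additive : semi_sigma_additive (density_of mf f0).
Proof. exact: semi_sigma_additive_nng_induced. Qed.

HB.instance Definition _ := isMeasure.Build _ _ _ (density_of mf f0)
  density0 density_ge0 density_sigma_additive.

End density.

(** Non-integrable functions are covered too: as soon as one part has infinite integral, [fine]
    sends both sides to 0. *)
Lemma Rintegral_opp d (T : measurableType d) (R : realType)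
    (mu : {measure set T -> \bar R}) (D : set T) (f : T -> R) :
  \int[mu]_(x in D) (- f x) = - \int[mu]_(x in D) f x.
Proof.
rewrite /Rintegral integralE [in RHS]integralE.
have -> : (fun x => (- f x)%:E) = (\- (EFin \o f))%E by apply/funext.
rewrite funeposN funenegN.
have : (0 <= \int[mu]_(x in D) (EFin \o f)^\+ x)%E.
  by apply: integral_ge0 => x _; exact: funepos_ge0.
have : (0 <= \int[mu]_(x in D) (EFin \o f)^\- x)%E.
  by apply: integral_ge0 => x _; exact: funeneg_ge0.
by case: integral => [a| |] //; case: integral => [b| |] //=; rewrite ?oppr0// opprB.
Qed.

Section fundamental_lemma.
Context {R : realType} {d : nat}.
Implicit Types (a b x : 'rV[R]_d) (D : set 'rV[R]_d) (h : 'rV[R]_d -> R).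

(** The bumps with s = 1/(n+1) are test functions converging to the indicator of the box, and h
    dominates their products with h. *)
Lemma integral_obox_eq0 D h a b : measurable D ->
  (leb d).-integrable D (EFin \o h) ->
  (forall phi, test_function D phi -> \int[leb d]_(x in D) (h x * phi x) = 0) ->
  rV_box a b `<=` D ->
  (\int[leb d]_(x in rV_obox a b) (h x)%:E = 0)%E.
Proof.
move=> mD ih hphi abD.
have mh : measurable_fun D h by apply/measurable_EFinP; case/integrableP: ih.
have oD : rV_obox a b `<=` D by apply: subset_trans abD; exact: rV_obox_sub.
have mo := measurable_rV_obox a b.
have s0 n : 0 < n.+1%:R^-1 :> R by rewrite invr_gt0.
have mbump n : measurable_fun D (bump n.+1%:R^-1 a b).
  apply: measurable_funTS; apply: continuous_measurable_rV.
  by apply: tame_continuous; exact: tame_bump.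
pose f_ (n : nat) x : \bar R := (h x * bump n.+1%:R^-1 a b x)%:E.
pose f x : \bar R := (h x * \1_(rV_obox a b) x)%:E.
have mf_ n : measurable_fun D (f_ n).
  by apply/measurable_EFinP; exact: measurable_funM.
have mf : measurable_fun D f.
  by apply/measurable_EFinP; apply: measurable_funM => //; exact: measurable_indic.
have bound n x : D x -> (`|f_ n x| <= (abse \o (EFin \o h)) x)%E.
  move=> _; rewrite /f_ /= lee_fin normrM -[leRHS]mulr1 ler_wpM2l//.
  by rewrite ger0_norm ?bump_ge0// bump_le1.
have iabs : (leb d).-integrable D (abse \o (EFin \o h)) by exact: integrable_abse.
have [] := @dominated_convergence _ _ _ (leb d) D mD f_ f (abse \o (EFin \o h)) mf_ mf.
- apply: aeW => x Dx; apply: cvg_EFin; first by near=> n.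
  by apply: cvgMr; exact: bump_cvg.
- exact: iabs.
- by apply: aeW => x n Dx; exact: bound.
move=> i_f _; rewrite (_ : (fun n => _) = cst 0%E); last first.
  apply/funext => n /=.
  have i_fn : (leb d).-integrable D (f_ n).
    by apply: (le_integrable mD (mf_ n) _ ih) => x Dx; exact: bound.
  rewrite -[LHS]fineK; last exact: integrable_fin_num.
  by congr EFin; exact: (hphi _ (test_bump (s0 n) abD)).
move/cvg_lim => /(_ (@ereal_hausdorff R)); rewrite lim_cst// => f0.
rewrite -[in LHS](setIidr oD) integral_mkcondr [RHS]f0.
apply: eq_integral => x _; rewrite /f /patch indicE.
by case: ifP => _; rewrite ?mulr1 ?mulr0.
Unshelve. all: by end_near. Qed.

(** The identity is measurable from the sigma-algebra generated by boxes: a half-space x_i > u is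
    the union of the boxes with lower bound u in direction i and all other bounds - k and k. *)
Lemma g_sigma_algebra_oboxE :
  @measurable _ ('rV[R]_d) = <<s [set A | exists a b, A = rV_obox a b] >>.
Proof.
set G := [set A | _]; apply/seteqP; split; last first.
  apply: smallest_sub; first exact: sigma_algebra_measurable.
  by move=> _ [a [b ->]]; exact: measurable_rV_obox.
have mid : measurable_fun setT (fun x : g_sigma_algebraType G => x : 'rV[R]_d).
  apply: measurable_fun_rV => i.
  apply: (measurability _ (RGenOInfty.measurableE R)) => //.
  move=> _ [_ [u ->] <-]; rewrite setTI.
  rewrite (_ : _ @^-1` _ = \bigcup_k (rV_obox (\row_j (if j == i then u else - k%:R)) (const_mx k%:R))).
    apply: bigcupT_measurable => k; apply: sub_sigma_algebra.
    by eexists; eexists; reflexivity.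
  apply/seteqP; split=> [x /=|x [k _ /(_ i)]]; rewrite ?in_itv /= ?andbT; last first.
    by rewrite !mxE eqxx in_itv/= andbT => /andP[].
  move=> ux; exists (Num.trunc `|x|).+1 => // j; rewrite !mxE.
  have: `|x ord0 j| < (Num.trunc `|x|).+1%:R.
    by apply: le_lt_trans (coord_le_norm _ _) _; exact: truncnS_gt.
  by rewrite ltr_norml => /andP[x1 ->]; case: eqP => [->|]; rewrite ?ux// x1.
move=> A mA; have := mid measurableT A mA.
by rewrite setTI.
Qed.

Lemma rV_oboxI a b a' b' : rV_obox a b `&` rV_obox a' b' =
  rV_obox (\row_i Num.max (a ord0 i) (a' ord0 i)) (\row_i Num.min (b ord0 i) (b' ord0 i)).
Proof.
apply/seteqP; split=> [x [h1 h2] i|x h].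
  by rewrite !mxE gt_max lt_min; have /andP[-> ->] := h1 i; have /andP[-> ->] := h2 i.
by split=> i; have := h i; rewrite !mxE gt_max lt_min => /andP[/andP[h1 h2] /andP[h3 h4]];
  rewrite ?h1 ?h2 ?h3 ?h4.
Qed.

(** The measures with densities h^+ and h^- on the box agree on open boxes, which form a pi-system,
    hence everywhere. On the set h > 0 the second vanishes, so the first does, and its density is
    zero almost everywhere there. *)
Lemma obox_ae_le0 D h a b : measurable D ->
  (leb d).-integrable D (EFin \o h) ->
  (forall phi, test_function D phi -> \int[leb d]_(x in D) (h x * phi x) = 0) ->
  rV_box a b `<=` D ->
  (leb d).-negligible (rV_obox a b `&` [set x | 0 < h x]).
Proof.
move=> mD ih hphi abD.
have mh : measurable_fun D h by apply/measurable_EFinP; case/integrableP: ih.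
have mo := measurable_rV_obox a b.
set Q := rV_obox a b in mo *.
have QD : Q `<=` D by apply: subset_trans abD; exact: rV_obox_sub.
pose H : 'rV[R]_d -> \bar R := EFin \o h.
have mHp : measurable_fun setT (H^\+ \_ Q)%E.
  apply/measurable_restrict => //; rewrite setTI; apply: measurable_funepos.
  by apply/measurable_EFinP; exact: measurable_funS mh.
have mHn : measurable_fun setT (H^\- \_ Q)%E.
  apply/measurable_restrict => //; rewrite setTI; apply: measurable_funeneg.
  by apply/measurable_EFinP; exact: measurable_funS mh.
have Hp0 x : (0 <= (H^\+ \_ Q) x)%E by rewrite erestrict_ge0// => y _; exact: funepos_ge0.
have Hn0 x : (0 <= (H^\- \_ Q) x)%E by rewrite erestrict_ge0// => y _; exact: funeneg_ge0.
pose nup := density_of (leb d) mHp Hp0.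
pose nun := density_of (leb d) mHn Hn0.
have nuE A : measurable A -> nup A = nun A.
  apply: (measure_unique [set A | exists a b, A = rV_obox a b]
    (fun k => rV_obox (const_mx (- k%:R)) (const_mx k%:R))).
  - exact: g_sigma_algebra_oboxE.
  - by move=> _ _ [a1 [b1 ->]] [a2 [b2 ->]]; rewrite rV_oboxI; do 2 eexists.
  - by move=> k; do 2 eexists.
  - apply/seteqP; split=> // x _; exists (Num.trunc `|x|).+1 => // j; rewrite !mxE.
    rewrite -ltr_norml; apply: le_lt_trans (coord_le_norm _ _) _; exact: truncnS_gt.
  - move=> _ [a1 [b1 ->]].
    rewrite /= /density_of -!integral_mkcondr rV_oboxI.
    set a2 := \row_i _; set b2 := \row_i _.
    have o2 : rV_obox a2 b2 `<=` Q by rewrite -rV_oboxI; exact: subIsetr.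
    have i2 : (leb d).-integrable (rV_obox a2 b2) H.
      by apply: integrableS ih => //; [exact: measurable_rV_obox|exact: subset_trans QD].
    have D2 : rV_box a2 b2 `<=` D.
      apply: subset_trans abD => x xab i; have := xab i; rewrite !mxE ge_max le_min.
      by case/andP=> /andP[_ ->] /andP[_ ->].
    have I0 := integral_obox_eq0 mD ih hphi D2.
    rewrite integralE -/H in I0; move: I0.
    have mo2 := measurable_rV_obox a2 b2.
    rewrite -(fineK (integrable_fin_num mo2 (integrable_funepos mo2 i2))).
    rewrite -(fineK (integrable_fin_num mo2 (integrable_funeneg mo2 i2))).
    by rewrite -EFinB => -[] /subr0_eq ->.
  - move=> k; apply: (@le_lt_trans _ _ (nup setT)).
      by apply: le_measure; rewrite ?inE//; exact: measurable_rV_obox.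
    rewrite /nup /= /density_of -integral_mkcond.
    have iQ : (leb d).-integrable Q H by apply: integrableS ih.
    have /integrableP[_] := integrable_funepos mo iQ.
    by under eq_integral do rewrite gee0_abs ?funepos_ge0//.
pose A := D `&` [set x | 0 < h x].
have mA : measurable A.
  have := mh mD _ (measurable_itv `]0, +oo[).
  by congr measurable; apply/seteqP; split=> x [Dx] /=; rewrite in_itv /= andbT.
have : nup A = 0%E.
  rewrite nuE// /nun /= /density_of; apply: integral0_eq => x [_ /= hx].
  rewrite /patch; case: ifP => // _; rewrite funenegE /H /=.
  by apply/max_idPr; rewrite lee_fin oppr_le0 ltW.
rewrite /nup /= /density_of => nA0.
have /ae_eq_integral_abs : (\int[leb d]_(x in A) `|(H^\+ \_ Q)%E x| = 0)%E.
  by rewrite -[RHS]nA0; apply: eq_integral => x _; rewrite gee0_abs.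
move=> /(_ mA) h0; have {}h0 := h0 (measurable_funTS mHp).
apply: negligibleS h0 => x [Qx /= hx] /=; apply/not_implyP; split.
  by split => //; exact: QD.
rewrite /patch mem_set// funeposE /H /= => /eqP; rewrite /cst /=.
by rewrite -EFin_max eqe (max_idPl (ltW hx)) gt_eqF.
Qed.

Lemma fundamental_lemma_le0 D h : open D ->
  (leb d).-integrable D (EFin \o h) ->
  (forall phi, test_function D phi -> \int[leb d]_(x in D) (h x * phi x) = 0) ->
  {ae leb d, forall x, D x -> h x <= 0}.
Proof.
move=> oD ih hphi.
pose lo z := rat_center R z - const_mx (rat_radius R z) : 'rV[R]_d.
pose hi z := rat_center R z + const_mx (rat_radius R z) : 'rV[R]_d.
(* Natural numbers enumerate the rational cubes contained in D, making D a countable union of sets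
   on which h <= 0 almost everywhere. *)
pose N k := if @unpickle ('rV[rat]_d * nat)%type k is Some z then
  if `[< rV_box (lo z) (hi z) `<=` D >] then rV_obox (lo z) (hi z) `&` [set x | 0 < h x]
  else set0 else set0.
apply: (@negligibleS _ _ _ _ (\bigcup_k N k)).
  move=> x /= /not_implyP[]; rewrite {1}(open_rV_bigcup_rat oD) => -[z zD zx] /negP.
  rewrite -ltNge => hx; exists (pickle z) => //; rewrite /N pickleK asboolT//; split=> // i.
  have /rV_ballP := zx; move=> /(_ (rat_radius_gt0 _ _) i).
  by rewrite !mxE ltr_distlC.
apply: negligible_bigcup => k; rewrite /N; case: unpickle => [z|]; last exact: negligible_set0.
case: asboolP => [zD|_]; last exact: negligible_set0.
exact: (obox_ae_le0 (open_measurable_rV oD) ih hphi zD).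
Qed.

Lemma fundamental_lemma D h : open D ->
  (leb d).-integrable D (EFin \o h) ->
  (forall phi, test_function D phi -> \int[leb d]_(x in D) (h x * phi x) = 0) ->
  {ae leb d, forall x, D x -> h x = 0}.
Proof.
move=> oD ih hphi; have le0 := fundamental_lemma_le0 oD ih hphi.
have : {ae leb d, forall x, D x -> - h x <= 0}.
  apply: fundamental_lemma_le0 => //; first exact: integrableN ih.
  move=> phi tphi; under eq_Rintegral do rewrite mulNr.
  by rewrite Rintegral_opp hphi// oppr0.
apply: filterS2 le0 => x h1 h2 Dx; apply/eqP.
by rewrite eq_le h1//= -oppr_le0 h2.
Qed.

End fundamental_lemma.

(** * Square-integrable functions and weak derivatives *)

Section L2.
Context {R : realType} {d : nat} (D : set 'rV[R]_d) (mD : measurable D).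
Implicit Types v w : 'rV[R]_d -> R.

Lemma in_L2_integrableM v w : in_L2 D v -> in_L2 D w ->
  (leb d).-integrable D (EFin \o (fun x => v x * w x)).
Proof.
move=> [mv iv] [mw iw].
have sq_int (u : 'rV[R]_d -> R) : measurable_fun D u ->
    (\int[leb d]_(x in D) ((u x) ^+ 2)%:E < +oo)%E ->
    (leb d).-integrable D (EFin \o (fun x => u x ^+ 2)).
  move=> mu iu; apply/integrableP; split.
    by apply/measurable_EFinP; exact: measurable_funX.
  by under eq_integral do rewrite gee0_abs ?lee_fin ?sqr_ge0//.
have i2 := integrableD mD (sq_int v mv iv) (sq_int w mw iw).
apply: (le_integrable mD _ _ i2).
  by apply/measurable_EFinP; exact: measurable_funM.
move=> x Dx /=; rewrite lee_fin [leRHS]ger0_norm ?addr_ge0 ?sqr_ge0// normrM.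
have := sqr_ge0 (`|v x| - `|w x|); rewrite sqrrB !real_normK ?num_real//.
have := sqr_ge0 (v x); have := sqr_ge0 (w x).
have : 0 <= `|v x| * `|w x| by rewrite mulr_ge0.
lra.
Qed.

Lemma in_L2_sqr v : measurable_fun D v ->
  (leb d).-integrable D (EFin \o (fun x => v x ^+ 2)) -> in_L2 D v.
Proof.
move=> mv /integrableP[_ iv]; split=> //; apply: le_lt_trans iv.
by rewrite le_eqVlt; apply/orP; left; apply/eqP; apply: eq_integral => x _ /=; rewrite ger0_norm ?sqr_ge0.
Qed.

Lemma in_L2Z (a : R) v : in_L2 D v -> in_L2 D (fun x => a * v x).
Proof.
move=> hv; have [mv _] := hv; apply: in_L2_sqr; first exact: measurable_funM.
have := integrableZl mD (a ^+ 2) (in_L2_integrableM hv hv).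
by apply: eq_integrable => // x _ /=; rewrite -EFinM exprMn expr2 [v x ^+ 2]expr2.
Qed.

Lemma in_L2D v w : in_L2 D v -> in_L2 D w -> in_L2 D (fun x => v x + w x).
Proof.
move=> hv hw; have [mv _] := hv; have [mw _] := hw.
apply: in_L2_sqr; first exact: measurable_funD.
have i1 := integrableD mD (in_L2_integrableM hv hv) (in_L2_integrableM hw hw).
have := integrableD mD i1 (integrableZl mD 2 (in_L2_integrableM hv hw)).
apply: eq_integrable => // x _ /=; rewrite -EFinM -!EFinD; congr EFin; ring.
Qed.

Lemma in_L2B v w : in_L2 D v -> in_L2 D w -> in_L2 D (fun x => v x - w x).
Proof.
move=> hv hw; have := in_L2D hv (in_L2Z (-1) hw).
by under eq_fun do rewrite mulN1r.
Qed.

Lemma in_L2_sum (I : finType) (v : I -> 'rV[R]_d -> R) (c : I -> R) :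
  in_L2 D (fun=> 0) -> (forall i, in_L2 D (v i)) -> in_L2 D (fun x => \sum_i c i * v i x).
Proof.
move=> h0 hv; elim: (index_enum I) => [|i r IH].
  by under eq_fun do rewrite big_nil.
by under eq_fun do rewrite big_cons; apply: in_L2D IH; exact: in_L2Z.
Qed.

Lemma ipC v w : ip D v w = ip D w v.
Proof. by apply: eq_Rintegral => x _; rewrite mulrC. Qed.

Lemma ip_ge0 v : 0 <= ip D v v.
Proof. by apply: Rintegral_ge0 => x _; rewrite -expr2 sqr_ge0. Qed.

Lemma ipDl v w u : in_L2 D v -> in_L2 D w -> in_L2 D u ->
  ip D (fun x => v x + w x) u = ip D v u + ip D w u.
Proof.
move=> hv hw hu; rewrite /ip -RintegralD//; try exact: in_L2_integrableM.
by apply: eq_Rintegral => x _; rewrite mulrDl.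
Qed.

Lemma ipZl (a : R) v u : in_L2 D v -> in_L2 D u ->
  ip D (fun x => a * v x) u = a * ip D v u.
Proof.
move=> hv hu; rewrite /ip -RintegralZl//; last exact: in_L2_integrableM.
by apply: eq_Rintegral => x _; rewrite mulrA.
Qed.

Lemma ipBl v w u : in_L2 D v -> in_L2 D w -> in_L2 D u ->
  ip D (fun x => v x - w x) u = ip D v u - ip D w u.
Proof.
move=> hv hw hu; rewrite -[_ - ip D w u]/(_ + - ip D w u) -mulN1r -ipZl// -ipDl//; last exact: in_L2Z.
by under eq_fun do rewrite -mulN1r.
Qed.

Lemma ip_suml (I : finType) (v : I -> 'rV[R]_d -> R) (c : I -> R) u :
  in_L2 D (fun=> 0) -> (forall i, in_L2 D (v i)) -> in_L2 D u ->
  ip D (fun x => \sum_i c i * v i x) u = \sum_i c i * ip D (v i) u.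
Proof.
move=> h0 hv hu.
suff [] : in_L2 D (fun x => \sum_i c i * v i x) /\
  ip D (fun x => \sum_i c i * v i x) u = \sum_i c i * ip D (v i) u by [].
elim: (index_enum I) => [|i r [IH1 IH2]].
  under eq_fun do rewrite big_nil; rewrite big_nil; split => //.
  by rewrite /ip; under eq_Rintegral do rewrite mul0r; rewrite Rintegral_cst// mul0r.
under eq_fun do rewrite big_cons; rewrite big_cons; split.
  by apply: in_L2D IH1; exact: in_L2Z.
by rewrite ipDl ?IH2 ?ipZl//; exact: in_L2Z.
Qed.

Lemma ip_congr v w v' w' :
  in_L2 D v -> in_L2 D w -> in_L2 D v' -> in_L2 D w' ->
  {ae leb d, forall x, D x -> v x = v' x} -> {ae leb d, forall x, D x -> w x = w' x} ->
  ip D v w = ip D v' w'.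
Proof.
move=> [mv _] [mw _] [mv' _] [mw' _] vv ww; rewrite /ip /Rintegral; congr fine.
apply: ae_eq_integral => //.
- by apply/measurable_EFinP; exact: measurable_funM.
- by apply/measurable_EFinP; exact: measurable_funM.
- by apply: filterS2 vv ww => x h1 h2 Dx; rewrite h1// h2.
Qed.

Lemma ipB_sqr v w : in_L2 D v -> in_L2 D w ->
  ip D v v <= 2 * ip D (fun x => v x - w x) (fun x => v x - w x) + 2 * ip D w w.
Proof.
move=> hv hw; have hb := in_L2B hv hw.
rewrite /ip -!RintegralZl//; try exact: in_L2_integrableM.
rewrite -RintegralD//; last 2 first.
  by have := integrableZl mD 2 (in_L2_integrableM hb hb); apply: eq_integrable.
  by have := integrableZl mD 2 (in_L2_integrableM hw hw); apply: eq_integrable.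
apply: le_Rintegral => //.
- exact: in_L2_integrableM.
- have := integrableD mD (integrableZl mD 2 (in_L2_integrableM hb hb))
    (integrableZl mD 2 (in_L2_integrableM hw hw)).
  by apply: eq_integrable.
- move=> x _; have := sqr_ge0 (v x - 2 * w x); lra.
Qed.

Lemma ip_cauchy (e : R) v w : 0 < e -> in_L2 D v -> in_L2 D w ->
  ip D v w <= e * ip D v v + e^-1 / 4 * ip D w w.
Proof.
move=> e0 hv hw.
rewrite /ip -!RintegralZl//; try exact: in_L2_integrableM.
rewrite -RintegralD//; last 2 first.
  by have := integrableZl mD e (in_L2_integrableM hv hv); apply: eq_integrable.
  by have := integrableZl mD (e^-1 / 4) (in_L2_integrableM hw hw); apply: eq_integrable.
apply: le_Rintegral => //.
- exact: in_L2_integrableM.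
- have := integrableD mD (integrableZl mD e (in_L2_integrableM hv hv))
    (integrableZl mD (e^-1 / 4) (in_L2_integrableM hw hw)).
  by apply: eq_integrable.
- move=> x _; have h : 0 <= e * (v x - e^-1 / 2 * w x) ^+ 2 by rewrite mulr_ge0 ?sqr_ge0// ltW.
  rewrite -subr_ge0; apply: le_trans h _; rewrite le_eqVlt; apply/orP; left; apply/eqP.
  by field; rewrite gt_eqF.
Qed.

Context (fD : (leb d D < +oo)%E).

Lemma in_L2_bounded v (M : R) : measurable_fun D v -> (forall x, D x -> `|v x| <= M) ->
  in_L2 D v.
Proof.
move=> mv vM; split => //; apply: (@le_lt_trans _ _ (\int[leb d]_(x in D) (M ^+ 2)%:E)%E).
  apply: ge0_le_integral => //.
  - by move=> x _; rewrite lee_fin sqr_ge0.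
  - by apply/measurable_EFinP; exact: measurable_funX.
  - move=> x Dx; rewrite lee_fin -(real_normK (num_real (v x))).
    have M0 : 0 <= M by apply: le_trans (vM x Dx).
    by rewrite lerXn2r ?nnegrE// vM.
by rewrite integral_cst// lte_mul_pinfty// lee_fin sqr_ge0.
Qed.

End L2.

Lemma continuous_bounded_on (R : realType) n (f : 'rV[R]_n -> R) (D : set 'rV[R]_n) :
  continuous f -> bounded_set D -> exists M, forall x, D x -> `|f x| <= M.
Proof.
move=> cf /bounded_sub_box[B B0 DB].
have : bounded_set (f @` rV_box (const_mx (- B)) (const_mx B)).
  apply: compact_bounded; apply: continuous_compact; last exact: compact_rV_box.
  by apply: continuous_subspaceT.
move=> [M [_ hM]]; exists (`|M| + 1) => x Dx; apply: (hM (`|M| + 1)).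
  by rewrite (le_lt_trans (ler_norm M))// ltrDl.
by exists x => //; exact: DB.
Qed.

Lemma mdeg_le1 d (al : 'I_d -> nat) : (mdeg al <= 1)%N ->
  (forall i, al i = 0%N) \/ exists i, al = (fun j => (j == i : nat)).
Proof.
move=> al1; have [al0|/existsNP[i ali]] := pselect (forall i, al i = 0%N); [by left|right].
exists i; have : (al i + \sum_(j < d | j != i) al j <= 1)%N by move: al1; rewrite /mdeg (bigD1 i).
have ai0 : (0 < al i)%N by rewrite lt0n; apply/eqP.
move=> ale; apply/funext => j; have [->|ji] := eqVneq j i.
  by apply/eqP; rewrite eqn_leq ai0 andbT; apply: leq_trans ale; exact: leq_addr.
apply/eqP; rewrite -leqn0; move: ale; rewrite (bigD1 j)//= addnA => /(leq_trans (leq_addr _ _)).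
by rewrite -[(al i)]prednK// addSn ltnS => /(leq_trans (leq_addl _ _)).
Qed.

Section weak_derivatives.
Context {R : realType} {d : nat} (D : set 'rV[R]_d) (oD : open D) (bD : bounded_set D).
Implicit Types (v w : 'rV[R]_d -> R) (al : 'I_d -> nat).

Let mD : measurable D := open_measurable_rV oD.
Let fD : (leb d D < +oo)%E := leb_bounded_lty mD bD.

Lemma in_L2_continuous v : continuous v -> in_L2 D v.
Proof.
move=> cv; have [M vM] := continuous_bounded_on cv bD.
apply: (in_L2_bounded mD fD _ vM).
by apply: measurable_funTS; exact: continuous_measurable_rV.
Qed.

Lemma in_L2_cst (c : R) : in_L2 D (fun=> c).
Proof. by apply: in_L2_continuous => x; exact: cst_continuous. Qed.

Lemma mpdE al v : exists s, mpd al v = foldr pd v s.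
Proof.
rewrite /mpd; elim: (enum 'I_d) => [|i s [s' /= ->]]; first by exists [::].
exists (nseq (al i) i ++ s'); rewrite foldr_cat.
by elim: (al i) => //= n ->.
Qed.

Lemma in_L2_test al phi : test_function D phi -> in_L2 D (mpd al phi).
Proof.
move=> [sphi _]; have [s ->] := mpdE al phi.
by apply: in_L2_continuous; have [] := sphi s.
Qed.

Lemma in_L2_test0 phi : test_function D phi -> in_L2 D phi.
Proof. by move=> [sphi _]; apply: in_L2_continuous; have [] := sphi [::]. Qed.

Lemma weak_deriv_ae_unique al v w1 w2 : in_L2 D w1 -> in_L2 D w2 ->
  is_weak_deriv D al v w1 -> is_weak_deriv D al v w2 ->
  {ae leb d, forall x, D x -> w1 x = w2 x}.
Proof.
move=> h1 h2 d1 d2; have hb := in_L2B mD h1 h2.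
(* On a bounded domain the constant 1 is square-integrable, so square-integrable functions are
   integrable, as the fundamental lemma requires. *)
have hi := in_L2_integrableM mD hb (in_L2_cst 1).
have i12 : (leb d).-integrable D (EFin \o (fun x => w1 x - w2 x)).
  by apply: eq_integrable hi => // x _ /=; rewrite mulr1.
have := fundamental_lemma oD i12.
have key phi : test_function D phi -> \int[leb d]_(x in D) ((w1 x - w2 x) * phi x) = 0.
  move=> tphi; rewrite -/(ip D (fun x => w1 x - w2 x) phi).
  rewrite (ipBl mD h1 h2 (in_L2_test0 tphi)).
  have := d1 _ tphi; rewrite (d2 _ tphi) => /eqP.
  by rewrite (inj_eq (mulfI _)) ?signr_eq0// => /eqP ->; rewrite subrr.
move=> /(_ key); apply: filterS => x h Dx; apply/eqP.
by rewrite -subr_eq0 h.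
Qed.

(** [weak_deriv] is a choice; this replaces it by whichever explicit weak derivative is at hand, up
    to a null set. *)
Lemma weak_derivP al v w : in_L2 D w -> is_weak_deriv D al v w ->
  in_L2 D (weak_deriv D al v) /\ {ae leb d, forall x, D x -> weak_deriv D al v x = w x}.
Proof.
move=> hw dw.
have [h1 h2] : in_L2 D (weak_deriv D al v) /\ is_weak_deriv D al v (weak_deriv D al v).
  exact: (@getPex _ [set w | in_L2 D w /\ is_weak_deriv D al v w] (ex_intro _ w (conj hw dw))).
by split=> //; exact: weak_deriv_ae_unique h2 dw.
Qed.

Lemma is_weak_derivB al v v' w w' :
  in_L2 D v -> in_L2 D v' -> in_L2 D w -> in_L2 D w' ->
  is_weak_deriv D al v w -> is_weak_deriv D al v' w' ->
  is_weak_deriv D al (v \- v') (fun x => w x - w' x).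
Proof.
move=> hv hv' hw hw' dv dv' phi tphi.
rewrite (ipBl mD hv hv' (in_L2_test al tphi)) (ipBl mD hw hw' (in_L2_test0 tphi)).
by rewrite dv// dv'// mulrBr.
Qed.

Lemma is_weak_deriv0 al v : (forall i, al i = 0%N) -> is_weak_deriv D al v v.
Proof.
move=> al0 phi _.
rewrite /mdeg big1// expr0 mul1r.
by congr (ip D v _); rewrite /mpd; elim: (enum 'I_d) => //= i s ->; rewrite al0.
Qed.

(* The H^1 norm is compared with the sum of squares only up to the number of
   multi-indices, which avoids identifying each term of the sum. *)
Lemma sobolev_norm1_le v : in_L2 D v ->
  (forall i, exists2 w, in_L2 D w & is_weak_deriv D (fun j => (j == i : nat)) v w) ->
  sobolev_norm D 1 v ^+ 2 <= #|{ffun 'I_d -> 'I_2}|%:R * (ip D v v + grad_ip D v v).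
Proof.
move=> hv dv; rewrite sqr_sqrtr; last by apply: sumr_ge0 => al _; exact: sqr_ge0.
apply: (@le_trans _ _ (\sum_(al : {ffun 'I_d -> 'I_2}) (ip D v v + grad_ip D v v))); last first.
  by rewrite sumr_const mulr_natl.
have g0 : 0 <= grad_ip D v v by apply: sumr_ge0 => i _; exact: ip_ge0.
rewrite [leRHS](bigID (fun al : {ffun 'I_d -> 'I_2} => (mdeg (al \; val) <= 1)%N)) /=.
apply: ler_wpDr; first by apply: sumr_ge0 => al _; rewrite addr_ge0 ?ip_ge0.
apply: ler_sum => al al1; rewrite sqr_sqrtr ?ip_ge0//.
have [al0|[i alE]] := mdeg_le1 al1.
  have [h1 h2] := weak_derivP hv (@is_weak_deriv0 _ v al0).
  by rewrite -[leLHS]/(ip D (weak_deriv D (al \; val) v) (weak_deriv D (al \; val) v))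
    (ip_congr mD h1 h1 hv hv h2 h2) lerDl.
rewrite alE -/(grad D v i) /grad_ip (bigD1 i)//= addrA addrAC.
by rewrite lerDr addr_ge0 ?ip_ge0// sumr_ge0// => j _; exact: ip_ge0.
Qed.

End weak_derivatives.

(** * Simplices and barycentric coordinates *)

Section dot.
Context {R : realType} {d : nat}.
Implicit Types x y z : 'rV[R]_d.

Lemma dotC x y : dot x y = dot y x.
Proof. by apply: eq_bigr => i _; rewrite mulrC. Qed.

Lemma dotDr x y z : dot x (y + z) = dot x y + dot x z.
Proof. by rewrite -big_split /=; apply: eq_bigr => i _; rewrite mxE mulrDr. Qed.

Lemma dotZr a x y : dot x (a *: y) = a * dot x y.
Proof. by rewrite mulr_sumr; apply: eq_bigr => i _; rewrite mxE mulrCA. Qed.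

Lemma dotNr x y : dot x (- y) = - dot x y.
Proof. by rewrite -scaleN1r dotZr mulN1r. Qed.

Lemma dotBr x y z : dot x (y - z) = dot x y - dot x z.
Proof. by rewrite dotDr dotNr. Qed.

Lemma dotBl x y z : dot (x - y) z = dot x z - dot y z.
Proof. by rewrite ![dot _ z]dotC dotBr. Qed.

Lemma dotZl a x y : dot (a *: x) y = a * dot x y.
Proof. by rewrite dotC dotZr dotC. Qed.

Lemma dotNl x y : dot (- x) y = - dot x y.
Proof. by rewrite dotC dotNr dotC. Qed.

Lemma dot0l y : dot 0 y = 0.
Proof. by rewrite /dot big1// => i _; rewrite mxE mul0r. Qed.

Lemma dot_sumr (I : finType) (c : I -> R) (f : I -> 'rV[R]_d) x :
  dot x (\sum_i c i *: f i) = \sum_i c i * dot x (f i).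
Proof.
elim: (index_enum I) => [|i r IH]; first by rewrite !big_nil dotC dot0l.
by rewrite !big_cons dotDr dotZr IH.
Qed.

Lemma dot_suml (I : finType) (c : I -> R) (f : I -> 'rV[R]_d) x :
  dot (\sum_i c i *: f i) x = \sum_i c i * dot (f i) x.
Proof. by rewrite dotC dot_sumr; apply: eq_bigr => i _; rewrite dotC. Qed.

Lemma dot_ge0 x : 0 <= dot x x.
Proof. by apply: sumr_ge0 => i _; rewrite -expr2 sqr_ge0. Qed.

Lemma dot_eq0 x : dot x x = 0 -> x = 0.
Proof.
move=> /psumr_eq0P x0; apply/rowP => i; apply/eqP; rewrite mxE -sqrf_eq0 expr2 x0//.
by move=> j _; rewrite -expr2 sqr_ge0.
Qed.

Lemma dot_inj x y : (forall z, dot x z = dot y z) -> x = y.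
Proof.
move=> h; apply/eqP; rewrite -subr_eq0; apply/eqP/dot_eq0.
by rewrite dotBl h subrr.
Qed.

Lemma dot_mulmx x y : dot x y = (x *m y^T) ord0 ord0.
Proof. by rewrite mxE; apply: eq_bigr => i _; rewrite mxE. Qed.

Lemma dot_delta x i : dot x (delta_mx ord0 i) = x ord0 i.
Proof.
rewrite /dot (bigD1 i)//= big1 ?addr0 ?mxE ?eqxx ?mulr1// => j ji.
by rewrite mxE eqxx /= (negbTE ji) mulr0.
Qed.

End dot.

Section simplex.
Context {R : realType} {d : nat} (Th : mesh R d).
Local Notation index := ('I_(nvert Th)).
Local Notation a := (vert (m := Th)).
Implicit Types (K L : {set index}) (i j : index) (x : 'rV[R]_d).

Definition good_simplex K := #|K| = d.+1 /\ affinely_independent K.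

(** The vertex in position [ord0] serves as base point of the edges in [edge_mx]. *)
Definition enumerates K (e : 'I_d.+1 -> index) := injective e /\ e @: 'I_d.+1 = K.

Definition edge_mx (e : 'I_d.+1 -> index) : 'M[R]_d :=
  \matrix_(p, j) (a (e (lift ord0 p)) - a (e ord0)) ord0 j.

Definition bary_coord K x (c : index -> R) : Prop :=
  [/\ forall i, i \notin K -> c i = 0, \sum_i c i = 1 & \sum_i c i *: a i = x].

(** Barycentric coordinates of any point of the space, possibly negative, indexed by all mesh
    vertices and zero off K. *)
Definition lam K x : index -> R := get [set c | bary_coord K x c].

Definition bgrad K i : 'rV[R]_d :=
  get [set g | exists b, forall x, lam K x i = dot g x + b].

Lemma enumerates_exists K : #|K| = d.+1 -> exists e, enumerates K e.
Proof.
move=> cK; exists (fun p => enum_val (cast_ord (esym cK) p)).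
have inj : injective (fun p => enum_val (cast_ord (esym cK) p)).
  by move=> p q /enum_val_inj /cast_ord_inj.
split=> //; apply/eqP; rewrite eqEcard; apply/andP; split; last by rewrite card_imset// card_ord cK.
by apply/fintype.subsetP => _ /imsetP[p _ ->]; exact: enum_valP.
Qed.

Lemma enumerates_in K e p : enumerates K e -> e p \in K.
Proof. by case=> _ <-; rewrite imset_f. Qed.

Lemma enumerates_sum (V : nmodType) K e (F : index -> V) : enumerates K e ->
  (forall i, i \notin K -> F i = 0) -> \sum_i F i = \sum_p F (e p).
Proof.
move=> [inj eK] F0; rewrite (bigID (fun i => i \in K)) /= [X in _ + X]big1 ?addr0//.
rewrite -eK big_imset /=; last by move=> ? ? _ _; exact: inj.
by apply: eq_bigl => p; rewrite inE.
Qed.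

Definition ext_coef (e : 'I_d.+1 -> index) (z : 'I_d.+1 -> R) i : R :=
  if [pick p | e p == i] is Some p then z p else 0.

Lemma ext_coefE K e z p : enumerates K e -> ext_coef e z (e p) = z p.
Proof.
move=> [inj _]; rewrite /ext_coef; case: pickP => [q /eqP/inj -> //|/(_ p)].
by rewrite eqxx.
Qed.

Lemma ext_coef0 K e z i : enumerates K e -> i \notin K -> ext_coef e z i = 0.
Proof.
move=> eK; rewrite /ext_coef; case: pickP => // p /eqP <-.
by rewrite (enumerates_in p eK).
Qed.

Lemma edge_mx_comb e (z : 'I_d.+1 -> R) :
  \sum_p z p *: a (e p) =
  (\sum_p z p) *: a (e ord0) + (\row_p z (lift ord0 p)) *m edge_mx e.
Proof.
apply/rowP => j; rewrite summxE 3!mxE !big_ord_recl /= mxE mulrDl -addrA.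
congr (_ + _); rewrite mulr_suml -big_split /=; apply: eq_bigr => p _.
by rewrite !mxE; ring.
Qed.

(** A row vector y killed by the edge matrix is an affine dependence of the vertices, with
    coefficient - sum y at the base vertex. *)
Lemma edge_mx_unit K e : good_simplex K -> enumerates K e -> edge_mx e \in unitmx.
Proof.
move=> [_ ai] eK; rewrite -row_free_unit; apply: inj_row_free => y yE.
pose z p := if unlift ord0 p is Some q then y ord0 q else - \sum_q y ord0 q.
have zl q : z (lift ord0 q) = y ord0 q by rewrite /z liftK.
have z0 : z ord0 = - \sum_q y ord0 q by rewrite /z unlift_none.
have sz : \sum_p z p = 0.
  by rewrite big_ord_recl z0 [X in _ + X](eq_bigr _ (fun q _ => zl q)) addNr.
have c0 := ai (ext_coef e z) (fun i => ext_coef0 z eK).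
apply/rowP => q; rewrite mxE -zl -(ext_coefE z _ eK); apply: c0.
  rewrite (enumerates_sum eK) => [|i]; last exact: ext_coef0.
  by under eq_bigr do rewrite (ext_coefE z _ eK).
rewrite (enumerates_sum eK) => [|i iK]; last by rewrite (ext_coef0 z eK iK) scale0r.
under eq_bigr do rewrite (ext_coefE z _ eK).
rewrite edge_mx_comb sz scale0r add0r (_ : \row_p _ = y)//.
by apply/rowP => p; rewrite mxE zl.
Qed.

Definition loc_coef e x (p : 'I_d.+1) : R :=
  let y := (x - a (e ord0)) *m invmx (edge_mx e) in
  if unlift ord0 p is Some q then y ord0 q else 1 - \sum_q y ord0 q.

Lemma loc_coef_lift e x q :
  loc_coef e x (lift ord0 q) = ((x - a (e ord0)) *m invmx (edge_mx e)) ord0 q.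
Proof. by rewrite /loc_coef liftK. Qed.

Lemma loc_coef_sum e x : \sum_p loc_coef e x p = 1.
Proof.
rewrite big_ord_recl /loc_coef unlift_none.
by under [X in _ + X]eq_bigr do rewrite liftK; rewrite subrK.
Qed.

Lemma bary_coord_loc K e x : good_simplex K -> enumerates K e ->
  bary_coord K x (ext_coef e (loc_coef e x)).
Proof.
move=> gK eK; split=> [i|| ]; first exact: ext_coef0.
  rewrite (enumerates_sum eK) => [|i]; last exact: ext_coef0.
  by under eq_bigr do rewrite (ext_coefE _ _ eK); exact: loc_coef_sum.
rewrite (enumerates_sum eK) => [|i iK]; last by rewrite (ext_coef0 _ eK iK) scale0r.
under eq_bigr do rewrite (ext_coefE _ _ eK).
rewrite edge_mx_comb loc_coef_sum scale1r (_ : \row_p _ = (x - a (e ord0)) *m invmx (edge_mx e)).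
  by rewrite mulmxKV ?(edge_mx_unit gK eK)// addrC subrK.
by apply/rowP => p; rewrite mxE loc_coef_lift.
Qed.

Lemma bary_coord_unique K x c c' : good_simplex K ->
  bary_coord K x c -> bary_coord K x c' -> c = c'.
Proof.
move=> [_ ai] [h1 h2 h3] [h1' h2' h3']; apply/funext => i; apply/eqP; rewrite -subr_eq0.
apply/eqP; apply: (ai (fun i => c i - c' i)) => [j jK||].
- by rewrite h1// h1'// subrr.
- by rewrite sumrB h2 h2' subrr.
- by under eq_bigr do rewrite scalerBl; rewrite sumrB h3 h3' subrr.
Qed.

Lemma lamP K x : good_simplex K -> bary_coord K x (lam K x).
Proof.
move=> gK; have [e eK] := enumerates_exists gK.1.
exact: (@getPex _ [set c | bary_coord K x c] (ex_intro _ _ (bary_coord_loc x gK eK))).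
Qed.

Lemma lam_unique K x c : good_simplex K -> bary_coord K x c -> lam K x = c.
Proof. by move=> gK; apply: bary_coord_unique => //; exact: lamP. Qed.

Lemma lam_enum K e x p : good_simplex K -> enumerates K e ->
  lam K x (e p) = loc_coef e x p.
Proof.
move=> gK eK; rewrite (lam_unique gK (bary_coord_loc x gK eK)).
exact: ext_coefE eK.
Qed.

Lemma lam_out K x i : good_simplex K -> i \notin K -> lam K x i = 0.
Proof. by move=> gK; have [h _ _] := lamP x gK; exact: h. Qed.

Lemma lam_sum K x : good_simplex K -> \sum_i lam K x i = 1.
Proof. by move=> gK; have [] := lamP x gK. Qed.

Lemma lam_comb K x : good_simplex K -> \sum_i lam K x i *: a i = x.
Proof. by move=> gK; have [] := lamP x gK. Qed.

Lemma lam_vert K i j : good_simplex K -> j \in K -> lam K (a j) i = (i == j)%:R.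
Proof.
move=> gK jK; rewrite (lam_unique gK (c := fun i => (i == j)%:R))//; split.
- by move=> k; apply: contraNeq; rewrite pnatr_eq0 eqb0 negbK => /eqP ->.
- by rewrite (bigD1 j)//= eqxx big1 ?addr0// => k /negbTE ->.
- rewrite (bigD1 j)//= eqxx scale1r big1 ?addr0// => k /negbTE ->.
  by rewrite scale0r.
Qed.

Lemma lam_affine K i : good_simplex K -> exists g b, forall x, lam K x i = dot g x + b.
Proof.
move=> gK; have [iK|iK] := boolP (i \in K); last first.
  by exists 0, 0 => x; rewrite lam_out// dot0l addr0.
have [e eK] := enumerates_exists gK.1.
have lift_aff q : exists g b, forall x, loc_coef e x (lift ord0 q) = dot g x + b.
  exists (col q (invmx (edge_mx e)))^T, (- dot (col q (invmx (edge_mx e)))^T (a (e ord0))) => x.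
  rewrite loc_coef_lift -dotBr dotC dot_mulmx trmxK mxE [RHS]mxE.
  by apply: eq_bigr => j _; rewrite [col _ _ _ _]mxE.
have [inj eKE] := eK; move: iK; rewrite -eKE => /imsetP[p _ ->].
case: (unliftP ord0 p) => [q ->|->].
  have [g [b gb]] := lift_aff q; exists g, b => x.
  by rewrite eKE (lam_enum _ _ gK eK).
have /choice[g /choice[b gb]] := lift_aff.
exists (- \sum_q g q), (1 - \sum_q b q) => x; rewrite eKE (lam_enum _ _ gK eK).
have := loc_coef_sum e x; rewrite big_ord_recl => /(canRL (addrK _)) ->.
under eq_bigr do rewrite gb; rewrite big_split /=.
have -> : dot (- \sum_q g q) x = - \sum_q dot (g q) x.
  have := dot_suml (fun=> 1) g x; under eq_bigr do rewrite scale1r.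
  by rewrite dotNl => ->; congr (- _); apply: eq_bigr => q _; rewrite mul1r.
ring.
Qed.

Lemma bgradP K i : good_simplex K -> exists b, forall x, lam K x i = dot (bgrad K i) x + b.
Proof.
move=> gK; have [g [b gb]] := lam_affine i gK.
exact: (@getPex _ [set g | exists b, forall x, lam K x i = dot g x + b]
  (ex_intro _ g (ex_intro _ b gb))).
Qed.

Lemma bgrad_diff K i x y : good_simplex K -> lam K x i - lam K y i = dot (bgrad K i) (x - y).
Proof. by move=> /(bgradP i)[b bE]; rewrite !bE dotBr; ring. Qed.

Lemma bgrad_unique K i g b : good_simplex K -> (forall x, lam K x i = dot g x + b) ->
  bgrad K i = g.
Proof.
move=> gK gb; apply: dot_inj => z; have := bgrad_diff i z 0 gK; rewrite !gb subr0 => <-.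
rewrite [dot g 0]dotC dot0l; ring.
Qed.

Lemma bgrad_lift K e q : good_simplex K -> enumerates K e ->
  bgrad K (e (lift ord0 q)) = (col q (invmx (edge_mx e)))^T.
Proof.
move=> gK eK; apply: (bgrad_unique (b := - dot (col q (invmx (edge_mx e)))^T (a (e ord0)))) => // x.
rewrite (lam_enum _ _ gK eK) loc_coef_lift -dotBr dotC dot_mulmx trmxK mxE [RHS]mxE.
by apply: eq_bigr => j _; rewrite [col _ _ _ _]mxE.
Qed.

Lemma bgrad_out K i : good_simplex K -> i \notin K -> bgrad K i = 0.
Proof.
move=> gK iK; apply: (bgrad_unique (b := 0)) => // x.
by rewrite lam_out// dot0l addr0.
Qed.

Lemma bgrad_sum K : good_simplex K -> \sum_i bgrad K i = 0.
Proof.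
move=> gK; apply: dot_inj => z; rewrite dot0l.
have := dot_suml (fun=> 1) (bgrad K) z; under eq_bigr do rewrite scale1r.
move=> ->; under eq_bigr => i _.
  rewrite mul1r (_ : dot _ z = lam K z i - lam K 0 i); first over.
  by rewrite bgrad_diff// subr0.
by rewrite sumrB !lam_sum// subrr.
Qed.

Lemma lam_continuous K i : good_simplex K -> continuous (fun x => lam K x i).
Proof.
move=> /(bgradP i)[b bE]; under eq_fun do rewrite bE.
move=> x; apply: (@continuousD _ _ _ (fun x => dot (bgrad K i) x) (cst b)).
  exact: continuous_dot.
exact: cst_continuous.
Qed.

End simplex.

(** * Volumes of simplices *)

Section simplex_measure_theory.
Context {R : realType} {d : nat} (Th : mesh R d).
Local Notation index := ('I_(nvert Th)).
Local Notation a := (vert (m := Th)).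
Implicit Types (K L : {set index}) (i j : index) (x : 'rV[R]_d).

Definition osimp K : set 'rV[R]_d := [set x | forall i, i \in K -> 0 < lam K x i].

Definition vol K : R := fine (leb d (osimp K)).

Definition std_simplex : set 'rV[R]_d :=
  [set y | (forall p, 0 <= y ord0 p) /\ \sum_p y ord0 p <= 1].

(** The volume 1/d! of the reference simplex, kept symbolic because only its sign enters the signs
    of the stiffness entries. *)
Definition std_vol : R := fine (leb d std_simplex).

Lemma hullP K x : good_simplex K -> hull K x <-> forall i, 0 <= lam K x i.
Proof.
move=> gK; split=> [[c [c0 cK c1 xc]]|h].
  by rewrite (lam_unique gK (c := c)).
exists (lam K x); split=> //.
- by move=> i; exact: lam_out.
- exact: lam_sum.
- by rewrite lam_comb.
Qed.

Lemma osimp_hull K : good_simplex K -> osimp K `<=` hull K.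
Proof.
move=> gK x xK; apply/hullP => // i; have [/xK/ltW//|iK] := boolP (i \in K).
by rewrite lam_out.
Qed.

Lemma lam_measurable K i : good_simplex K -> measurable_fun setT (fun x => lam K x i).
Proof. by move=> gK; apply: continuous_measurable_rV; exact: lam_continuous. Qed.

Lemma osimp_open K : good_simplex K -> open (osimp K).
Proof.
move=> gK; rewrite openE => x xK.
have : \forall y \near x, forall i, i \in K -> 0 < lam K y i.
  apply: (@filter_forall _ _ (fun i y => i \in K -> 0 < lam K y i) (nbhs x) _) => i.
  have [iK|iK] := boolP (i \in K); last by apply: filterE => y.
  have h : \forall y \near x, 0 < lam K y i.
    exact: (cvgr_gt (f := fun y => lam K y i) (lam K x i) (@lam_continuous _ _ _ _ i gK x) 0 (xK i iK)).
  by apply: filterS h => y.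
exact.
Qed.

Lemma hull_closed K : good_simplex K -> closed (hull K).
Proof.
move=> gK; rewrite (_ : hull K = \bigcap_(i in setT) [set x | 0 <= lam K x i]); last first.
  by apply/seteqP; split=> x; [move=> /(hullP _ gK) h i _|move=> h; apply/(hullP _ gK) => i]; exact: h.
apply: closed_bigI => i _.
have := @closed_comp _ _ (fun x => lam K x i) [set y | 0 <= y].
by apply; [move=> x _; exact: lam_continuous|exact: closed_ge].
Qed.

Lemma osimp_measurable K : good_simplex K -> measurable (osimp K).
Proof. by move=> gK; apply: open_measurable_rV; exact: osimp_open. Qed.

Lemma hull_measurable K : good_simplex K -> measurable (hull K).
Proof.
move=> gK; rewrite -[hull K]setCK; apply: measurableC; apply: open_measurable_rV.
by apply: closed_openC; exact: hull_closed.
Qed.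

Lemma hull_bounded K x : hull K x -> `|x| <= \sum_i `|a i|.
Proof.
move=> [c [c0 cK c1 ->]]; apply: le_trans (ler_norm_sum _ _ _) _.
apply: ler_sum => i _; rewrite normrZ ger0_norm// ler_piMl//.
by rewrite -c1 (bigD1 i)//= lerDl sumr_ge0.
Qed.

Lemma hull_lty K : good_simplex K -> (leb d (hull K) < +oo)%E.
Proof.
move=> gK; apply: leb_bounded_lty; first exact: hull_measurable.
exists (\sum_i `|a i|); split; first by rewrite num_real.
by move=> M ltM x xK; apply: le_trans (hull_bounded xK) (ltW ltM).
Qed.

Lemma bgrad_neq0 K i : (0 < d)%N -> good_simplex K -> i \in K -> bgrad K i != 0.
Proof.
move=> d0 gK iK; apply/eqP => g0.
have [j jK ji] : exists2 j, j \in K & j != i.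
  have : (0 < #|K :\ i|)%N by have := cardsD1 i K; rewrite iK gK.1 add1n => -[<-].
  by case/card_gt0P=> j; rewrite !inE => /andP[? ?]; exists j.
have := bgrad_diff i (a i) (a j) gK.
rewrite g0 dot0l !lam_vert// eqxx eq_sym (negbTE ji) subr0 => /eqP.
by rewrite oner_eq0.
Qed.

Lemma face_null K i : (0 < d)%N -> good_simplex K -> i \in K ->
  leb d [set x | lam K x i = 0] = 0%E.
Proof.
move=> d0 gK iK; have [b bE] := bgradP i gK.
rewrite -(leb_hyperplane (- b) (bgrad_neq0 d0 gK iK)).
congr (leb d _); apply/seteqP; split => x /=; rewrite bE => /eqP.
  by rewrite addr_eq0 => /eqP.
by rewrite -addr_eq0 => /eqP.
Qed.

(** A point of the hull outside the open simplex has a zero coordinate, hence lies on one of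
    finitely many hyperplanes. *)
Lemma hull_boundary_negligible K : (0 < d)%N -> good_simplex K ->
  (leb d).-negligible (hull K `\` osimp K).
Proof.
move=> d0 gK.
pose F i : set 'rV[R]_d := if i \in K then [set x | lam K x i = 0] else set0.
apply: (@negligibleS _ _ _ _ (\big[setU/set0]_i F i)).
  move=> x [/(hullP _ gK) xK] /existsNP[i /not_implyP[iK /negP]].
  rewrite -leNgt => xi; rewrite -bigcup_seq; exists i; first by rewrite /= mem_index_enum.
  by rewrite /F iK /=; apply/eqP; rewrite eq_le xi xK.
elim: (index_enum _) => [|i r IH]; first by rewrite big_nil; exact: negligible_set0.
rewrite big_cons; apply: negligibleU IH; rewrite /F; case: ifP => iK; last exact: negligible_set0.
apply/negligibleP; last exact: face_null.
rewrite -[X in measurable X]setTI.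
exact: (lam_measurable i gK measurableT (measurable_set1 0)).
Qed.

Lemma leb_osimp K : (0 < d)%N -> good_simplex K -> leb d (osimp K) = leb d (hull K).
Proof.
move=> d0 gK; rewrite -[in RHS](setDUK (osimp_hull gK)).
have mb : measurable (hull K `\` osimp K).
  by apply: measurableD; [exact: hull_measurable|exact: osimp_measurable].
rewrite measureU//; last 2 first.
  exact: osimp_measurable.
  by apply/seteqP; split=> // x [? []].
have /negligibleP := hull_boundary_negligible d0 gK.
by move=> /(_ mb) b0; rewrite [X in (_ + X)%E]b0 adde0.
Qed.

(** The affine map y -> y E + a_0, with E the edge matrix, carries the reference simplex onto K. *)
Lemma volE K e : (0 < d)%N -> good_simplex K -> enumerates K e ->
  vol K = `|\det (edge_mx e)| * std_vol.
Proof.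
move=> d0 gK eK; rewrite /vol leb_osimp//.
rewrite (leb_affine (a (e ord0)) (edge_mx_unit gK eK) (hull_measurable gK)).
rewrite (_ : _ @^-1` _ = std_simplex); last first.
  have lamE y p : lam K (y *m edge_mx e + a (e ord0)) (e p) =
      (if unlift ord0 p is Some q then y ord0 q else 1 - \sum_q y ord0 q).
    rewrite (lam_enum _ _ gK eK) /loc_coef addrK mulmxK//.
    exact: edge_mx_unit eK.
  apply/seteqP; split => y /=.
    move=> /(hullP _ gK) h; split=> [p|].
      by have := h (e (lift ord0 p)); rewrite lamE liftK.
    by have := h (e ord0); rewrite lamE unlift_none subr_ge0.
  move=> [y0 y1]; apply/hullP => // i; have [iK|iK] := boolP (i \in K); last first.
    by rewrite lam_out.
  move: iK; rewrite -[in i \in K]eK.2 => /imsetP[p _ ->]; rewrite lamE.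
  by case: unliftP => [q _|_]; [exact: y0|rewrite subr_ge0].
have dE : 0 < `|\det (edge_mx e)|.
  by rewrite normr_gt0 -unitfE -unitmxE; exact: edge_mx_unit eK.
(* The other factor being a positive real, [fine] is multiplicative here even at infinite values. *)
rewrite /std_vol; case: (leb d std_simplex) => [r //||].
  by rewrite gt0_muley ?lte_fin//= mulr0.
by rewrite gt0_muleNy ?lte_fin//= mulr0.
Qed.

(** The open simplex contains the barycenter, and a nonempty open set has positive measure. *)
Lemma vol_gt0 K : (0 < d)%N -> good_simplex K -> 0 < vol K.
Proof.
move=> d0 gK; rewrite /vol fine_gt0// leb_osimp// hull_lty// andbT -leb_osimp//.
have [K0] : exists i, i \in K by apply/card_gt0P; rewrite gK.1.
pose x : 'rV[R]_d := \sum_i (if i \in K then d.+1%:R^-1 else 0) *: a i.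
move=> _; apply: (@leb_open_gt0 _ _ _ x (osimp_open gK)) => i iK.
rewrite (lam_unique gK (c := fun i => if i \in K then d.+1%:R^-1 else 0)) ?iK ?invr_gt0//.
split=> //.
- by move=> j /negbTE ->.
- by rewrite -big_mkcond /= sumr_const gK.1 -[_ *+ _]mulr_natl divff.
Qed.

End simplex_measure_theory.

(** * The cotangent formula *)

(* Jacobi's identity for complementary minors of a matrix and its inverse. *)
Lemma det_compl_minor (F : comNzRingType) m n (M N : 'M[F]_(m + n)) :
  M *m N = 1%:M -> \det M * \det (ulsubmx N) = \det (drsubmx M).
Proof.
move=> MN.
have ME : M *m block_mx (ulsubmx N) 0 (dlsubmx N) 1%:M =
    block_mx 1%:M (ursubmx M) 0 (drsubmx M).
  move: MN; rewrite -[in M *m N](submxK M) -[in _ *m N](submxK N) mulmx_block.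
  rewrite (scalar_mx_block m n 1) => /eq_block_mx[h1 _ h2 _].
  by rewrite -[X in X *m _]submxK mulmx_block h1 h2 !mulmx0 !mulmx1 !add0r.
have := congr1 determinant ME.
by rewrite det_mulmx det_lblock det_ublock !det1 mulr1 mul1r.
Qed.

Lemma det_mx2 (F : comNzRingType) (M : 'M[F]_2) :
  \det M = M ord0 ord0 * M ord_max ord_max - M ord0 ord_max * M ord_max ord0.
Proof.
rewrite (expand_det_row _ ord0) !big_ord_recl big_ord0 addr0 /cofactor !det_mx11 !mxE /=.
have -> : lift ord0 ord0 = ord_max :> 'I_2 by apply: val_inj.
have -> : lift ord_max ord0 = ord0 :> 'I_2 by apply: val_inj.
by rewrite addn0 expr0 mul1r /= expr1 mulN1r mulrN.
Qed.

Lemma simplex_measureE (R : realType) d (b : 'rV[R]_d) (s : seq 'rV[R]_d) n : size s = n ->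
  simplex_measure (b :: s) =
  Num.sqrt (\det (\matrix_(p < n, q < n) dot (s`_p - b) (s`_q - b))) / (n`!)%:R.
Proof. by move=> <-. Qed.

Section stiffness_sign.
Context {R : realType} {d' : nat}.
Notation d := d'.+2.
Context (Th : mesh R d).
Local Notation index := ('I_(nvert Th)).
Local Notation a := (vert (m := Th)).
Implicit Types (K L : {set index}) (i j : index).

(** The base vertex is taken in the simplex opposite to the edge, and i, j come right after it. The
    lower right block of the Gram matrix of the edges is then that of the opposite simplex, and the
    upper left 2 by 2 block of its inverse is that of the gradients at i and j. *)
Lemma enumerates_edge K i j : #|K| = d.+1 -> i \in K -> j \in K -> i != j ->
  exists e, [/\ enumerates K e, e (lift ord0 (lshift d' (ord0 : 'I_2))) = i,
    e (lift ord0 (lshift d' (ord_max : 'I_2))) = j &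
    exists2 s, [seq a k | k <- enum (K :\ i :\ j)] = a (e ord0) :: s &
      size s = d' /\ forall p : 'I_d', s`_p = a (e (lift ord0 (rshift 2 p)))].
Proof.
move=> cK iK jK ij.
have : size (enum (K :\ i :\ j)) = d'.+1.
  rewrite -cardE; have := cardsD1 i K; have := cardsD1 j (K :\ i).
  rewrite iK !inE eq_sym ij jK cK /= => -> /eqP; rewrite !add1n !eqSS => /eqP <-.
  by [].
case Et : (enum (K :\ i :\ j)) => [//|k0 t] /= [st].
pose s0 := k0 :: i :: j :: t.
have us : uniq s0.
  have : uniq (k0 :: t) by rewrite -Et enum_uniq.
  have iN : i \notin k0 :: t by rewrite -Et mem_enum !inE eqxx andbF.
  have jN : j \notin k0 :: t by rewrite -Et mem_enum !inE eqxx.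
  move: iN jN; rewrite /s0 !cons_uniq !in_cons !negb_or => /andP[ik it] /andP[jk jt] /andP[kt ut].
  by rewrite [k0 == i]eq_sym ik [k0 == j]eq_sym jk kt ij it jt ut.
have ss : size s0 = d.+1 by rewrite /= st.
pose e (p : 'I_d.+1) := nth i s0 p.
have sK k : k \in s0 -> k \in K.
  rewrite !inE => /or4P[/eqP->|/eqP->//|/eqP->//|kt].
    have : k0 \in enum (K :\ i :\ j) by rewrite Et mem_head.
    by rewrite mem_enum !inE => /and3P[].
  have : k \in enum (K :\ i :\ j) by rewrite Et inE kt orbT.
  by rewrite mem_enum !inE => /and3P[].
have inj : injective e.
  move=> p q /eqP; rewrite /e nth_uniq ?ss ?ltn_ord// => /eqP pq.
  exact: val_inj.
exists e; split => //.
  split=> //; apply/eqP; rewrite eqEcard; apply/andP; split.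
    by apply/fintype.subsetP => _ /imsetP[p _ ->]; apply: sK; rewrite mem_nth ?ss.
  by rewrite card_imset// card_ord cK.
exists [seq a k | k <- t] => //; split; first by rewrite size_map.
by move=> p; rewrite (nth_map i) ?st.
Qed.

(** The normalized opposite gradient satisfies the three clauses. Conversely, any such n differs
    from a negative multiple of the gradient by a vector orthogonal to all edges, hence zero, and
    the unit length fixes the multiple. *)
Lemma normal_bgrad K i : good_simplex K -> i \in K ->
  outward_normal K i = - (enorm (bgrad K i))^-1 *: bgrad K i.
Proof.
move=> gK iK; set g := bgrad K i.
have g0 : g != 0 by exact: bgrad_neq0.
have eg : 0 < enorm g.
  rewrite sqrtr_gt0 lt_neqAle dot_ge0 andbT eq_sym.
  by apply: contra_neq g0 => /dot_eq0.
have eg2 : enorm g ^+ 2 = dot g g by rewrite sqr_sqrtr// dot_ge0.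
have gkl k l : k \in K -> l \in K -> dot g (a k - a l) = (i == k)%:R - (i == l)%:R.
  by move=> kK lK; rewrite -(bgrad_diff i _ _ gK) !lam_vert.
set nn := - (enorm g)^-1 *: g.
have nP : [/\ enorm nn = 1,
    forall k l, k \in K :\ i -> l \in K :\ i -> dot nn (a k - a l) = 0
  & forall k, k \in K :\ i -> dot nn (a i - a k) < 0].
  split.
  - rewrite /enorm /nn dotZl dotZr -eg2 mulrA mulNr mulrN opprK.
    have -> : (enorm g)^-1 / enorm g * enorm g ^+ 2 = 1 by field; rewrite gt_eqF.
    by rewrite sqrtr1.
  - move=> k l; rewrite !inE => /andP[ki kK] /andP[li lK].
    by rewrite dotZl gkl// eq_sym (negbTE ki) eq_sym (negbTE li) subrr mulr0.
  - move=> k; rewrite !inE => /andP[ki kK]; rewrite dotZl gkl// eqxx eq_sym (negbTE ki).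
    by rewrite subr0 mulr1 oppr_lt0 invr_gt0.
rewrite /outward_normal; set N := [set n | _].
have [h1 h2 h3] : N (get N) by apply: (@getPex _ N); exists nn.
set n := get N in h1 h2 h3 *.
have [e eK] := enumerates_exists gK.1.
have [b bK] : exists b, b \in K :\ i.
  by apply/card_gt0P; have := cardsD1 i K; rewrite iK gK.1 add1n => -[<-].
have bK' : b \in K by move: bK; rewrite !inE => /andP[].
have bi : i != b by move: bK; rewrite !inE eq_sym => /andP[].
pose s := - dot n (a i - a b).
have s0 : 0 < s by rewrite oppr_gt0 h3.
have nE : n = - s *: g.
  apply/eqP; rewrite -subr_eq0; apply/eqP.
  have w0 k : k \in K -> dot (n - - s *: g) (a k - a b) = 0.
    move=> kK; rewrite dotBl dotZl gkl// (negbTE bi) subr0.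
    have [<-|ik] := eqVneq i k; first by rewrite (_ : true%:R = 1 :> R)// /s; ring.
    by rewrite h2// ?mulr0 ?subr0// !inE eq_sym ik.
  move: (n - - s *: g) w0 => w w0.
  have : w *m (edge_mx e)^T = 0.
    apply/rowP => p; rewrite mxE [RHS]mxE.
    have : dot w (a (e (lift ord0 p)) - a (e ord0)) = 0.
      have := w0 _ (enumerates_in (lift ord0 p) eK).
      have := w0 _ (enumerates_in ord0 eK).
      by rewrite !dotBr => /subr0_eq <- /subr0_eq ->; rewrite subrr.
    by move=> h; rewrite -[RHS]h; apply: eq_bigr => j _; rewrite !mxE.
  have u : (edge_mx e)^T \in unitmx by rewrite unitmx_tr; exact: edge_mx_unit eK.
  by move=> /(congr1 (mulmx^~ (invmx (edge_mx e)^T))); rewrite mul0mx mulmxK.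
have : s * enorm g = 1.
  rewrite -h1 nE /enorm dotZl dotZr -/(enorm g) mulrA mulrNN -expr2.
  by rewrite sqrtrM ?sqr_ge0// sqrtr_sqr gtr0_norm.
rewrite nE /nn => sg; congr (- _ *: _).
by rewrite -[s](mulfK (lt0r_neq0 eg)) sg mul1r.
Qed.

(** Strict Cauchy-Schwarz inequality. In dimension at least 2 there is a third vertex k, and pairing
    |h|^2 g - (g, h) h with a_i - a_k gives |h|^2, so this vector is nonzero. *)
Lemma gram_gt0 K i j : good_simplex K -> i \in K -> j \in K -> i != j ->
  0 < dot (bgrad K i) (bgrad K i) * dot (bgrad K j) (bgrad K j)
      - dot (bgrad K i) (bgrad K j) ^+ 2.
Proof.
move=> gK iK jK ij; set g := bgrad K i; set h := bgrad K j.
have hh : 0 < dot h h.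
  rewrite lt_neqAle dot_ge0 andbT eq_sym; apply/eqP => /dot_eq0/eqP.
  by apply/negP; exact: bgrad_neq0.
pose w := dot h h *: g - dot g h *: h.
have wE : dot w w = dot h h * (dot g g * dot h h - dot g h ^+ 2).
  by rewrite /w !dotBl !dotBr !dotZl !dotZr [dot h g]dotC; ring.
have w0 : w != 0.
  apply/eqP => w0; have [k] : exists k, k \in K :\ i :\ j.
    apply/card_gt0P; have := cardsD1 i K; have := cardsD1 j (K :\ i).
    by rewrite iK !inE eq_sym ij jK gK.1 /= => -> /eqP; rewrite !add1n !eqSS => /eqP <-.
  rewrite !inE => /and3P[kj ki kK].
  have : dot w (a i - a k) = dot h h.
    rewrite /w dotBl !dotZl -!(bgrad_diff _ _ _ gK) !lam_vert// eqxx [j == i]eq_sym (negbTE ij).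
    by rewrite [i == k]eq_sym (negbTE ki) [j == k]eq_sym (negbTE kj) /= !subr0 mulr1 mulr0 subr0.
  by rewrite w0 dot0l => h0; move: hh; rewrite -h0 ltxx.
have : 0 < dot w w.
  by rewrite lt_neqAle dot_ge0 andbT eq_sym; apply: contra_neq w0 => /dot_eq0.
by rewrite wE pmulr_rgt0.
Qed.

(* Gradients of barycentric coordinates are the columns of the inverse of the
   edge matrix, so their Gram determinant is a minor of the inverse of the Gram
   matrix of the edges. *)
Lemma cot_formula K i j : good_simplex K -> i \in K -> j \in K -> i != j ->
  vol K * dot (bgrad K i) (bgrad K j) =
  - (std_vol (R := R) (d := d) * d'`!%:R) * (opposite_measure K i j * cot (dihedral_angle K i j)).
Proof.
move=> gK iK jK ij.
have [e [eK ei ej [s sE [ss sp]]]] := enumerates_edge gK.1 iK jK ij.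
rewrite (volE _ gK eK)// /opposite_measure sE (simplex_measureE _ ss).
set E := edge_mx e.
have uE : E \in unitmx by exact: edge_mx_unit eK.
set g := bgrad K i; set h := bgrad K j.
have gE : g = (col (lshift d' (ord0 : 'I_2)) (invmx E))^T.
  by rewrite /g -ei; exact: bgrad_lift.
have hE : h = (col (lshift d' (ord_max : 'I_2)) (invmx E))^T.
  by rewrite /h -ej; exact: bgrad_lift.
pose M : 'M[R]_(2 + d') := E *m E^T.
pose N : 'M[R]_(2 + d') := (invmx E)^T *m invmx E.
have MN : M *m N = 1%:M.
  by rewrite /M /N mulmxA -[E *m _ *m _]mulmxA -trmx_mul mulVmx// trmx1 mulmx1 mulmxV.
(* The Gram determinant of the opposite simplex equals det E ^ 2 times G, the Gram determinant of
   the two gradients. *)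
have := det_compl_minor MN.
have -> : \det M = \det E ^+ 2 by rewrite det_mulmx det_tr expr2.
set G := dot g g * dot h h - dot g h ^+ 2.
have dotcol p q : dot (col p (invmx E))^T (col q (invmx E))^T = N p q.
  by rewrite /N !mxE; apply: eq_bigr => k _; rewrite !mxE.
have -> : \det (ulsubmx N) = G.
  rewrite det_mx2 ![ulsubmx N _ _]mxE ![usubmx N _ _]mxE -!dotcol -gE -hE.
  by rewrite [dot h g]dotC /G expr2.
have -> : drsubmx M = \matrix_(p < d', q < d') dot (s`_p - a (e ord0)) (s`_q - a (e ord0)).
  apply/matrixP => p q; rewrite !mxE; apply: eq_bigr => k _.
  by rewrite [in RHS]sp [in RHS]sp !mxE.
move=> <-.
have G0 : 0 < G by exact: gram_gt0.
rewrite sqrtrM ?sqr_ge0// sqrtr_sqr.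
have gg : 0 < dot g g.
  rewrite lt_neqAle dot_ge0 andbT eq_sym; apply/eqP => /dot_eq0/eqP.
  by apply/negP; exact: bgrad_neq0.
have hh : 0 < dot h h.
  rewrite lt_neqAle dot_ge0 andbT eq_sym; apply/eqP => /dot_eq0/eqP.
  by apply/negP; exact: bgrad_neq0.
have eg : 0 < enorm g by rewrite sqrtr_gt0.
have eh : 0 < enorm h by rewrite sqrtr_gt0.
have eg2 : enorm g ^+ 2 = dot g g by rewrite sqr_sqrtr// dot_ge0.
have eh2 : enorm h ^+ 2 = dot h h by rewrite sqr_sqrtr// dot_ge0.
rewrite /dihedral_angle !normal_bgrad// -/g -/h dotZl dotZr.
set c := _ * (_ * _).
have cE : c = dot g h / (enorm g * enorm h).
  by rewrite /c; field; rewrite !gt_eqF.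
(* G appears again in the sine of the dihedral angle, so its square root cancels against that in the
   opposite measure. *)
have c2 : 1 - c ^+ 2 = G / (enorm g * enorm h) ^+ 2.
  by rewrite cE /G -eg2 -eh2; field; rewrite !gt_eqF.
have c1 : -1 <= c <= 1.
  rewrite -ler_norml -(expr_le1 (n := 2))// real_normK ?num_real//.
  by rewrite -subr_ge0 c2 divr_ge0 ?sqr_ge0// ltW.
have -> : cot (pi - acos c) = - c / Num.sqrt (1 - c ^+ 2).
  rewrite /cot cosB sinB cospi sinpi acosK ?in_itv//= sin_acos// !mul0r.
  by rewrite addr0 sub0r !mulN1r opprK.
rewrite c2 sqrtrM ?ltW// sqrtrV ?sqr_ge0// sqrtr_sqr [`|enorm g * _|]gtr0_norm ?mulr_gt0// cE.
have sG : Num.sqrt G != 0 by rewrite gt_eqF// sqrtr_gt0.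
have f0 : d'`!%:R != 0 :> R by rewrite pnatr_eq0 -lt0n fact_gt0.
by field; rewrite sG f0 !gt_eqF.
Qed.

End stiffness_sign.

(** * Nodal functions *)

Section mesh_theory.
Context {R : realType} {d : nat} (Th : mesh R d) (D : set 'rV[R]_d).
Local Notation index := ('I_(nvert Th)).
Local Notation a := (vert (m := Th)).
Local Notation SS := (simplices Th).
Context (d0 : (0 < d)%N).
Context (cD : conforming_triangulation Th D).
Implicit Types (K L : {set index}) (i j : index) (x : 'rV[R]_d) (U V : index -> R).

Lemma mesh_good K : K \in SS -> good_simplex K.
Proof. by have [h _ _ _ _] := cD; exact: h. Qed.

Lemma hull_mesh_domain K : K \in SS -> hull K `<=` mesh_domain Th.
Proof. by move=> KS x Kx; exists K. Qed.

Lemma sub_mesh_domain : D `<=` mesh_domain Th.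
Proof. by have [_ _ _ <- _] := cD; exact: subset_closure. Qed.

Lemma osimp_sub K : K \in SS -> osimp K `<=` D.
Proof.
move=> KS; have [_ _ _ _ ->] := cD.
rewrite -open_subsetE; last exact/osimp_open/mesh_good.
apply: subset_trans (hull_mesh_domain KS); exact/osimp_hull/mesh_good.
Qed.

Definition nbary x : index -> R :=
  get [set c | exists K, [/\ K \in SS, forall i, 0 <= c i & bary_coord K x c]].

Definition hat i x : R := nbary x i.

Definition fe U x : R := \sum_i U i * hat i x.

(** Conformity makes the choice irrelevant: a point common to K and L lies in the hull of their
    common vertices, and its coordinates there are its barycentric coordinates in both K and L. *)
Lemma nbaryE K x : K \in SS -> hull K x -> nbary x = lam K x.
Proof.
move=> KS Kx; have gK := mesh_good KS; rewrite /nbary; set P := [set c | _].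
have [L [LS c0 cL]] : P (get P).
  apply: (@getPex _ P); exists (lam K x); exists K; split=> //; last exact: lamP.
  exact/hullP.
have Lx : hull L x by have [h1 h2 h3] := cL; exists (get P); split.
have [_ _ KL _ _] := cD; have : hull (K :&: L) x by rewrite -KL.
move=> [c [h1 h2 h3 h4]].
have bc (M : {set index}) : (forall i, i \notin M -> i \notin K :&: L) -> bary_coord M x c.
  by move=> hM; split=> // i /hM; exact: h2.
rewrite (lam_unique gK (bc K _)); last by move=> i iK; rewrite inE negb_and iK.
apply: (bary_coord_unique (mesh_good LS) cL); apply: bc => i iL.
by rewrite inE negb_and iL orbT.
Qed.

Lemma hat_hull K x i : K \in SS -> hull K x -> hat i x = lam K x i.
Proof. by move=> KS Kx; rewrite /hat (nbaryE KS Kx). Qed.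

Lemma fe_hull K x U : K \in SS -> hull K x -> fe U x = \sum_i U i * lam K x i.
Proof. by move=> KS Kx; apply: eq_bigr => i _; rewrite (hat_hull _ KS Kx). Qed.

Lemma vert_hull K i : K \in SS -> i \in K -> hull K (a i).
Proof.
move=> KS iK; have gK := mesh_good KS; apply/hullP => // j.
by rewrite lam_vert// ler0n.
Qed.

Lemma vert_mesh i : exists2 K, K \in SS & i \in K.
Proof. by have [_ h _ _ _] := cD; exact: h. Qed.

Lemma vert_closure i : closure D (a i).
Proof.
have [K KS iK] := vert_mesh i; have [_ _ _ -> _] := cD.
exact: hull_mesh_domain (vert_hull KS iK).
Qed.

Lemma hat_vert i j : hat i (a j) = (i == j)%:R.
Proof.
have [K KS jK] := vert_mesh j; rewrite (hat_hull _ KS (vert_hull KS jK)).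
exact: lam_vert (mesh_good KS) jK.
Qed.

Lemma fe_vert U j : fe U (a j) = U j.
Proof.
rewrite /fe (bigD1 j)//= hat_vert eqxx mulr1 big1 ?addr0// => i ij.
by rewrite hat_vert (negbTE ij) mulr0.
Qed.

Definition pw_affine (v : 'rV[R]_d -> R) : Prop :=
  forall K, K \in SS -> exists (c : 'rV[R]_d) (b : R), forall x, hull K x -> v x = dot c x + b.

Lemma pw_affineE v x : pw_affine v -> mesh_domain Th x -> v x = fe (v \o a) x.
Proof.
move=> av [K KS Kx]; have gK := mesh_good KS; rewrite (fe_hull _ KS Kx).
have [c [b vE]] := av _ KS; rewrite vE// -[in LHS](lam_comb x gK) dot_sumr.
rewrite -[b]mul1r -(lam_sum x gK) mulr_suml -big_split /=; apply: eq_bigr => i _.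
have [iK|iK] := boolP (i \in K); last by rewrite lam_out// !mul0r mulr0 addr0.
by rewrite (vE _ (vert_hull KS iK)) mulrDl; ring.
Qed.

Definition fgrad U K : 'rV[R]_d := \sum_i U i *: bgrad K i.

Lemma fe_affine U K : K \in SS -> exists b, forall x, hull K x -> fe U x = dot (fgrad U K) x + b.
Proof.
move=> KS; have gK := mesh_good KS; exists (\sum_i U i * lam K 0 i) => x Kx.
rewrite (fe_hull _ KS Kx) /fgrad dot_suml -big_split /=; apply: eq_bigr => i _.
by rewrite -mulrDr -[x in dot _ x]subr0 -bgrad_diff// subrK.
Qed.

Lemma fe_pw_affine U : pw_affine (fe U).
Proof. by move=> K KS; have [b h] := fe_affine U KS; exists (fgrad U K), b. Qed.

(** The barycentric coordinates of x in K and in L coincide, and each simplex is the set of indices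
    where they are positive. *)
Lemma osimp_disj K L x : K \in SS -> L \in SS -> osimp K x -> osimp L x -> K = L.
Proof.
move=> KS LS Kx Lx; have gK := mesh_good KS; have gL := mesh_good LS.
have KL : lam K x = lam L x.
  by rewrite -(nbaryE KS (osimp_hull gK Kx)) -(nbaryE LS (osimp_hull gL Lx)).
apply/setP => i; apply/idP/idP => iK.
  by apply: contraTT (Kx _ iK) => iL; rewrite KL lam_out// ltxx.
by apply: contraTT (Lx _ iK) => iL; rewrite -KL lam_out// ltxx.
Qed.

Lemma fin_negligible (I : finType) (F : I -> set 'rV[R]_d) :
  (forall k, (leb d).-negligible (F k)) -> (leb d).-negligible (\bigcup_k F k).
Proof.
move=> hF; apply: (@negligibleS _ _ _ _ (\big[setU/set0]_i F i)).
  by move=> x [i _ Fx]; rewrite -bigcup_seq; exists i => //=; rewrite mem_index_enum.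
elim: (index_enum _) => [|i r IH]; first by rewrite big_nil; exact: negligible_set0.
by rewrite big_cons; exact: negligibleU.
Qed.

Lemma ae_osimp : {ae leb d, forall x, D x -> exists2 K, K \in SS & osimp K x}.
Proof.
apply: (@negligibleS _ _ _ _
  (\bigcup_K (if K \in SS then hull K `\` osimp K else set0))); last first.
  apply: fin_negligible => K; case: ifPn => [KS|_]; last exact: negligible_set0.
  exact: hull_boundary_negligible (mesh_good KS).
move=> x /= /not_implyP[Dx /forall2NP nx]; have [K KS Kx] := sub_mesh_domain Dx.
exists K => //; rewrite (_ : K \in SS = true)//; split=> //.
by have [] := nx K.
Qed.

Lemma fe_measurable v : pw_affine v -> measurable D -> measurable_fun D v.
Proof.
move=> av mD _ Y mY.
have /choice[f fP] K : exists f : 'rV[R]_d * R, K \in SS -> forall x, hull K x -> v x = dot f.1 x + f.2.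
  have [KS|KS] := boolP (K \in SS); last by exists (0, 0).
  by have [c [b h]] := av K KS; exists (c, b).
pose F K := if K \in SS then D `&` (hull K `&` (fun x => dot (f K).1 x + (f K).2) @^-1` Y) else set0.
rewrite (_ : _ `&` _ = \bigcup_(K in [set: {set index}]) F K).
  apply: fin_bigcup_measurable => [|K _]; first exact: finite_finset.
  rewrite /F; case: ifPn => // KS; apply: measurableI => //.
  apply: measurableI; first exact: hull_measurable (mesh_good KS).
  rewrite -[X in measurable X]setTI.
  have mf : measurable_fun setT (fun x : 'rV[R]_d => dot (f K).1 x + (f K).2).
    by apply: measurable_funD => //; exact: measurable_dot.
  exact: mf.
apply/seteqP; split=> [x [Dx Yx]|x [K _]]; last first.
  by rewrite /F; case: ifPn => // KS [Dx [Kx]] /=; rewrite -fP.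
have [K KS Kx] := sub_mesh_domain Dx.
by exists K => //; rewrite /F (_ : K \in SS = true)//; split=> //; split=> //=; rewrite -fP.
Qed.

Lemma pw_affine_bounded v : pw_affine v -> exists M, forall x, D x -> `|v x| <= M.
Proof.
move=> av; exists (\sum_i `|v (a i)|) => x /sub_mesh_domain dx.
have [K KS Kx] := dx; have gK := mesh_good KS.
rewrite (pw_affineE av dx) (fe_hull _ KS Kx); apply: le_trans (ler_norm_sum _ _ _) _.
apply: ler_sum => i _; rewrite normrM ler_piMr//.
have l0 j : 0 <= lam K x j by move: j; exact/hullP.
by rewrite ger0_norm// -(lam_sum x gK) (bigD1 i)//= lerDl sumr_ge0.
Qed.

End mesh_theory.

(** * Chain rule for piecewise affine functions *)

(* At the supremum of the times up to which the bound holds, only the pieces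
   containing that time matter nearby. *)
Lemma piecewise_lipschitz (R : realType) (I : finType) (A : I -> set R) (f : R -> R) (L t : R) :
  0 <= t -> (forall k, closed (A k)) -> (forall s, 0 <= s <= t -> exists k, A k s) ->
  (forall k r s, 0 <= r <= t -> 0 <= s <= t -> A k r -> A k s ->
     `|f r - f s| <= L * `|r - s|) ->
  `|f t - f 0| <= L * t.
Proof.
move=> t0 cA covA lipA.
pose S := [set s | 0 <= s <= t /\ `|f s - f 0| <= L * s].
have S0 : S 0 by split; rewrite ?lexx// subrr normr0 mulr0.
have supS : has_sup S by split; [exists 0|exists t => s [/andP[]]].
set m := sup S.
have m0 : 0 <= m by exact: (sup_upper_bound supS).
have mt : m <= t by apply: ge_sup; [exists 0|move=> s [/andP[]]].
have [e /= e0 me] : exists2 e, 0 < e & forall s, `|m - s| < e -> forall k, A k s -> A k m.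
  have /nbhs_ballP[e /= e0 h] : \forall s \near m, forall k, A k s -> A k m.
    apply: (@filter_forall _ _ (fun k s => A k s -> A k m) (nbhs m) _) => k.
    have [Am|nAm] := pselect (A k m); first exact: filterE.
    have : nbhs m (~` A k) by apply: open_nbhs_nbhs; split => //; exact: closed_openC.
    by apply: filterS => s.
  by exists e => // s ms; exact: h.
have loc s : 0 <= s <= t -> `|m - s| < e -> `|f s - f m| <= L * `|s - m|.
  move=> st ms; have [k Aks] := covA s st.
  by apply: (lipA k) => //; [rewrite m0|exact: (me s)].
have Sm : `|f m - f 0| <= L * m.
  have [r [rt fr] mr] := sup_adherent e0 supS; rewrite -/m in mr.
  have rm : r <= m by exact: (sup_upper_bound supS).
  have E : `|m - r| = m - r by rewrite ger0_norm ?subr_ge0.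
  have h : `|f r - f m| <= L * (m - r).
    by rewrite -E [`|m - r|]distrC; apply: loc => //; rewrite E; lra.
  rewrite (_ : f m - f 0 = (f r - f 0) - (f r - f m)); last by ring.
  apply: le_trans (ler_normB _ _) _; lra.
have [mt'|] := ltP m t; last by move=> tm; rewrite (_ : t = m)//; apply/eqP; rewrite eq_le mt tm.
(* If m < t, the bound persists slightly beyond m, against the definition of m as a supremum. *)
pose s := Num.min t (m + e / 2).
have ms : m < s by rewrite lt_min mt' ltrDl divr_gt0.
have se : s - m < e by rewrite ltrBlDl gt_min; apply/orP; right; lra.
have st : 0 <= s <= t by rewrite (le_trans m0 (ltW ms)) /= ge_min lexx.
have : S s.
  split=> //; have := loc s st; rewrite ltr0_norm ?subr_lt0// opprB => /(_ se).
  rewrite [`|s - m|]ger0_norm ?subr_ge0 ?(ltW ms)// => h.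
  rewrite (_ : f s - f 0 = (f m - f 0) + (f s - f m)); last by ring.
  apply: le_trans (ler_normD _ _) _; lra.
by move=> /(sup_upper_bound supS); rewrite leNgt ms.
Qed.

Lemma compact_sub_open_ball (R : realType) n (K D : set 'rV[R]_n) :
  compact K -> open D -> K `<=` D -> exists2 e : R, 0 < e & forall x, K x -> ball x e `<=` D.
Proof.
move=> /compact_near_coveringP cK oD KD.
have := cK _ (0^'+ : set_system R) (fun e x => ball x e `<=` D) _.
have H x : K x -> \forall x' \near x & e \near (0^'+ : set_system R), ball x' e `<=` D.
  move=> /KD Dx; have /nbhs_ballP[e /= e0 eD] := open_nbhs_nbhs (conj oD Dx).
  exists (ball x (e / 2), [set r | r < e / 2]); first split => /=.
  - by apply: nbhsx_ballx; rewrite divr_gt0.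
  - by apply: nbhs_right_lt; rewrite divr_gt0.
  move=> [x' r] /= [xx' re] y x'y; apply: eD; apply: (ball_split xx').
  by apply: le_ball x'y; exact: ltW.
move=> /(_ _ H) h.
have [e [e0 he]] : exists e : R, 0 < e /\ K `<=` (fun x => ball x e `<=` D).
  by apply: (@filter_ex _ (0^'+ : set_system R)); near=> e; split;
    [near: e; exact: nbhs_right_gt|near: e].
by exists e.
Unshelve. all: by end_near. Qed.

Lemma mpd1 (R : realType) d (i : 'I_d) (phi : 'rV[R]_d -> R) :
  mpd (fun j => (j == i : nat)) phi = pd i phi.
Proof.
rewrite /mpd; have : i \in enum 'I_d by rewrite mem_enum.
elim: (enum 'I_d) (enum_uniq 'I_d) => //= k s IH /andP[ks us].
rewrite inE; have [->|ik] := eqVneq i k; last exact: IH.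
move=> _ /=; congr (pd k _).
elim: s ks {IH us} => //= l s IH; rewrite inE negb_or => /andP[kl /IH ->].
by rewrite eq_sym (negbTE kl).
Qed.

Lemma mdeg1 d (i : 'I_d) : mdeg (fun j => (j == i : nat)) = 1%N.
Proof. by rewrite /mdeg (bigD1 i)//= eqxx big1 ?addn0// => j /negbTE ->. Qed.

Lemma leb_integral_shift (R : realType) n (t : 'rV[R]_n) (f : 'rV[R]_n -> \bar R) :
  measurable_fun setT f ->
  (\int[leb n]_x f (x + t)%R = \int[leb n]_x f x)%E.
Proof.
move=> mf; rewrite integralE [in RHS]integralE.
rewrite (leb_integral_translation t (measurable_funepos mf)) => [|x]; last exact: funepos_ge0.
rewrite (leb_integral_translation t (measurable_funeneg mf)) => [|x]; last exact: funeneg_ge0.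
by congr (_ - _)%E; apply: eq_integral => x _; rewrite ?funeposE ?funenegE.
Qed.

Lemma is_derive_line (R : realType) d (phi : 'rV[R]_d -> R) (x e : 'rV[R]_d) (s : R) :
  derivable phi (x + s *: e) e ->
  is_derive s 1 (fun r => phi (x + r *: e)) ('D_e phi (x + s *: e)).
Proof.
move=> /cvg_ex[l hl].
have -> : 'D_e phi (x + s *: e) = l by exact: cvg_lim hl.
apply: is_derive_cvg; move: hl => /=.
under eq_fun do rewrite addrCA -scalerDl.
by under [in X in _ -> X]eq_fun do rewrite [_ *: 1]mulr1.
Qed.

Lemma line_continuous (R : realType) d (x e : 'rV[R]_d) :
  continuous (fun s : R => x + s *: e).
Proof. by move=> s; apply: cvgD; [exact: cvg_cst|apply: cvgZr_tmp; exact: cvg_id]. Qed.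

Lemma near_line (R : realType) d (x e : 'rV[R]_d) (O : set 'rV[R]_d) :
  open O -> O x -> \forall s \near (0 : R), O (x + s *: e).
Proof.
move=> oO Ox; have := @line_continuous R d x e 0 O; apply.
by rewrite /= scale0r addr0; exact: open_nbhs_nbhs.
Qed.

Lemma integrable_box_bounded (R : realType) n (a b : 'rV[R]_n) (M : R) (f : 'rV[R]_n -> R) :
  (forall i, a ord0 i <= b ord0 i) -> measurable_fun setT f ->
  (forall x, `|f x| <= M * \1_(rV_box a b) x) -> (leb n).-integrable setT (EFin \o f).
Proof.
move=> ab mf fM; have mB := measurable_rV_box a b.
have i1 : (leb n).-integrable setT (EFin \o \1_(rV_box a b)).
  apply/integrableP; split; first by apply/measurable_EFinP; exact: measurable_indic.
  under eq_integral do rewrite gee0_abs ?lee_fin//.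
  by rewrite integral_indic// setIT leb_box ?ltry.
have iM := integrableZl measurableT M i1.
apply: (le_integrable measurableT _ _ iM); first exact/measurable_EFinP.
by move=> x _ /=; rewrite lee_fin; apply: le_trans (fM x) (ler_norm _).
Qed.

Section weak_derivative_comp.
Context {R : realType} {d : nat} (Th : mesh R d) (D : set 'rV[R]_d).
Local Notation SS := (simplices Th).
Context (d0 : (0 < d)%N) (cD : conforming_triangulation Th D) (oD : open D) (bD : bounded_set D).
Context (v : 'rV[R]_d -> R) (c : {set 'I_(nvert Th)} -> 'rV[R]_d) (b : {set 'I_(nvert Th)} -> R).
Context (vE : forall K, K \in SS -> forall x, hull K x -> v x = dot (c K) x + b K).
Context (g g' : R -> R) (gD : forall y : R, is_derive y 1 g (g' y)) (cg' : continuous g').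
Context (kappa : R) (glip : forall x y, `|g x - g y| <= kappa * `|x - y|).

Let mD : measurable D := open_measurable_rV oD.
Let fD : (leb d D < +oo)%E := leb_bounded_lty mD bD.
Let cg : continuous g := is_derive1_continuous gD.

(** The i-th partial derivative of v inside each simplex, set to 0 on the skeleton of the mesh. *)
Definition slope (i : 'I_d) (x : 'rV[R]_d) : R :=
  \sum_(K in SS) c K ord0 i * \1_(osimp K) x.

Lemma slope_osimp i K x : K \in SS -> osimp K x -> slope i x = c K ord0 i.
Proof.
move=> KS Kx; rewrite /slope (bigD1 K)//= indicE mem_set// mulr1 big1 ?addr0// => L /andP[LS LK].
rewrite indicE memNset ?mulr0// => Lx; move/eqP: LK; apply.
exact: (osimp_disj cD LS KS Lx Kx).
Qed.

Lemma pw_affine_v : pw_affine Th v.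
Proof. by move=> K KS; exists (c K), (b K); exact: vE. Qed.

(** Adding the slopes of all simplices is crude, but the bound serves only to dominate difference
    quotients. *)
Lemma segment_lipschitz i x t : 0 <= t ->
  (forall s, 0 <= s <= t -> D (x + s *: delta_mx ord0 i)) ->
  `|v (x + t *: delta_mx ord0 i) - v x| <= (\sum_(K in SS) `|c K ord0 i|) * t.
Proof.
move=> t0 segD; set e := delta_mx ord0 i in segD *.
have -> : v x = v (x + 0 *: e) by rewrite scale0r addr0.
apply: (piecewise_lipschitz (A := fun K => if K \in SS then [set s | hull K (x + s *: e)] else set0)
  (f := fun s => v (x + s *: e))) => //.
- move=> K; case: ifPn => KS; last exact: closed0.
  have := @closed_comp _ _ (fun s : R => x + s *: e) (hull K).
  apply; last exact: hull_closed (mesh_good cD KS).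
  by move=> s _; exact: line_continuous.
- move=> s st; have [K KS Kx] := sub_mesh_domain cD (segD _ st).
  by exists K; rewrite (_ : K \in SS = true).
- move=> K r s _ _; case: ifPn => // KS /= Kr Ks.
  rewrite !(vE KS)// opprD addrACA subrr addr0 -dotBr opprD addrACA subrr add0r -scalerBl.
  rewrite dotZr dot_delta normrM mulrC ler_wpM2r//.
  by rewrite (bigD1 K)//= lerDl sumr_ge0.
Qed.

Lemma g_comp_bounded : exists2 M, 0 <= M & forall x, D x -> `|g (v x)| <= M.
Proof.
have [M hM] := pw_affine_bounded cD pw_affine_v.
exists (`|g 0| + `|kappa| * `|M|) => [|x Dx]; first by rewrite addr_ge0 ?mulr_ge0.
have := ler_normD (g (v x) - g 0) (g 0); rewrite subrK addrC => h.
apply: le_trans h _; rewrite lerD2l; apply: le_trans (glip _ _) _; rewrite subr0.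
apply: le_trans (ler_wpM2r _ (ler_norm kappa)) _ => //.
by apply: ler_wpM2l => //; apply: le_trans (hM _ Dx) (ler_norm _).
Qed.

Lemma measurable_v : measurable_fun D v.
Proof. exact: (fe_measurable cD pw_affine_v mD). Qed.

Lemma measurable_slope i : measurable_fun setT (slope i).
Proof.
rewrite /slope (_ : (fun _ => _) = fun x => \sum_K (if K \in SS then c K ord0 i * \1_(osimp K) x else 0)); last first.
  by apply/funext => x; rewrite big_mkcond.
apply: measurable_sum => K; have [KS|_] := boolP (K \in SS); last exact: measurable_cst.
apply: measurable_funM; first exact: measurable_cst.
by apply: measurable_indic; exact: osimp_measurable (mesh_good cD KS).
Qed.

(* The integral of g(v) phi is invariant under translation by t e_i: its
   difference quotients vanish, and converge to the integral below by dominated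
   convergence. *)
Lemma is_weak_deriv_comp_key i phi : test_function D phi ->
  \int[leb d]_(x in D) (g (v x) * pd i phi x + g' (v x) * slope i x * phi x) = 0.
Proof.
move=> [sphi [K0 [cK0 K0D phi0]]].
set e : 'rV[R]_d := delta_mx ord0 i.
have cphi : continuous phi by have [] := sphi [::].
have dphi x : derivable phi x e by have [_] := sphi [::]; exact.
have cpd : continuous (pd i phi) by have [] := sphi [:: i].
have [Mg Mg0 hMg] := g_comp_bounded.
have [Mphi hMphi] := continuous_bounded_on cphi bD.
have [Mpd hMpd] := continuous_bounded_on cpd bD.
have [del del0 hdel] := compact_sub_open_ball cK0 oD K0D.
have [B B0 DB] := bounded_sub_box bD.
(* Extension by zero, so that translation invariance can be used on the whole space. *)
pose V := (fun x => g (v x) * phi x) \_ D.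
have VD x : D x -> V x = g (v x) * phi x by move=> Dx; rewrite /V patchE mem_set.
have VnD x : ~ D x -> V x = 0 by move=> Dx; rewrite /V patchE memNset.
have Vphi0 x : phi x = 0 -> V x = 0.
  by move=> h; have [/VD ->|/VnD//] := pselect (D x); rewrite h mulr0.
have mgv : measurable_fun D (g \o v).
  exact: measurableT_comp (continuous_measurable_fun cg) measurable_v.
have mV : measurable_fun setT V.
  apply/measurable_restrict => //; rewrite setTI; apply: measurable_funM => //.
  by apply: measurable_funTS; exact: continuous_measurable_rV.
(* Steps shorter than [del] keep in D any segment with an endpoint in the support of phi; steps at
   most 1 keep the translates in the box enlarged by 1. *)
pose eps := Num.min (del / 2) 1.
have eps0 : 0 < eps by rewrite lt_min divr_gt0//=.
pose tt (n : nat) : R := eps * n.+1%:R^-1.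
have tt0 n : 0 < tt n by rewrite mulr_gt0.
have tt_eps n : tt n <= eps.
  by rewrite ler_piMr ?(ltW eps0)// invf_le1// ler1n.
have tt_del n : tt n < del.
  apply: le_lt_trans (tt_eps n) _; rewrite gt_min; apply/orP; left; lra.
have tt1 n : tt n <= 1 by apply: le_trans (tt_eps n) _; rewrite ge_min lexx orbT.
have ttcvg : tt n @[n --> \oo] --> (0 : R).
  by rewrite -(mulr0 eps); apply: cvgMr; exact: cvg_harmonic.
pose F (n : nat) (x : 'rV[R]_d) : R := (V (x + tt n *: e) - V x) / tt n.
pose W := (fun x => g (v x) * pd i phi x + g' (v x) * slope i x * phi x) \_ D.
have mVt n : measurable_fun setT (fun x : 'rV[R]_d => V (x + tt n *: e)).
  exact: measurableT_comp mV (measurable_addr_rV _).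
have mF n : measurable_fun setT (F n).
  by apply: measurable_funM => //; exact: measurable_funB.
have mW : measurable_fun setT W.
  apply/measurable_restrict => //; rewrite setTI; apply: measurable_funD.
    apply: measurable_funM => //.
    by apply: measurable_funTS; exact: continuous_measurable_rV.
  apply: measurable_funM; last first.
    by apply: measurable_funTS; exact: continuous_measurable_rV.
  apply: measurable_funM; last by apply: measurable_funTS; exact: measurable_slope.
  exact: measurableT_comp (continuous_measurable_fun cg') measurable_v.
pose Lv := \sum_(K in SS) `|c K ord0 i|.
pose C := `|kappa| * Lv * `|Mphi| + Mg * `|Mpd|.
have Lv0 : 0 <= Lv by exact: sumr_ge0.
have C0 : 0 <= C by rewrite addr_ge0 ?mulr_ge0.
pose Bx : set 'rV[R]_d := rV_box (const_mx (- (B + 1))) (const_mx (B + 1)).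
have mBx : measurable Bx by exact: measurable_rV_box.
have e_ij j : e ord0 j = (j == i)%:R by rewrite mxE eqxx.
(* If neither endpoint is in the support, both values vanish; otherwise the whole segment lies in D,
   and the Lipschitz bounds of g(v) and phi combine as in the product rule. *)
have Vlip n x : `|V (x + tt n *: e) - V x| <= C * tt n.
  have seg : K0 x \/ K0 (x + tt n *: e) -> forall s, 0 <= s <= tt n -> D (x + s *: e).
    move=> [Kx|Kx] s /andP[s0 st]; apply: (hdel _ Kx); apply/rV_ballP => // j; rewrite !mxE eqxx /=.
      rewrite opprD addNKr normrN; case: eqP => _; rewrite ?mulr1 ?mulr0 ?normr0//.
      by rewrite ger0_norm//; exact: le_lt_trans st (tt_del n).
    rewrite opprD addrACA subrr add0r -mulrBl; case: eqP => _; rewrite ?mulr1 ?mulr0 ?normr0//.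
    rewrite ger0_norm ?subr_ge0//; apply: le_lt_trans (tt_del n); lra.
  have [Kx|nKx] := pselect (K0 x \/ K0 (x + tt n *: e)); last first.
    have -> : V x = 0 by apply/Vphi0/phi0 => h; apply: nKx; left.
    have -> : V (x + tt n *: e) = 0 by apply/Vphi0/phi0 => h; apply: nKx; right.
    by rewrite subrr normr0 mulr_ge0// ltW.
  have {}seg := seg Kx.
  have Dt : D (x + tt n *: e) by apply: seg; rewrite lexx ltW.
  have Dx : D x by have := seg 0; rewrite scale0r addr0; apply; rewrite lexx ltW.
  have lv : `|v (x + tt n *: e) - v x| <= Lv * tt n.
    by apply: segment_lipschitz => //; exact: ltW.
  have lphi : `|phi (x + tt n *: e) - phi x| <= `|Mpd| * tt n.
    have Dh (s : R) : is_derive s 1 (fun r : R => phi (x + r *: e)) (pd i phi (x + s *: e)).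
      exact: is_derive_line.
    have [s st] := @MVT_segment R (fun r => phi (x + r *: e)) (fun s => pd i phi (x + s *: e))
      0 (tt n) (ltW (tt0 n)) (fun s _ => Dh s) (continuous_subspaceT (is_derive1_continuous Dh)).
    rewrite scale0r addr0 subr0 => ->; rewrite normrM (ger0_norm (ltW (tt0 n))).
    apply: ler_wpM2r; first exact: ltW.
    apply: le_trans (ler_norm _); apply: hMpd; apply: seg.
    by move: st; rewrite in_itv.
  rewrite !VD//.
  have -> : g (v (x + tt n *: e)) * phi (x + tt n *: e) - g (v x) * phi x =
    (g (v (x + tt n *: e)) - g (v x)) * phi (x + tt n *: e) +
    g (v x) * (phi (x + tt n *: e) - phi x) by ring.
  apply: le_trans (ler_normD _ _) _; rewrite !normrM /C mulrDl; apply: lerD.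
    rewrite -mulrA [`|Mphi| * _]mulrC mulrA; apply: ler_pM => //.
      apply: le_trans (glip _ _) _; rewrite -mulrA.
      apply: le_trans (ler_wpM2r _ (ler_norm kappa)) _ => //.
      exact: ler_wpM2l.
    exact: le_trans (hMphi _ Dt) (ler_norm _).
  by rewrite -mulrA; apply: ler_pM => //; exact: hMg.
pose G (x : 'rV[R]_d) : \bar R := (C * \1_Bx x)%:E.
have outB (x y : 'rV[R]_d) : ~ Bx x -> (forall j, `|y ord0 j - x ord0 j| <= 1) -> ~ D y.
  move=> xB yx Dy; apply: xB => j; rewrite !mxE.
  have := DB _ Dy j; rewrite !mxE => /andP[h1 h2].
  have := yx j; rewrite ler_distl => /andP[h3 h4]; apply/andP; split; lra.
have FG n x : (`|(F n x)%:E| <= G x)%E.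
  rewrite /G lee_fin indicE; have [xB|xB] := boolP (x \in Bx).
    rewrite mulr1 /F normrM normfV [`|tt n|]gtr0_norm// ler_pdivrMr//.
  rewrite mulr0; rewrite notin_setE in xB.
  rewrite /F !VnD ?subrr ?mul0r ?normr0//; apply: (outB _ _ xB) => j.
    by rewrite subrr normr0.
  rewrite !mxE addrAC subrr add0r eqxx /=; case: eqP => _; rewrite ?mulr0 ?normr0// mulr1.
  by rewrite gtr0_norm.
have Bab (j : 'I_d) : (const_mx (- (B + 1)) : 'rV[R]_d) ord0 j <= (const_mx (B + 1) : 'rV[R]_d) ord0 j.
  by rewrite !mxE; lra.
have iG : (leb d).-integrable setT G.
  apply: (@integrable_box_bounded _ _ (const_mx (- (B + 1))) (const_mx (B + 1)) C (fun x => C * \1_Bx x)) => //.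
    by apply: measurable_funM => //; exact: measurable_indic.
  by move=> x; rewrite ger0_norm ?mulr_ge0// indicE ler0n.
have VM x : `|V x| <= Mg * `|Mphi|.
  have [Dx|nDx] := pselect (D x); last by rewrite VnD// normr0 mulr_ge0.
  rewrite VD// normrM; apply: ler_pM => //; first exact: hMg.
  exact: le_trans (hMphi _ Dx) (ler_norm _).
have iVt n : (leb d).-integrable setT (EFin \o (fun x : 'rV[R]_d => V (x + tt n *: e))).
  apply: (@integrable_box_bounded _ _ (const_mx (- (B + 1))) (const_mx (B + 1)) (Mg * `|Mphi|)) => // x.
  rewrite indicE; have [xB|] := boolP (x \in _); first by rewrite mulr1.
  rewrite notin_setE => xB; rewrite mulr0 VnD ?normr0//.
  apply: (outB _ _ xB) => j; rewrite !mxE addrAC subrr add0r eqxx /=.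
  by case: eqP => _; rewrite ?mulr0 ?normr0// mulr1 gtr0_norm.
have iV : (leb d).-integrable setT (EFin \o V).
  apply: (@integrable_box_bounded _ _ (const_mx (- (B + 1))) (const_mx (B + 1)) (Mg * `|Mphi|)) => // x.
  rewrite indicE; have [xB|] := boolP (x \in _); first by rewrite mulr1.
  rewrite notin_setE => xB; rewrite mulr0 VnD ?normr0//.
  by apply: (outB _ _ xB) => j; rewrite subrr normr0.
(* Off D, the quotients vanish for small steps because the support of phi is closed and inside D. In
   D, almost every point is interior to a simplex. *)
have FW : {ae leb d, forall x, setT x -> (F n x)%:E @[n --> \oo] --> (W x)%:E}.
  apply: filterS (ae_osimp d0 cD) => x hx _; apply: cvg_EFin; first by near=> n.
  have [Dx|nDx] := pselect (D x); last first.
    have -> : W x = 0 by rewrite /W patchE memNset.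
    have : \forall s \near (0 : R), ~ K0 (x + s *: e).
      apply: (@near_line _ _ x e (~` K0)) => [|/K0D//].
      by apply: closed_openC; apply: compact_closed => //; exact: norm_hausdorff.
    move=> h0; have h1 : \forall n \near \oo, ~ K0 (x + tt n *: e) by exact: (ttcvg _ h0).
    apply: cvg_near_cst; near=> n.
    have nK : ~ K0 (x + tt n *: e) by near: n.
    by rewrite /= /F (Vphi0 _ (phi0 _ nK)) VnD// subrr mul0r.
  have [K KS Kx] := hx Dx.
  (* Inside the simplex v is affine, so for small steps the quotient of V is that of H at 0. *)
  pose H s := g (dot (c K) x + b K + s * c K ord0 i) * phi (x + s *: e).
  have WE : W x = g (v x) * pd i phi x + g' (v x) * c K ord0 i * phi x.
    by rewrite /W patchE mem_set// (slope_osimp i KS Kx).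
  have vx : v x = dot (c K) x + b K by apply: vE KS _ (osimp_hull (mesh_good cD KS) Kx).
  have DH : is_derive (0 : R) 1 H (W x).
    have D1 : is_derive (0 : R) 1 (fun s : R => dot (c K) x + b K + s * c K ord0 i) (c K ord0 i).
      have D1a := @is_deriveZ R R R id (c K ord0 i) 0 1 1 (is_derive_id _ _).
      have D1b := @is_deriveD R R R (cst (dot (c K) x + b K)) _ 0 1 _ _ (is_derive_cst _ _ _) D1a.
      rewrite (_ : (fun s : R => _) = cst (dot (c K) x + b K) + (c K ord0 i \*: id)).
        by apply: (is_derive_eq D1b); rewrite add0r /GRing.scale /= mulr1.
      by apply/funext => s; rewrite /= mulrC.
    have D2 := @is_derive1_comp R g (fun s : R => dot (c K) x + b K + s * c K ord0 i) 0 _ _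
      (gD _) D1.
    have D3 : is_derive (0 : R) 1 (fun s : R => phi (x + s *: e)) (pd i phi (x + 0 *: e)).
      exact: is_derive_line.
    have D4 := is_deriveM D2 D3.
    apply: (is_derive_eq D4); rewrite WE vx scale0r addr0 /GRing.scale /= mul0r addr0; ring.
  have [/cvg_ex[l hl] lE] := DH.
  have lW : l = W x by rewrite -lE; apply/esym/cvg_lim.
  have := (cvgr_dnbhsP _ _ _).1 hl tt (conj (fun n => lt0r_neq0 (tt0 n)) ttcvg).
  rewrite lW; apply: cvg_trans; apply: near_eq_cvg.
  have : \forall s \near (0 : R), osimp K (x + s *: e).
    exact: near_line (osimp_open (mesh_good cD KS)) Kx.
  move=> h0; have h1 : \forall n \near \oo, osimp K (x + tt n *: e) by exact: (ttcvg _ h0).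
  near=> n; have Kn : osimp K (x + tt n *: e) by near: n.
  have vn : v (x + tt n *: e) = dot (c K) x + b K + tt n * c K ord0 i.
    rewrite (vE KS (osimp_hull (mesh_good cD KS) Kn)) dotDr dotZr dot_delta; ring.
  rewrite /= /F VD; last exact: (osimp_sub cD KS).
  rewrite VD// /H vn -vx [_ *: 1]mulr1 addr0 mul0r addr0 scale0r addr0.
  by rewrite /GRing.scale /= mulrC.
have [iW _ FWi] := dominated_convergence measurableT
  (fun n => (measurable_EFinP _ _).2 (mF n)) ((measurable_EFinP _ _).2 mW) FW iG
  (aeW _ (fun x n _ => FG n x)).
rewrite Rintegral_mkcond -/W /Rintegral.
suff -> : (\int[leb d]_x (W x)%:E = 0)%E by [].
move: FWi; rewrite (_ : (fun n => _) = cst 0%E); last first.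
  apply/funext => n /=.
  transitivity (\int[leb d]_x (((V (x + tt n *: e))%:E - (V x)%:E) * (tt n)^-1%:E))%E.
    by apply: eq_integral => x _; rewrite /F EFinM EFinB.
  rewrite integralZr//; last exact: (integrableB measurableT (iVt n) iV).
  rewrite (integralB measurableT (iVt n) iV).
  rewrite (leb_integral_shift (tt n *: e) ((measurable_EFinP _ _).2 mV)).
  by rewrite subee ?mul0e//; exact: integrable_fin_num iV.
by move/cvg_lim => /(_ (@ereal_hausdorff R)); rewrite lim_cst.
Unshelve. all: by end_near. Qed.

Lemma slope_bounded i : exists2 M, 0 <= M & forall x, `|slope i x| <= M.
Proof.
exists (\sum_(K in SS) `|c K ord0 i|) => [|x]; first exact: sumr_ge0.
apply: le_trans (ler_norm_sum _ _ _) _; apply: ler_sum => K _.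
by rewrite normrM indicE ler_piMr// ger0_norm// lern1 leq_b1.
Qed.

Lemma derive_le_lipschitz y : `|g' y| <= `|kappa|.
Proof.
have [/cvg_ex[l hl] lE] := gD y.
have <- : l = g' y by rewrite -lE; apply/esym/cvg_lim.
rewrite leNgt; apply/negP => kl.
have : \forall h \near (0 : R)^', False.
  near=> h; have h0 : h != 0 by near: h; exact: nbhs_dnbhs_neq.
  suff : `|kappa| < `|h^-1 *: ((g \o shift y) (h *: 1) - g y)|.
    rewrite normrM normfV ltr_pdivlMl ?normr_gt0// ltNge => /negP; apply.
    apply: le_trans (glip _ _) _; rewrite /= addrK [_ *: 1]mulr1 mulrC.
    by rewrite ler_wpM2l// ler_norm.
  near: h; exact: (cvgr_norm_gt l hl).
by move=> /filter_ex[].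
Unshelve. all: by end_near. Qed.

Lemma in_L2_comp : in_L2 D (g \o v).
Proof.
have [M _ hM] := g_comp_bounded; apply: (in_L2_bounded mD fD _ hM).
exact: measurableT_comp (continuous_measurable_fun cg) measurable_v.
Qed.

Lemma in_L2_comp_slope i : in_L2 D (fun x => g' (v x) * slope i x).
Proof.
have [M M0 hM] := slope_bounded i; apply: (@in_L2_bounded _ _ _ mD fD _ (`|kappa| * M)).
  apply: measurable_funM; last by apply: measurable_funTS; exact: measurable_slope.
  exact: measurableT_comp (continuous_measurable_fun cg') measurable_v.
by move=> x _; rewrite normrM; apply: ler_pM => //; exact: derive_le_lipschitz.
Qed.

Lemma is_weak_deriv_comp i :
  is_weak_deriv D (fun j => (j == i : nat)) (g \o v) (fun x => g' (v x) * slope i x).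
Proof.
move=> phi tphi; rewrite mdeg1 expr1 mulN1r mpd1; apply/eqP; rewrite -addr_eq0; apply/eqP.
rewrite -[RHS](is_weak_deriv_comp_key i tphi) /ip -RintegralD//.
- apply: in_L2_integrableM => //; first exact: in_L2_comp.
  by have := in_L2_test oD bD (fun j => (j == i : nat)) tphi; rewrite mpd1.
- apply: in_L2_integrableM => //; first exact: in_L2_comp_slope.
  exact: in_L2_test0 tphi.
Qed.

End weak_derivative_comp.

(** * Mass, lumped mass and stiffness *)

Section simple_integral.
Context {R : realType} {d : nat} (D : set 'rV[R]_d) (oD : open D) (bD : bounded_set D).

Let mD : measurable D := open_measurable_rV oD.
Let fD : (leb d D < +oo)%E := leb_bounded_lty mD bD.

Lemma in_L2_indic (A : set 'rV[R]_d) : measurable A -> in_L2 D (\1_A).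
Proof.
move=> mA; apply: (@in_L2_bounded _ _ _ mD fD _ 1).
  by apply: measurable_funTS; exact: measurable_indic.
by move=> x _; rewrite indicE ger0_norm// lern1 leq_b1.
Qed.

Lemma ip_indic_sum (I : finType) (A : I -> set 'rV[R]_d) (c : I -> R) :
  (forall k, measurable (A k)) -> (forall k, A k `<=` D) ->
  in_L2 D (fun x => \sum_k c k * \1_(A k) x) /\
  \int[leb d]_(x in D) (\sum_k c k * \1_(A k) x) = \sum_k c k * fine (leb d (A k)).
Proof.
move=> mA AD; have h0 := in_L2_cst oD bD 0; have h1 := in_L2_cst oD bD 1.
split; first by apply: in_L2_sum => // k; exact: in_L2_indic.
transitivity (ip D (fun x => \sum_k c k * \1_(A k) x) (fun=> 1)).
  by apply: eq_Rintegral => x _; rewrite mulr1.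
rewrite ip_suml// => [|k]; last exact: in_L2_indic.
apply: eq_bigr => k _; congr (_ * _); rewrite /ip /Rintegral; congr fine.
under eq_integral do rewrite mulr1.
by rewrite integral_indic// setIidl.
Qed.

End simple_integral.

Section finite_elements.
Context {R : realType} {d : nat} (Th : mesh R d) (D : set 'rV[R]_d).
Local Notation index := ('I_(nvert Th)).
Local Notation a := (vert (m := Th)).
Local Notation SS := (simplices Th).
Context (d0 : (0 < d)%N) (cD : conforming_triangulation Th D) (oD : open D) (bD : bounded_set D).
Implicit Types (K L : {set index}) (x : 'rV[R]_d) (U V : index -> R).

Let mD : measurable D := open_measurable_rV oD.
Let fD : (leb d D < +oo)%E := leb_bounded_lty mD bD.

Lemma fe_offset U : exists b, forall K, K \in SS -> forall x, hull K x -> fe U x = dot (fgrad U K) x + b K.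
Proof.
have /choice[b hb] K : exists b, K \in SS -> forall x, hull K x -> fe U x = dot (fgrad U K) x + b.
  have [KS|_] := boolP (K \in SS); last by exists 0.
  by have [b h] := fe_affine cD U KS; exists b.
by exists b.
Qed.

Let idD (y : R) : is_derive y 1 id 1 := is_derive_id y 1.

Lemma idlip (x y : R) : `|id x - id y| <= 1 * `|x - y|.
Proof. by rewrite mul1r. Qed.

Definition fslope U (i : 'I_d) x : R := slope (Th := Th) (fgrad U) i x.

Lemma in_L2_fe U : in_L2 D (fe U).
Proof.
have [b hb] := fe_offset U.
exact: (in_L2_comp cD oD bD hb idD idlip).
Qed.

Lemma in_L2_fslope U i : in_L2 D (fslope U i).
Proof.
have [b hb] := fe_offset U.
have := in_L2_comp_slope cD oD bD hb idD (@cst_continuous _ _ (1 : R)) idlip i.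
by under eq_fun do rewrite mul1r.
Qed.

(** The chain rule above, with the identity as g. *)
Lemma fe_weak_deriv U i : is_weak_deriv D (fun j => (j == i : nat)) (fe U) (fslope U i).
Proof.
have [b hb] := fe_offset U.
have := is_weak_deriv_comp d0 cD oD bD hb idD (@cst_continuous _ _ (1 : R)) idlip i.
by rewrite [X in is_weak_deriv _ _ _ X -> _](_ : _ = fslope U i)//; apply/funext => x; rewrite mul1r.
Qed.

Lemma sobolev_fe U : sobolev D 1 (fe U).
Proof.
split; first exact: in_L2_fe.
move=> al /mdeg_le1[al0|[i ->]]; [exists (fe U)|exists (fslope U i)]; split.
- exact: in_L2_fe.
- exact: is_weak_deriv0.
- exact: in_L2_fslope.
- exact: fe_weak_deriv.
Qed.

Lemma Vh_fe U : Vh D Th (fe U).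
Proof. by split; [exact: sobolev_fe|exact: (fe_pw_affine cD)]. Qed.

Lemma VhE v x : Vh D Th v -> mesh_domain Th x -> v x = fe (v \o a) x.
Proof. by move=> [_ av] dx; exact: (pw_affineE (v := v) cD av dx). Qed.

Lemma ip_eqD v w v' w' : {in D, v =1 v'} -> {in D, w =1 w'} -> ip D v w = ip D v' w'.
Proof. by move=> vv ww; apply: eq_Rintegral => x Dx; rewrite vv// ww. Qed.

Lemma VhE_in v : Vh D Th v -> {in D, v =1 fe (v \o a)}.
Proof. by move=> hv x /set_mem Dx; apply: VhE => //; exact: sub_mesh_domain Dx. Qed.

Lemma is_weak_deriv_eqD al v v' w : {in D, v =1 v'} ->
  is_weak_deriv D al v w -> is_weak_deriv D al v' w.
Proof.
move=> vv h phi tphi; rewrite -h//; apply: eq_Rintegral => x Dx.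
by rewrite vv.
Qed.

Lemma grad_Vh v i : Vh D Th v ->
  in_L2 D (grad D v i) /\ {ae leb d, forall x, D x -> grad D v i x = fslope (v \o a) i x}.
Proof.
move=> hv; apply: (weak_derivP oD bD); first exact: in_L2_fslope.
apply: is_weak_deriv_eqD (fe_weak_deriv (v \o a) i) => x Dx.
by rewrite (VhE_in hv).
Qed.

(** [nodal_basis] is a choice whose values off the mesh domain are arbitrary; on it, the vertex
    values and affinity on each simplex determine it. *)
Lemma nodal_basis_hat i x : mesh_domain Th x -> nodal_basis D i x = hat (Th := Th) i x.
Proof.
move=> dx; rewrite /nodal_basis; set P := [set phi | _].
have hatE y : hat (Th := Th) i y = fe (fun j => (i == j)%:R) y.
  rewrite /fe (bigD1 i)//= eqxx mul1r big1 ?addr0// => j /negbTE.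
  by rewrite eq_sym => ->; rewrite mul0r.
have [h1 h2] : P (get P).
  apply: (@getPex _ P); exists (fe (fun j => (i == j)%:R)).
  by split; [exact: Vh_fe|move=> j; exact: (fe_vert cD)].
rewrite (VhE h1 dx) hatE; congr (fe _ x); apply/funext => j.
exact: h2.
Qed.

Lemma IhE v x : mesh_domain Th x -> Ih D Th v x = fe (v \o a) x.
Proof. by move=> dx; apply: eq_bigr => i _; rewrite nodal_basis_hat. Qed.

Definition stiff U V : R := \sum_(K in SS) vol K * dot (fgrad U K) (fgrad V K).

Definition mass U V : R := ip D (fe U) (fe V).

Definition lumpw i : R := \sum_(K in SS | i \in K) vol K.

Definition lump U V : R := \sum_i lumpw i * (U i * V i).

Lemma ip_slope U V i :
  ip D (fslope U i) (fslope V i) = \sum_(K in SS) vol K * (fgrad U K ord0 i * fgrad V K ord0 i).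
Proof.
pose c K := if K \in SS then fgrad U K ord0 i * fgrad V K ord0 i else 0.
pose A K := if K \in SS then osimp K else set0.
have mA K : measurable (A K).
  by rewrite /A; case: ifPn => // KS; exact: osimp_measurable (mesh_good cD KS).
have AD K : A K `<=` D by rewrite /A; case: ifPn => [KS|_]; [exact: (osimp_sub cD KS)|exact: sub0set].
transitivity (\sum_K c K * fine (leb d (A K))); last first.
  rewrite [RHS]big_mkcond; apply: eq_bigr => K _; rewrite /c /A.
  by case: ifPn => // _; rewrite ?mul0r// mulrC.
rewrite -(ip_indic_sum oD bD c mA AD).2; apply: eq_Rintegral => x _.
have [[K KS Kx]|nx] := pselect (exists2 K, K \in SS & osimp K x).
  rewrite /fslope !(slope_osimp cD _ _ KS Kx) (bigD1 K)//= big1 ?addr0.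
    by rewrite /c /A KS indicE mem_set// mulr1.
  move=> L LK; rewrite /A; case: ifPn => LS; last by rewrite indic0 mulr0.
  rewrite indicE memNset ?mulr0// => Lx; move/eqP: LK; apply.
  exact: (osimp_disj cD LS KS Lx Kx).
have ind0 K : K \in SS -> \1_(osimp K) x = 0 :> R.
  by move=> KS; rewrite indicE memNset// => Kx; apply: nx; exists K.
rewrite /fslope /slope big1 ?mul0r => [|K KS]; last by rewrite ind0// mulr0.
rewrite big1// => K _; rewrite /A; case: ifPn => KS; last by rewrite indic0 mulr0.
by rewrite ind0// mulr0.
Qed.

Lemma grad_ip_Vh v w : Vh D Th v -> Vh D Th w -> grad_ip D v w = stiff (v \o a) (w \o a).
Proof.
move=> hv hw; rewrite /grad_ip.
transitivity (\sum_(i < d) \sum_(K in SS) vol K * (fgrad (v \o a) K ord0 i * fgrad (w \o a) K ord0 i)).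
  apply: eq_bigr => i _; rewrite -ip_slope.
  have [h1 h2] := grad_Vh i hv; have [h3 h4] := grad_Vh i hw.
  by apply: ip_congr => //; exact: in_L2_fslope.
by rewrite exchange_big /=; apply: eq_bigr => K _; rewrite mulr_sumr.
Qed.

Lemma ip_Vh v w : Vh D Th v -> Vh D Th w -> ip D v w = mass (v \o a) (w \o a).
Proof. by move=> hv hw; apply: ip_eqD; exact: VhE_in. Qed.

Lemma in_L2_hat i : in_L2 D (hat (Th := Th) i).
Proof.
have := in_L2_fe (fun j => (i == j)%:R).
rewrite (_ : fe _ = hat i)//; apply/funext => y.
rewrite /fe (bigD1 i)//= eqxx mul1r big1 ?addr0// => j /negbTE.
by rewrite eq_sym => ->; rewrite mul0r.
Qed.

Lemma ip_fe_sum w V : in_L2 D w -> ip D w (fe V) = \sum_i V i * ip D w (hat (Th := Th) i).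
Proof.
move=> hw; rewrite ipC ip_suml//; first by apply: eq_bigr => i _; rewrite [ip D w _]ipC.
- exact: in_L2_cst.
- exact: in_L2_hat.
Qed.

Lemma mass_sum U V : mass U V = \sum_j V j * \sum_i U i * ip D (hat (Th := Th) i) (hat (Th := Th) j).
Proof.
rewrite /mass ip_fe_sum; last exact: in_L2_fe.
apply: eq_bigr => j _; congr (_ * _); rewrite ipC ip_fe_sum; last exact: in_L2_hat.
by apply: eq_bigr => i _; rewrite [ip D (hat i) _]ipC.
Qed.

Lemma massC U V : mass U V = mass V U.
Proof. exact: ipC. Qed.

Lemma mass_ge0 U : 0 <= mass U U.
Proof. exact: ip_ge0. Qed.

Lemma lam_bounds K x i : K \in SS -> hull K x -> 0 <= lam K x i.
Proof. by move=> KS /(hullP _ (mesh_good cD KS)). Qed.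

(** Convexity of the square, as nonnegativity of the variance of the nodal values with weights
    [lam K x]; these weights are then bounded by 1. *)
Lemma fe_sqr_le K x U : K \in SS -> hull K x -> fe U x ^+ 2 <= \sum_(i in K) U i ^+ 2.
Proof.
move=> KS Kx; have gK := mesh_good cD KS; rewrite (fe_hull cD _ KS Kx).
set m := \sum_i _; have mE : \sum_i U i * lam K x i = m by [].
move: m mE => m mE.
have l0 i := lam_bounds i KS Kx.
have : 0 <= \sum_i lam K x i * (U i - m) ^+ 2.
  by apply: sumr_ge0 => i _; rewrite mulr_ge0 ?sqr_ge0.
have -> : \sum_i lam K x i * (U i - m) ^+ 2 =
    \sum_i lam K x i * U i ^+ 2 - 2 * m * \sum_i U i * lam K x i + m ^+ 2 * \sum_i lam K x i.
  by rewrite !mulr_sumr -sumrB -big_split /=; apply: eq_bigr => i _; ring.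
rewrite mE lam_sum// => h.
apply: (@le_trans _ _ (\sum_i lam K x i * U i ^+ 2)); first by move: h; lra.
rewrite [leRHS]big_mkcond; apply: ler_sum => i _; case: ifPn => iK; last by rewrite lam_out// mul0r.
by rewrite ler_piMl ?sqr_ge0// -(lam_sum x gK) (bigD1 i)//= lerDl sumr_ge0.
Qed.

(** The lumped form is the integral of the function equal on each simplex to the sum of the squares
    of its vertex values. *)
Lemma mass_le_lump U : mass U U <= lump U U.
Proof.
pose A K := if K \in SS then osimp K else set0.
have mA K : measurable (A K).
  by rewrite /A; case: ifPn => // KS; exact: osimp_measurable (mesh_good cD KS).
have AD K : A K `<=` D by rewrite /A; case: ifPn => [KS|_]; [exact: (osimp_sub cD KS)|exact: sub0set].
pose c K : R := \sum_(i in K) U i ^+ 2.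
have c0 K : 0 <= c K by apply: sumr_ge0 => i _; exact: sqr_ge0.
have [i2 E2] := ip_indic_sum oD bD c mA AD.
have i2' : (leb d).-integrable D (EFin \o (fun x => \sum_K c K * \1_(A K) x)).
  have := in_L2_integrableM mD i2 (in_L2_cst oD bD 1).
  by under eq_fun do rewrite mulr1.
have lumpE : lump U U = \sum_K c K * fine (leb d (A K)).
  rewrite /lump /lumpw; under eq_bigr do rewrite mulr_suml big_mkcond.
  rewrite exchange_big /=; apply: eq_bigr => K _; rewrite /c /A.
  have [KS|KS] := ifPn; last by rewrite measure0 mulr0 big1.
  rewrite mulr_suml [RHS]big_mkcond; apply: eq_bigr => i _ /=.
  by case: ifP => // _; rewrite mulrC expr2.
rewrite lumpE -E2 /mass /ip /Rintegral.
have i1 := in_L2_integrableM mD (in_L2_fe U) (in_L2_fe U).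
apply: fine_le.
- exact: (integrable_fin_num mD i1).
- exact: (integrable_fin_num mD i2').
apply: ae_ge0_le_integral => //.
- by move=> x _; rewrite lee_fin -expr2 sqr_ge0.
- by case/integrableP: i1.
- by move=> x _; rewrite lee_fin sumr_ge0// => K _; rewrite mulr_ge0// indicE.
- by case/integrableP: i2'.
apply: filterS (ae_osimp d0 cD) => x hx /hx[K KS Kx].
rewrite lee_fin -expr2; apply: le_trans (fe_sqr_le U KS (osimp_hull (mesh_good cD KS) Kx)) _.
rewrite (bigD1 K)//= {1}/A KS indicE mem_set// mulr1 lerDl sumr_ge0// => L _.
by rewrite mulr_ge0// indicE.
Qed.

(** On the fraction 4^-d of a simplex near its vertex of largest modulus, the square of the function
    is at least 1/4 of the square of that vertex value, which is at least 1/(d+1) of the sum over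
    the vertices. *)
Definition c0 : R := (4 * d.+1%:R)^-1 * (4^-1) ^+ d.

Lemma c0_gt0 : 0 < c0.
Proof. by rewrite /c0 mulr_gt0 ?exprn_gt0 ?invr_gt0 ?mulr_gt0. Qed.

(* The part of a simplex close to a vertex is a homothetic copy of it. *)
Definition near_vertex K (i : index) : set 'rV[R]_d :=
  [set x | osimp K x /\ 3 / 4 < lam K x i].

Lemma near_vertex_measurable K i : K \in SS -> measurable (near_vertex K i).
Proof.
move=> KS; have gK := mesh_good cD KS; apply: measurableI; first exact: osimp_measurable.
have := lam_measurable i gK measurableT (measurable_itv `]3 / 4, +oo[).
by rewrite setTI; congr measurable; apply/seteqP; split=> x /=; rewrite in_itv /= andbT.
Qed.

Lemma near_vertex_vol K i : K \in SS -> i \in K ->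
  fine (leb d (near_vertex K i)) = (4^-1) ^+ d * vol K.
Proof.
move=> KS iK; have gK := mesh_good cD KS.
have uA : (4^-1 : R)%:M \in @unitmx _ d.
  by rewrite unitmxE det_scalar unitrX// unitfE invr_eq0.
rewrite (leb_affine ((3 / 4) *: a i) uA (near_vertex_measurable i KS)).
rewrite det_scalar ger0_norm ?exprn_ge0 ?invr_ge0//.
have -> : (fun x : 'rV[R]_d => x *m (4^-1)%:M + (3 / 4) *: a i) @^-1` near_vertex K i = osimp K.
  have lE x j : lam K (x *m (4^-1)%:M + (3 / 4) *: a i) j = 4^-1 * lam K x j + 3 / 4 * (j == i)%:R.
    rewrite mul_mx_scalar -(lam_vert j gK iK).
    by have [b bE] := bgradP j gK; rewrite !bE dotDr !dotZr; field.
  apply/seteqP; split=> x /=.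
    move=> [h1 h2] j jK; have := h1 j jK; rewrite lE.
    have [ji|ji] := eqVneq j i; last by rewrite mulr0 addr0 pmulr_rgt0 ?invr_gt0.
    by move=> _; move: h2; rewrite lE -ji eqxx mulr1 ltrDr pmulr_rgt0 ?invr_gt0.
  move=> Kx; split=> [j jK|]; rewrite lE.
    by rewrite ltr_pwDl ?mulr_gt0 ?invr_gt0 ?Kx// mulr_ge0// ?divr_ge0// ler0n.
  by rewrite eqxx mulr1 ltrDr mulr_gt0 ?invr_gt0 ?Kx.
rewrite fineM//; rewrite ge0_fin_numE//; apply: leb_bounded_lty => //.
  exact: osimp_measurable.
move: bD => [M [Mr hM]]; exists M; split => // r Mr' x Kx; apply: (hM r Mr').
exact: (osimp_sub cD KS).
Qed.

(** The weight at i exceeds 3/4 and all other values are at most |U_i| in modulus, so the function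
    is at least (3/4 - 1/4) |U_i| in modulus. *)
Lemma fe_sqr_ge K i x U : K \in SS -> i \in K -> (forall j, j \in K -> `|U j| <= `|U i|) ->
  near_vertex K i x -> (4 * d.+1%:R)^-1 * \sum_(j in K) U j ^+ 2 <= fe U x ^+ 2.
Proof.
move=> KS iK hi [Kx lx]; have gK := mesh_good cD KS.
have Kx' := osimp_hull gK Kx; have l0 j := lam_bounds j KS Kx'.
have s1 : \sum_(j in K) U j ^+ 2 <= d.+1%:R * U i ^+ 2.
  rewrite mulr_natl -gK.1 -sumr_const; apply: ler_sum => j jK.
  by rewrite -real_normK ?num_real// -[leRHS]real_normK ?num_real// lerXn2r ?nnegrE ?hi.
apply: (@le_trans _ _ (4^-1 * U i ^+ 2)).
  apply: le_trans (ler_wpM2l _ s1) _; first by rewrite invr_ge0 mulr_ge0.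
  rewrite le_eqVlt; apply/orP; left; apply/eqP; field.
  by rewrite gt_eqF // ltr_pwDl.
have : 2^-1 * `|U i| <= `|fe U x|.
  rewrite (fe_hull cD _ KS Kx') (bigD1 i)//=.
  apply: le_trans (lerB_normD _ _).
  have h1 : `|\sum_(j < nvert Th | j != i) U j * lam K x j| <= `|U i| * (1 - lam K x i).
    rewrite -(lam_sum x gK) [X in _ * (X - _)](bigD1 i)//= addrAC subrr add0r mulr_sumr.
    apply: le_trans (ler_norm_sum _ _ _) _; apply: ler_sum => j _.
    have [jK|jK] := boolP (j \in K); last by rewrite lam_out// !mulr0 normr0.
    by rewrite normrM (ger0_norm (l0 j)) ler_wpM2r// hi.
  apply: le_trans (lerB (lexx _) h1); rewrite normrM (ger0_norm (l0 i)).
  have := normr_ge0 (U i); nra.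
move=> h; rewrite -[leRHS]real_normK ?num_real// -[U i ^+ 2]real_normK ?num_real//.
have n0 := normr_ge0 (U i).
have : (2^-1 * `|U i|) ^+ 2 <= `|fe U x| ^+ 2 by rewrite lerXn2r ?nnegrE ?mulr_ge0 ?invr_ge0.
by apply: le_trans; rewrite exprMn exprVn -natrX.
Qed.

Lemma lump_le_mass U : c0 * lump U U <= mass U U.
Proof.
(* In each simplex, the part near a vertex where |U| is largest. *)
have /choice[A hA] K : exists A : set 'rV[R]_d, if K \in SS then exists2 i, i \in K &
    (forall j, j \in K -> `|U j| <= `|U i|) /\ A = near_vertex K i else A = set0.
  have [KS|KS] := boolP (K \in SS); last by exists set0.
  have [i0 iK] : exists i, i \in K by apply/card_gt0P; rewrite (mesh_good cD KS).1.
  pose i := [arg max_(i > i0 in K) `|U i|]%O.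
  exists (near_vertex K i), i; rewrite /i; case: arg_maxP => //.
have mA K : measurable (A K).
  have := hA K; case: ifPn => [KS [i _ [_ ->]]|_ -> //]; exact: near_vertex_measurable.
have AD K : A K `<=` D.
  have := hA K; case: ifPn => [KS [i _ [_ ->]]|_ -> //].
  by move=> x [Kx _]; apply: (osimp_sub cD KS).
pose c K : R := (4 * d.+1%:R)^-1 * \sum_(i in K) U i ^+ 2.
have cc0 K : 0 <= c K.
  by rewrite mulr_ge0 ?invr_ge0 ?mulr_ge0// sumr_ge0// => i _; exact: sqr_ge0.
have [i2 E2] := ip_indic_sum oD bD c mA AD.
have i2' : (leb d).-integrable D (EFin \o (fun x => \sum_K c K * \1_(A K) x)).
  have := in_L2_integrableM mD i2 (in_L2_cst oD bD 1).
  by under eq_fun do rewrite mulr1.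
have lumpE : c0 * lump U U = \sum_K c K * fine (leb d (A K)).
  rewrite /lump /lumpw mulr_sumr; under eq_bigr do rewrite mulr_suml big_mkcond mulr_sumr.
  rewrite exchange_big /=; apply: eq_bigr => K _; rewrite /c.
  have := hA K; have [KS [i0 i0K [_ ->]]|KS ->] := ifPn; last first.
    by rewrite measure0 [RHS]mulr0; apply: big1 => j _; exact: mulr0.
  rewrite near_vertex_vol// mulr_sumr mulr_suml [RHS]big_mkcond; apply: eq_bigr => i _ /=.
  by case: ifP => _; rewrite ?mulr0// /c0 expr2; ring.
rewrite lumpE -E2 /mass /ip.
have i1 := in_L2_integrableM mD (in_L2_fe U) (in_L2_fe U).
apply: le_Rintegral => // x Dx; rewrite -expr2.
have [[K KS Kx]|nx] := pselect (exists2 K, K \in SS & osimp K x); last first.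
  rewrite big1 ?sqr_ge0// => K _; have := hA K; case: ifPn => [KS [i _ [_ ->]]|_ ->].
    by rewrite indicE memNset ?mulr0// => -[Kx _]; apply: nx; exists K.
  by rewrite indic0 mulr0.
rewrite (bigD1 K)//= big1 ?addr0 => [|L LK]; last first.
  have := hA L; case: ifPn => [LS [i _ [_ ->]]|_ ->]; last by rewrite indic0 mulr0.
  rewrite indicE memNset ?mulr0// => -[Lx _]; move/eqP: LK; apply.
  exact: (osimp_disj cD LS KS Lx Kx).
have := hA K; rewrite KS => -[i iK [hi ->]]; rewrite indicE.
have [/set_mem Ax|_] := boolP (x \in _); last by rewrite mulr0 sqr_ge0.
by rewrite mulr1; exact: fe_sqr_ge iK hi Ax.
Qed.

End finite_elements.

(** * Symmetric bilinear forms on nodal values, and pointwise bounds for the reaction *)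

Section bilinear_form.
Context {R : realType} {I : finType} (s : I -> I -> R).
Implicit Types U V : I -> R.

Definition bil U V : R := \sum_i \sum_j s i j * (U i * V j).

Lemma bilDl U U' V : bil (fun i => U i + U' i) V = bil U V + bil U' V.
Proof.
rewrite /bil -big_split; apply: eq_bigr => i _; rewrite -big_split.
by apply: eq_bigr => j _ /=; ring.
Qed.

Lemma bilZl (c : R) U V : bil (fun i => c * U i) V = c * bil U V.
Proof.
rewrite /bil mulr_sumr; apply: eq_bigr => i _; rewrite mulr_sumr.
by apply: eq_bigr => j _; ring.
Qed.

Context (sC : forall i j, s i j = s j i) (s0 : forall U, 0 <= bil U U).

Lemma bilC U V : bil U V = bil V U.
Proof.
rewrite /bil exchange_big /=; apply: eq_bigr => i _; apply: eq_bigr => j _.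
by rewrite sC [U j * _]mulrC.
Qed.

Lemma bilD_sqr (c : R) U V : bil (fun i => U i + c * V i) (fun i => U i + c * V i) =
  bil U U + 2 * c * bil V U + c ^+ 2 * bil V V.
Proof.
have E X : bil (fun i => U i + c * V i) X = bil U X + c * bil V X by rewrite bilDl bilZl.
by rewrite E (bilC U) (bilC V) !E (bilC U V); ring.
Qed.

(** Expansion of the nonnegative values of the form at U + e V and U - e V, divided by e. *)
Lemma bil_cauchy (e : R) U V : 0 < e -> `|2 * bil V U| <= e * bil V V + e^-1 * bil U U.
Proof.
move=> e0; have h c : 0 <= e^-1 * (bil U U + 2 * (c * e) * bil V U + (c * e) ^+ 2 * bil V V).
  by rewrite -bilD_sqr mulr_ge0// invr_ge0 ltW.
rewrite ler_norml -subr_ge0 -[in X in _ && X]subr_ge0; apply/andP; split.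
  by rewrite [leRHS](_ : _ = e^-1 * (bil U U + 2 * (1 * e) * bil V U + (1 * e) ^+ 2 * bil V V)) ?h//; field; rewrite gt_eqF.
by rewrite [leRHS](_ : _ = e^-1 * (bil U U + 2 * (-1 * e) * bil V U + (-1 * e) ^+ 2 * bil V V)) ?h//; field; rewrite gt_eqF.
Qed.

(** Symmetry and zero row sums give bil (phi U) U = - 1/2 sum s_ij (phi U_i - phi U_j) (U_i - U_j);
    the diagonal drops out and the other coefficients are nonpositive. *)
Lemma bil_monotone (phi : R -> R) U : (forall x y, 0 <= (phi x - phi y) * (x - y)) ->
  (forall i j, i != j -> s i j <= 0) -> (forall i, \sum_j s i j = 0) ->
  0 <= bil (phi \o U) U.
Proof.
move=> mphi sle s1.
have e1 : \sum_i \sum_j s i j * (phi (U i) * U i) = 0.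
  by apply: big1 => i _; rewrite -mulr_suml s1 mul0r.
have e2 : \sum_i \sum_j s i j * (phi (U j) * U j) = 0.
  rewrite exchange_big /=; apply: big1 => j _; rewrite -mulr_suml.
  by under eq_bigr do rewrite sC; rewrite s1 mul0r.
have e3 : \sum_i \sum_j s i j * (phi (U j) * U i) = bil (phi \o U) U.
  rewrite exchange_big /=; apply: eq_bigr => j _; apply: eq_bigr => i _.
  by rewrite sC.
have : \sum_i \sum_j s i j * ((phi (U i) - phi (U j)) * (U i - U j)) <= 0.
  apply: sumr_le0 => i _; apply: sumr_le0 => j _.
  have [<-|ij] := eqVneq i j; first by rewrite subrr mul0r mulr0.
  by rewrite mulr_le0_ge0// sle.
have -> : \sum_i \sum_j s i j * ((phi (U i) - phi (U j)) * (U i - U j)) =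
    \sum_i \sum_j s i j * (phi (U i) * U i) + \sum_i \sum_j s i j * (phi (U j) * U j)
    - (\sum_i \sum_j s i j * (phi (U j) * U i) + bil (phi \o U) U).
  rewrite /bil -!big_split -sumrB; apply: eq_bigr => i _; rewrite -!big_split -sumrB.
  by apply: eq_bigr => j _ /=; ring.
by rewrite e1 e2 e3; lra.
Qed.

End bilinear_form.

Lemma odd_power_monotone (R : realType) q (x y : R) : odd q -> 0 <= (x ^+ q - y ^+ q) * (x - y).
Proof.
move=> oq; wlog yx : x y / y <= x.
  move=> h; have [yx|/ltW xy] := leP y x; first exact: h.
  by rewrite -mulrNN !opprB h.
rewrite mulr_ge0 ?subr_ge0//.
have [y0|y0] := leP 0 y; first by rewrite lerXn2r ?nnegrE// (le_trans y0).
have [x0|x0] := leP 0 x.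
  by apply: (@le_trans _ _ 0); rewrite ?exprn_odd_le0 ?exprn_ge0// ltW.
have : (- x) ^+ q <= (- y) ^+ q by rewrite lerXn2r ?nnegrE ?oppr_ge0 ?lerN2// ltW.
by rewrite (exprNn x) (exprNn y) -signr_odd oq expr1 !mulN1r lerN2.
Qed.

(** Put y = x^2, so that x^(q+1) = y^(m+2). For y <= 1 the bound is k; for y > 1 the power dominates
    y^2, and k y - y^2 <= k^2. *)
Lemma superlinear_bound (R : realType) q (k x : R) : (3 <= q)%N -> odd q -> 0 <= k ->
  k * x ^+ 2 - x ^+ q.+1 <= k + k ^+ 2.
Proof.
move=> q3 oq k0; have [m mE] : exists m, q.+1 = (2 * m.+2)%N.
  by exists (q./2.-1); rewrite mul2n -[in LHS](odd_double_half q) oq; case: q q3 oq => [|[|[|q]]].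
rewrite mE exprM; have : 0 <= x ^+ 2 by exact: sqr_ge0.
move: (x ^+ 2) => y y0; have ym := exprn_ge0 m.+2 y0.
have [y1|y1] := leP y 1; first by have := sqr_ge0 k; nra.
have : y ^+ 2 <= y ^+ m.+2 by rewrite ler_weXn2l// ltW.
have := sqr_ge0 (y - k); nra.
Qed.

(** * Matrices of the three forms and existence of the projection *)

Section mesh_matrices.
Context {R : realType} {d : nat} (Th : mesh R d) (D : set 'rV[R]_d).
Local Notation index := ('I_(nvert Th)).
Local Notation a := (vert (m := Th)).
Local Notation SS := (simplices Th).
Context (d0 : (0 < d)%N) (cD : conforming_triangulation Th D) (oD : open D) (bD : bounded_set D).
Implicit Types (K L : {set index}) (x : 'rV[R]_d) (U V G : index -> R).

Let mD : measurable D := open_measurable_rV oD.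
Let fD : (leb d D < +oo)%E := leb_bounded_lty mD bD.

Definition stiffm (i j : index) : R := \sum_(K in SS) vol K * dot (bgrad K i) (bgrad K j).
Definition massm (i j : index) : R := ip D (hat (Th := Th) i) (hat (Th := Th) j).
Definition lumpm (i j : index) : R := if i == j then lumpw i else 0.

Lemma stiff_bil U V : stiff U V = bil stiffm U V.
Proof.
rewrite /stiff /bil /stiffm.
under [RHS]eq_bigr do under eq_bigr do rewrite mulr_suml.
under [RHS]eq_bigr do rewrite exchange_big /=.
rewrite [RHS]exchange_big /=; apply: eq_bigr => K _.
rewrite /fgrad dot_suml mulr_sumr; apply: eq_bigr => i _.
rewrite dot_sumr !mulr_sumr; apply: eq_bigr => j _; ring.
Qed.

Lemma mass_bil U V : mass D U V = bil massm U V.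
Proof.
rewrite (mass_sum cD oD bD) /bil exchange_big /=; apply: eq_bigr => i _.
by rewrite mulr_sumr; apply: eq_bigr => j _; rewrite /massm; ring.
Qed.

Lemma lump_bil U V : lump U V = bil lumpm U V.
Proof.
apply: eq_bigr => i _; rewrite (bigD1 i)//= /lumpm eqxx big1 ?addr0// => j /negbTE.
by rewrite eq_sym => ->; rewrite mul0r.
Qed.

Lemma stiffmC i j : stiffm i j = stiffm j i.
Proof. by apply: eq_bigr => K _; rewrite dotC. Qed.

Lemma massmC i j : massm i j = massm j i.
Proof. exact: ipC. Qed.

Lemma lumpmC i j : lumpm i j = lumpm j i.
Proof. by rewrite /lumpm eq_sym; case: eqP => [->|]. Qed.

Lemma vol_ge0 K : 0 <= vol K.
Proof. exact: fine_ge0. Qed.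

Lemma stiff_ge0 U : 0 <= stiff U U.
Proof. by apply: sumr_ge0 => K _; rewrite mulr_ge0 ?vol_ge0 ?dot_ge0. Qed.

Lemma lumpw_gt0 i : 0 < lumpw (Th := Th) i.
Proof.
have [K KS iK] := vert_mesh cD i.
rewrite /lumpw (bigD1 K) ?KS//= ltr_pwDl ?(vol_gt0 d0 (mesh_good cD KS))//.
by apply: sumr_ge0 => L _; exact: vol_ge0.
Qed.

Lemma lump_ge0 U : 0 <= lump U U.
Proof. by apply: sumr_ge0 => i _; rewrite mulr_ge0 ?(ltW (lumpw_gt0 _))// -expr2 sqr_ge0. Qed.

Lemma lump_eq0 U : lump U U = 0 -> forall i, U i = 0.
Proof.
move=> h i.
have h0 j : true -> 0 <= lumpw j * (U j * U j).
  by move=> _; rewrite mulr_ge0 ?(ltW (lumpw_gt0 _))// -expr2 sqr_ge0.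
have /(_ i isT) := psumr_eq0P h0 h.
by move/eqP; rewrite mulf_eq0 gt_eqF ?lumpw_gt0//= mulf_eq0 orbb => /eqP.
Qed.

Lemma stiffm_sum i : \sum_j stiffm i j = 0.
Proof.
rewrite /stiffm exchange_big /=; apply: big1 => K KS; rewrite -mulr_sumr.
have := dot_sumr (fun=> 1) (bgrad K) (bgrad K i); under eq_bigr do rewrite scale1r.
rewrite (bgrad_sum (mesh_good cD KS)) dotC dot0l; under eq_bigr do rewrite mul1r.
by move=> <-; rewrite mulr0.
Qed.

Definition mass_mx : 'M[R]_(nvert Th) := \matrix_(i, j) massm i j.

Lemma mass_mxE U V : mass D U V = ((\row_i U i) *m mass_mx *m (\row_i V i)^T) ord0 ord0.
Proof.
rewrite mass_bil /bil mxE exchange_big /=; apply: eq_bigr => j _.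
rewrite !mxE mulr_suml; apply: eq_bigr => i _; rewrite !mxE; ring.
Qed.

Lemma mass_eq0 U : mass D U U = 0 -> forall i, U i = 0.
Proof.
move=> h; apply: lump_eq0; apply/eqP; rewrite eq_le lump_ge0 andbT.
by have := lump_le_mass cD oD bD U; rewrite h pmulr_rle0 ?c0_gt0.
Qed.

(** The mass form is definite because it dominates [c0] times the lumped form, whose weights are
    positive. *)
Lemma mass_mx_unit : mass_mx \in unitmx.
Proof.
rewrite -row_free_unit -kermx_eq0; apply/rowV0P => v /sub_kermxP hv.
have h i : v ord0 i = 0.
  apply: (mass_eq0 (U := fun i => v ord0 i)); rewrite mass_mxE.
  have -> : \row_j v ord0 j = v by apply/rowP => j; rewrite mxE.
  by rewrite hv mul0mx mxE.
by apply/rowP => i; rewrite h mxE.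
Qed.

Definition mass_solve (l : index -> R) : index -> R :=
  fun i => ((\row_j l j) *m invmx mass_mx) ord0 i.

Lemma mass_solveP l V : mass D (mass_solve l) V = \sum_i V i * l i.
Proof.
rewrite mass_mxE.
have -> : \row_j mass_solve l j = (\row_j l j) *m invmx mass_mx.
  by apply/rowP => j; rewrite mxE.
by rewrite mulmxKV ?mass_mx_unit// mxE; apply: eq_bigr => i _; rewrite !mxE mulrC.
Qed.

Lemma mass_inj U U' : (forall V, mass D U V = mass D U' V) -> U = U'.
Proof.
move=> h; apply/funext => i; apply/eqP; rewrite -subr_eq0.
have -> : U i - U' i = U i + -1 * U' i by ring.
apply/eqP; apply: (mass_eq0 (U := fun i => U i + -1 * U' i)).
by rewrite !mass_bil (bilD_sqr massmC) -!mass_bil !h (massC D U' U) h; ring.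
Qed.

(** Solving with the mass matrix shows that the equations defining the choice [Ph] have a solution
    in V_h. *)
Lemma Ph_spec w : in_L2 D w ->
  Vh D Th (Ph D Th w) /\ forall V, mass D (Ph D Th w \o a) V = ip D w (fe V).
Proof.
move=> hw; rewrite /Ph; set P := [set p | _].
have [h1 h2] : P (get P).
  pose G := mass_solve (fun i => ip D w (hat (Th := Th) i)).
  apply: (@getPex _ P); exists (fe G); split; first exact: (Vh_fe d0 cD oD bD).
  move=> v hv; have vE := VhE_in cD hv.
  rewrite (ip_eqD (fun x _ => erefl) vE) [RHS](ip_eqD (fun x _ => erefl) vE).
  by rewrite [LHS]mass_solveP (ip_fe_sum cD oD bD).
split=> // V; rewrite -[RHS]h2; last exact: (Vh_fe d0 cD oD bD).
rewrite -[LHS]/(ip D _ _); apply: ip_eqD => // x Dx.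
by rewrite (VhE_in cD h1).
Qed.

End mesh_matrices.

(** * Discrete energy *)

(** The two barycentric gradients of an interval are opposite to each other. *)
Lemma stiffm_le0_interval (R : realType) (Th : mesh R 1) (D : set 'rV[R]_1)
    (cD : conforming_triangulation Th D) (i j : 'I_(nvert Th)) : i != j -> stiffm i j <= 0.
Proof.
move=> ij; apply: sumr_le0 => K KS; have gK := mesh_good cD KS.
have [iK|iK] := boolP (i \in K); last by rewrite bgrad_out// dot0l mulr0.
have [jK|jK] := boolP (j \in K); last by rewrite dotC bgrad_out// dot0l mulr0.
have KE : K = [set i; j]%SET.
  by apply/esym/eqP; rewrite eqEcard gK.1 cards2 ij andbT finset.subUset !finset.sub1set iK.
have -> : bgrad K j = - bgrad K i.
  apply/eqP; rewrite -addr_eq0 addrC -(bgrad_sum gK) (bigD1 i)//= (bigD1 j) 1?eq_sym//=.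
  rewrite big1 ?addr0// => k /andP[ki kj]; apply: bgrad_out => //.
  by rewrite KE !inE negb_or ki.
by rewrite dotNr mulrN oppr_le0 mulr_ge0 ?vol_ge0 ?dot_ge0.
Qed.

(** Summing the cotangent formula over the simplices at an edge gives a nonpositive multiple of the
    sum in the mesh assumption; a pair of vertices that is not an edge has a zero entry. *)
Lemma stiffm_le0_cot (R : realType) d' (Th : mesh R d'.+2) (D : set 'rV[R]_d'.+2)
    (cD : conforming_triangulation Th D) (mA : mesh_assumption Th) (i j : 'I_(nvert Th)) :
  i != j -> stiffm i j <= 0.
Proof.
move=> ij; have [ed|ned] := pselect (edge i j); last first.
  rewrite /stiffm big1// => K KS; have gK := mesh_good cD KS.
  have [iK|iK] := boolP (i \in K); last by rewrite bgrad_out// dot0l mulr0.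
  have [jK|jK] := boolP (j \in K); last by rewrite dotC bgrad_out// dot0l mulr0.
  by exfalso; apply: ned; split=> //; exists K => //; rewrite iK.
have := mA isT i j ed; rewrite pmulr_rge0 ?invr_gt0 ?ltr0n// => h.
have -> : stiffm i j = - (std_vol (R := R) (d := d'.+2) * d'`!%:R) *
    \sum_(K in simplices Th | (i \in K) && (j \in K))
      opposite_measure K i j * cot (dihedral_angle K i j).
  rewrite /stiffm (bigID (fun K : {set 'I_(nvert Th)} => (i \in K) && (j \in K))) /= [X in _ + X]big1 ?addr0; last first.
    move=> K /andP[KS]; have gK := mesh_good cD KS; rewrite negb_and => /orP[iK|jK].
      by rewrite bgrad_out// dot0l mulr0.
    by rewrite dotC bgrad_out// dot0l mulr0.
  rewrite mulr_sumr; apply: eq_bigr => K /and3P[KS iK jK].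
  exact: (cot_formula (mesh_good cD KS) iK jK ij).
by rewrite mulr_le0_ge0// oppr_le0 mulr_ge0// fine_ge0.
Qed.

Lemma stiffm_le0 (R : realType) d (Th : mesh R d) (D : set 'rV[R]_d) (d0 : (0 < d)%N)
    (cD : conforming_triangulation Th D) (mA : mesh_assumption Th) (i j : 'I_(nvert Th)) :
  i != j -> stiffm i j <= 0.
Proof.
case: d Th D d0 cD mA i j => [|[|d']]// Th D _ cD mA i j.
  exact: stiffm_le0_interval cD i j.
exact: stiffm_le0_cot cD mA i j.
Qed.

Section discrete_energy.
Context {R : realType} {d : nat} (Th : mesh R d) (D : set 'rV[R]_d).
Local Notation index := ('I_(nvert Th)).
Local Notation a := (vert (m := Th)).
Local Notation SS := (simplices Th).
Context (d0 : (0 < d)%N) (cD : conforming_triangulation Th D) (oD : open D) (bD : bounded_set D).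
Context (Dn0 : D !=set0).
Implicit Types (K L : {set index}) (x : 'rV[R]_d) (U V G : index -> R).

Let mD : measurable D := open_measurable_rV oD.
Let fD : (leb d D < +oo)%E := leb_bounded_lty mD bD.

Definition energym (i j : index) : R := stiffm i j + lumpm i j.

Definition energy U V : R := stiff U V + lump U V.

Lemma energy_bil U V : energy U V = bil energym U V.
Proof.
rewrite /energy stiff_bil lump_bil /bil -big_split; apply: eq_bigr => i _.
by rewrite -big_split; apply: eq_bigr => j _; rewrite /energym mulrDl.
Qed.

Lemma energymC i j : energym i j = energym j i.
Proof. by rewrite /energym stiffmC lumpmC. Qed.

Lemma energy_ge0 U : 0 <= energy U U.
Proof. by rewrite addr_ge0 ?stiff_ge0 ?(lump_ge0 d0 cD). Qed.

Definition discrete_laplacian U : index -> R :=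
  mass_solve D (fun i => - \sum_j stiffm i j * U j).

Lemma discrete_laplacianP U V : mass D (discrete_laplacian U) V = - stiff U V.
Proof.
rewrite (mass_solveP d0 cD oD bD) stiff_bil (bilC (@stiffmC _ _ _)) /bil -sumrN.
apply: eq_bigr => i _; rewrite mulrN mulr_sumr; congr (- _).
by apply: eq_bigr => j _; ring.
Qed.

(** The coefficient of (U, U)_m once |L|^2 has been spent: 1 from the linear part of the reaction,
    1/2 from A(U, U), and 1/(2 c0) from (L, U)_m. *)
Definition growth : R := (2 * c0 (R := R) (d := d))^-1 + 3 / 2.

Lemma reaction_diffusion_bound q U : mesh_assumption Th -> (3 <= q)%N -> odd q ->
  energy (fun i => discrete_laplacian U i + (U i - U i ^+ q)) U <=
    (growth + growth ^+ 2) * \sum_i lumpw (Th := Th) i.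
Proof.
move=> mA q3 oq; set L := discrete_laplacian U.
have cpos : 0 < c0 (R := R) (d := d) by exact: c0_gt0.
have g0 : 0 <= growth by rewrite addr_ge0 ?invr_ge0 ?mulr_ge0// ltW.
have LL : stiff L U = - mass D L L.
  by rewrite discrete_laplacianP stiff_bil (bilC (@stiffmC _ _ _)) -stiff_bil opprK.
(* A(U, U) = - (L, U) uses half of |L|^2, by Young's inequality in the mass form. *)
have h1 : stiff U U <= mass D L L / 2 + lump U U / 2.
  rewrite -[stiff U U]opprK -discrete_laplacianP.
  have psd V : 0 <= bil (massm D) V V by rewrite -(mass_bil cD oD bD) mass_ge0.
  have := bil_cauchy (@massmC _ _ _ D) psd U L ltr01.
  rewrite -!(mass_bil cD oD bD) ler_norml invr1 !mul1r => /andP[+ _].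
  by have := mass_le_lump d0 cD oD bD U; rewrite -/L; lra.
(* The other half of |L|^2: Young's inequality with weight [c0], since c0 (L, L)_m <= |L|^2. *)
have h2 : lump L U <= mass D L L / 2 + (2 * c0 (R := R) (d := d))^-1 * lump U U.
  have psd V : 0 <= bil (lumpm (Th := Th)) V V by rewrite -lump_bil (lump_ge0 d0 cD).
  have := bil_cauchy (@lumpmC _ _ _) psd U L cpos.
  rewrite -!lump_bil ler_norml => /andP[_]; rewrite (invfM 2).
  by have := lump_le_mass cD oD bD L; lra.
have h3 : 0 <= stiff (fun i => U i ^+ q) U.
  rewrite stiff_bil -[X in bil _ X _]/((fun y : R => y ^+ q) \o U); apply: (bil_monotone (@stiffmC _ _ Th)).
  - by move=> s t; exact: odd_power_monotone.
  - by move=> i j; exact: (stiffm_le0 d0 cD).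
  - by move=> i; exact: (stiffm_sum cD).
have h4 : growth * lump U U - lump (fun i => U i ^+ q) U <= (growth + growth ^+ 2) * \sum_i lumpw (Th := Th) i.
  rewrite /lump !mulr_sumr -sumrB; apply: ler_sum => i _.
  rewrite -exprSr -expr2 mulrCA -mulrBr mulrC ler_wpM2r ?(ltW (lumpw_gt0 d0 cD i))//.
  exact: superlinear_bound.
have -> : energy (fun i => L i + (U i - U i ^+ q)) U =
   (stiff L U + lump L U) + (stiff U U + lump U U) - (stiff (fun i => U i ^+ q) U + lump (fun i => U i ^+ q) U).
  have E (s : index -> index -> R) : bil s (fun i => L i + (U i - U i ^+ q)) U =
      bil s L U + bil s U U - bil s (fun i => U i ^+ q) U.
    rewrite !bilDl addrA; congr (_ + _); rewrite -[RHS]mulN1r -bilZl; congr bil.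
    by apply/funext => i; rewrite mulN1r.
  rewrite /energy !stiff_bil !lump_bil !E; ring.
by move: h1 h2 h3 h4; rewrite LL /growth; lra.
Qed.

(** With X = L + f(U'), the scheme says U + Delta G = U' - tau X. When the energies of both sides
    are expanded, tau^2 Q(X, X) has the favourable sign, so tau need not be small. *)
Lemma energy_step q (tau Delta : R) U U' G : mesh_assumption Th -> (3 <= q)%N -> odd q -> 0 < tau ->
  (forall V, mass D U' V + tau * stiff U' V =
     mass D U V + tau * mass D (fun i => U' i - U' i ^+ q) V + Delta * mass D G V) ->
  energy U' U' <= energy U U + 2 * Delta * energy G U + Delta ^+ 2 * energy G G +
    2 * tau * ((growth + growth ^+ 2) * \sum_i lumpw (Th := Th) i).
Proof.
move=> mA q3 oq t0 hU.
pose X i := discrete_laplacian U' i + (U' i - U' i ^+ q).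
have XE V : mass D X V = - stiff U' V + mass D (fun i => U' i - U' i ^+ q) V.
  by rewrite /X !(mass_bil cD oD bD) bilDl -!(mass_bil cD oD bD) discrete_laplacianP.
have UX : (fun i => U i + Delta * G i) = (fun i => U' i + - tau * X i).
  apply: (mass_inj d0 cD oD bD) => V; have := XE V; move: (X) => Y YE.
  rewrite (mass_bil cD oD bD) bilDl bilZl [RHS](mass_bil cD oD bD) bilDl bilZl.
  by rewrite -!(mass_bil cD oD bD) YE; have := hU V; lra.
have := bilD_sqr energymC Delta U G; rewrite UX (bilD_sqr energymC) -!energy_bil => h.
have := reaction_diffusion_bound U' mA q3 oq; rewrite -/X => hX.
have := energy_ge0 X; move: h hX; move: (energy X U') (energy X X) => e1 e2 h hX he.
have := mulr_ge0 (sqr_ge0 tau) he.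
have := ler_wpM2l (ltW t0) hX.
by move: h; lra.
Qed.

(** The comparison of the two mass forms, at the constant function 1. *)
Lemma lumpw_sum_le : \sum_i lumpw (Th := Th) i <= (c0 (R := R) (d := d))^-1 * fine (leb d D).
Proof.
have := lump_le_mass cD oD bD (fun=> 1); rewrite -ler_pdivlMl ?c0_gt0//.
rewrite /lump; under eq_bigr do rewrite mulr1 mulr1.
move=> /le_trans; apply; rewrite ler_wpM2l//; first by rewrite invr_ge0 ltW ?c0_gt0.
rewrite /mass /ip /Rintegral le_eqVlt; apply/orP; left; apply/eqP; congr fine.
rewrite -[RHS]mul1e -[RHS]integral_cst//; apply: eq_integral => x /set_mem Dx.
have [K KS Kx] := sub_mesh_domain cD Dx.
rewrite (fe_hull cD _ KS Kx); under eq_bigr do rewrite mul1r.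
by rewrite (lam_sum _ (mesh_good cD KS)) mulr1.
Qed.

Lemma enorm_le_norm x : enorm x <= Num.sqrt (d%:R * `|x| ^+ 2).
Proof.
have -> : d%:R * `|x| ^+ 2 = \sum_(i < d) `|x| ^+ 2 by rewrite sumr_const card_ord mulr_natl.
rewrite ler_wsqrtr//; apply: ler_sum => i _.
rewrite -expr2 -real_normK ?num_real// lerXn2r ?nnegrE//; exact: coord_le_norm.
Qed.

(** This allows the projection estimate to be divided by the mesh size. *)
Lemma mesh_size_gt0 : 0 < mesh_size Th.
Proof.
have [x Dx] := Dn0; have [K KS Kx] := sub_mesh_domain cD Dx.
have gK := mesh_good cD KS.
have : (1 < #|K|)%N by rewrite gK.1 ltnS.
move=> /card_gt1P[i [j [iK jK ij]]].
apply: (@lt_le_trans _ _ (diam (hull K))); last exact: le_bigmax_cond.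
have aij : 0 < enorm (a i - a j).
  rewrite sqrtr_gt0 lt_neqAle dot_ge0 andbT eq_sym; apply/eqP => /dot_eq0 /eqP.
  rewrite subr_eq0 => /eqP aE; move/eqP: (lam_vert i gK iK); rewrite aE lam_vert// eqxx.
  by rewrite (negbTE ij) eq_sym oner_eq0.
apply: (lt_le_trans aij); apply: ub_le_sup.
  exists (Num.sqrt (d%:R * (2 * \sum_i `|a i|) ^+ 2)) => r [y [z [Ky Kz ->]]].
  apply: le_trans (enorm_le_norm _) _; rewrite ler_wsqrtr// ler_wpM2l//.
  rewrite lerXn2r ?nnegrE ?mulr_ge0 ?sumr_ge0//.
  by apply: le_trans (ler_normB _ _) _; have := hull_bounded Ky; have := hull_bounded Kz; lra.
by exists (a i), (a j); split=> //; exact: (vert_hull cD).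
Qed.

Lemma mass_Ph_le w : in_L2 D w ->
  mass D (Ph D Th w \o a) (Ph D Th w \o a) <= ip D w w.
Proof.
move=> hw; have [_ hP] := Ph_spec d0 cD oD bD hw; set G := _ \o a.
have i2 : 0 < 2^-1 :> R by rewrite invr_gt0.
have := ip_cauchy mD i2 hw (in_L2_fe cD oD bD G).
by rewrite -hP -/(mass D G G) invrK; lra.
Qed.

(** For s = 1 both the gradient error and the right-hand side of the estimate carry one factor h;
    without it, the H^1 error is bounded, and the triangle inequality concludes. *)
Lemma stiff_Ph_le (CP : R) w : sobolev D 1 w -> Ph_estimates D Th CP ->
  stiff (Ph D Th w \o a) (Ph D Th w \o a) <=
    2 * (CP ^+ 2 * #|{ffun 'I_d -> 'I_2}|%:R + 1) * (ip D w w + grad_ip D w w).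
Proof.
move=> sw [hP _]; have [hw dw] := sw; have [vP oP] := Ph_spec d0 cD oD bD hw.
set p := Ph D Th w; rewrite -/p in vP oP *.
have dW i : exists2 w', in_L2 D w' & is_weak_deriv D (fun j => (j == i : nat)) w w'.
  by have [w' [h1 h2]] := dw (fun j => (j == i : nat)) (eq_leq (mdeg1 i)); exists w'.
have hg i : in_L2 D (grad D w i) /\ is_weak_deriv D (fun j => (j == i : nat)) w (grad D w i).
  apply: (@getPex _ [set w' | in_L2 D w' /\ is_weak_deriv D (fun j => (j == i : nat)) w w']).
  by have [w' h1 h2] := dW i; exists w'.
have hp i : in_L2 D (grad D p i) /\ is_weak_deriv D (fun j => (j == i : nat)) p (grad D p i).
  apply: (@getPex _ [set w' | in_L2 D w' /\ is_weak_deriv D (fun j => (j == i : nat)) p w']).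
  have [[_ h] _] := vP.
  by have [w' [h1 h2]] := h (fun j => (j == i : nat)) (eq_leq (mdeg1 i)); exists w'.
have p2 : in_L2 D p by case: vP => -[].
pose r i := fun x => grad D w i x - grad D p i x.
have hr i : in_L2 D (r i) by apply: (in_L2B mD (hg i).1 (hp i).1).
have rE i : ip D (grad D (w \- p) i) (grad D (w \- p) i) = ip D (r i) (r i).
  have [h1 h2] := weak_derivP oD bD (hr i)
    (is_weak_derivB oD bD hw p2 (hg i).1 (hp i).1 (hg i).2 (hp i).2).
  exact: ip_congr.
have gE : grad_ip D (w \- p) (w \- p) = \sum_i ip D (r i) (r i) by apply: eq_bigr => i _.
have g0 v : 0 <= grad_ip D v v by apply: sumr_ge0 => i _; exact: ip_ge0.
have hs := mesh_size_gt0.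
have e1 : grad_norm D (w \- p) <= CP * sobolev_norm D 1 w.
  have := hP 1%N w isT sw; rewrite -/p.
  have : 0 <= L2norm D (w \- p) by exact: sqrtr_ge0.
  rewrite (_ : minn 2 1 = 1%N)// expr1 => l0 h.
  rewrite -(ler_pM2l hs); move: l0 h; lra.
have e2 : \sum_i ip D (r i) (r i) <= CP ^+ 2 * (#|{ffun 'I_d -> 'I_2}|%:R * (ip D w w + grad_ip D w w)).
  rewrite -gE -[leLHS]sqr_sqrtr ?g0//.
  apply: (@le_trans _ _ ((CP * sobolev_norm D 1 w) ^+ 2)).
    by rewrite lerXn2r ?nnegrE ?sqrtr_ge0//; apply: le_trans e1; exact: sqrtr_ge0.
  by rewrite exprMn ler_wpM2l ?sqr_ge0//; exact: sobolev_norm1_le.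
rewrite -(grad_ip_Vh d0 cD oD bD vP vP).
have e3 : grad_ip D p p <= \sum_i (2 * ip D (r i) (r i) + 2 * ip D (grad D w i) (grad D w i)).
  apply: ler_sum => i _.
  have -> : ip D (r i) (r i) = ip D (fun x => grad D p i x - grad D w i x) (fun x => grad D p i x - grad D w i x).
    by apply: eq_Rintegral => x _; rewrite /r -mulrNN !opprB.
  exact: (ipB_sqr mD (hp i).1 (hg i).1).
apply: le_trans e3 _; rewrite big_split /= -!mulr_sumr -/(grad_ip D w w).
have : 0 <= ip D w w by exact: ip_ge0.
move: e2; move: (\sum_(i < d) ip D (r i) (r i)) (ip D w w) (grad_ip D w w) (#|_|%:R : R) => e x y c.
by lra.
Qed.

Definition Ph_const (CP : R) : R :=
  (1 + (c0 (R := R) (d := d))^-1) * (2 * (CP ^+ 2 * #|{ffun 'I_d -> 'I_2}|%:R + 1) + 1).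

Lemma energy_Ph_le (CP : R) w : sobolev D 1 w -> Ph_estimates D Th CP ->
  energy (Ph D Th w \o a) (Ph D Th w \o a) <= Ph_const CP * (ip D w w + grad_ip D w w).
Proof.
move=> sw hP; have h1 := stiff_Ph_le sw hP; have h2 := mass_Ph_le sw.1.
have h3 := lump_le_mass cD oD bD (Ph D Th w \o a).
have g0 : 0 <= grad_ip D w w by apply: sumr_ge0 => i _; exact: ip_ge0.
have cpos : 0 < c0 (R := R) (d := d) by exact: c0_gt0.
have i0 : 0 <= ip D w w by exact: ip_ge0.
rewrite -ler_pdivlMl// in h3.
have h4 : lump (Ph D Th w \o a) (Ph D Th w \o a) <= (c0 (R := R) (d := d))^-1 * ip D w w.
  by apply: le_trans h3 _; rewrite ler_wpM2l// invr_ge0 ltW.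
rewrite /energy /Ph_const; have ci : 0 <= (c0 (R := R) (d := d))^-1 by rewrite invr_ge0 ltW.
move: h1; set k := 2 * _; have k0 : 0 <= k.
  by rewrite mulr_ge0// addr_ge0// mulr_ge0// sqr_ge0.
move: ci h4 k0 => {h3 cpos h2}; move: (_^-1) (k) (ip D w w) i0 (grad_ip D w w) g0 => ci k' x x0 y y0 ci0 h4 k0 h1.
have := mulr_ge0 ci0 y0; have := mulr_ge0 (mulr_ge0 ci0 k0) (addr_ge0 x0 y0).
by move: h1 h4; lra.
Qed.

Section noise.
Context (g g' : R -> R) (gD : forall y : R, is_derive y 1 g (g' y)) (cg' : continuous g').
Context (kappa : R) (glip : forall s t, `|g s - g t| <= kappa * `|s - t|).

(** The bounds |g(s)| <= |g(0)| + kappa |s| and |g'| <= kappa, integrated over D. *)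
Lemma sobolev_comp_fe U : sobolev D 1 (g \o fe U) /\
  ip D (g \o fe U) (g \o fe U) + grad_ip D (g \o fe U) (g \o fe U) <=
    2 * kappa ^+ 2 * energy U U + 2 * (g 0 ^+ 2 * fine (leb d D)).
Proof.
have [b hb] := fe_offset cD U.
have hw := in_L2_comp cD oD bD hb gD glip.
have hs i := in_L2_comp_slope cD oD bD hb gD cg' glip i.
have ds i := is_weak_deriv_comp d0 cD oD bD hb gD cg' glip i.
split.
  split=> // al /mdeg_le1[al0|[i ->]]; first by exists (g \o fe U); split=> //; exact: is_weak_deriv0.
  by eexists; split; [exact: (hs i)|exact: ds].
have k0 : 0 <= kappa.
  by have := glip 1 0; rewrite subr0 normr1 mulr1; apply: le_trans.
have e1 : ip D (g \o fe U) (g \o fe U) <= 2 * (kappa ^+ 2 * mass D U U) + 2 * (g 0 ^+ 2 * fine (leb d D)).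
  have hc := in_L2_cst oD bD (g 0).
  apply: le_trans (ipB_sqr mD hw hc) _; apply: lerD; rewrite ler_wpM2l//.
    have hfe := in_L2_fe cD oD bD U; have hB := in_L2B mD hw hc.
    rewrite /mass -(RintegralZl _ mD); last exact: in_L2_integrableM.
    apply: le_Rintegral => //.
    - exact: in_L2_integrableM.
    - by have := in_L2_integrableM mD (in_L2Z mD (kappa ^+ 2) hfe) hfe; under eq_fun do rewrite -mulrA.
    move=> x _; rewrite -!expr2 -exprMn -real_normK ?num_real// -[leRHS]real_normK ?num_real//.
    rewrite lerXn2r ?nnegrE//; apply: le_trans (glip _ _) _.
    by rewrite subr0 normrM (ger0_norm k0).
  by rewrite /ip /Rintegral integral_cst// fineM//= ?expr2//; rewrite ge0_fin_numE.
have e2 : grad_ip D (g \o fe U) (g \o fe U) <= kappa ^+ 2 * stiff U U.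
  have -> : stiff U U = \sum_(i < d) ip D (fslope U i) (fslope U i).
    under [RHS]eq_bigr do rewrite (ip_slope cD oD bD).
    by rewrite exchange_big /=; apply: eq_bigr => K _; rewrite mulr_sumr.
  rewrite mulr_sumr; apply: ler_sum => i _.
  have [h1 h2] := weak_derivP oD bD (hs i) (ds i).
  rewrite (ip_congr mD h1 h1 (hs i) (hs i) h2 h2).
  have hf := in_L2_fslope cD oD bD U i.
  rewrite -(RintegralZl _ mD); last exact: in_L2_integrableM.
  apply: le_Rintegral => //.
  - exact: in_L2_integrableM.
  - by have := in_L2_integrableM mD (in_L2Z mD (kappa ^+ 2) hf) hf; under eq_fun do rewrite -mulrA.
  move=> x _; rewrite /fslope -!expr2 exprMn ler_wpM2r ?sqr_ge0//.
  rewrite -real_normK ?num_real// lerXn2r ?nnegrE//.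
  by apply: le_trans (derive_le_lipschitz gD glip _) _; rewrite ger0_norm.
have := mass_le_lump d0 cD oD bD U; have := stiff_ge0 U; have := sqr_ge0 kappa.
rewrite /energy; move: e1 e2; move: (kappa ^+ 2) => k e1 e2 kk0 s0 ml.
have := ler_wpM2l kk0 ml; have := mulr_ge0 kk0 s0; move: e1 e2; lra.
Qed.

End noise.
End discrete_energy.

(** * Gaussian increments *)

Section gaussian.
Context {R : realType}.
Implicit Types (s x y z : R) (n : nat).

Let measurable_EFinZ (k : R) (f : R -> R) : measurable_fun setT f ->
  measurable_fun setT (fun x => (k%:E * (f x)%:E)%E).
Proof.
move=> mf; under eq_fun do rewrite -EFinM.
by apply/measurable_EFinP; exact: measurable_funM.
Qed.

Lemma normal_prob_opp s (A : set R) : s != 0 -> measurable A ->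
  normal_prob 0 s (-%R @^-1` A) = normal_prob 0 s A.
Proof.
move=> s0 mA; have mA' : measurable (-%R @^-1` A : set (measurableTypeR R)).
  by rewrite -[X in measurable X]setTI; exact: (@oppr_measurable R setT measurableT).
rewrite /normal_prob integral_mkcond [RHS]integral_mkcond.
rewrite [RHS](lebesgue_integral_affine (a := -1) 0); last 3 first.
- by rewrite oppr_eq0 oner_eq0.
- apply/measurable_restrict => //; rewrite setTI; apply/measurable_EFinP.
  by apply: measurable_funTS; exact: measurable_normal_pdf.
- by move=> x; apply: erestrict_ge0 => y _; rewrite lee_fin normal_pdf_ge0.
rewrite normrN1 mul1e; apply: eq_integral => x _.
rewrite addr0 mulN1r !patchE.
have -> : (- x \in A) = (x \in -%R @^-1` A) by apply/idP/idP => /set_mem h; apply/mem_set.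
by case: ifP => // _; rewrite !normal_pdfE// /normal_fun !subr0 sqrrN.
Qed.

Lemma normal_integral_opp s (f : R -> \bar R) : s != 0 -> measurable_fun setT f -> (forall x, 0 <= f x)%E ->
  (\int[normal_prob 0 s]_x f x = \int[normal_prob 0 s]_x f (- x)%R)%E.
Proof.
move=> s0 mf f0.
have mN : measurable_fun [set: measurableTypeR R] (-%R : measurableTypeR R -> measurableTypeR R).
  exact: oppr_measurable.
transitivity (\int[pushforward_measure (normal_prob 0 s) mN]_x f x)%E.
  by apply: eq_measure_integral => A mA _; rewrite /= /pushforward normal_prob_opp.
by rewrite (ge0_integral_pushforward mN (normal_prob 0 s) measurableT).
Qed.

(** Completing the square: an exponential tilt moves the mean. It is used for c = 1 and c = -1. *)
Lemma normal_pdf_shift s c x : 0 < s -> c ^+ 2 = 1 ->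
  expR (c * (x / s)) * normal_pdf 0 s x = expR 2^-1 * normal_pdf (c * s) s x.
Proof.
move=> s0 c1; rewrite !normal_pdfE ?gt_eqF//.
rewrite /normal_fun mulrCA [RHS]mulrCA -!expRD; congr (_ * expR _).
have -> : (x - c * s) ^+ 2 = x ^+ 2 - 2 * c * s * x + c ^+ 2 * s ^+ 2 by ring.
by rewrite c1 subr0; field; rewrite gt_eqF.
Qed.

(** exp |z| <= exp z + exp (- z), and each tilted density integrates to exp (1/2). *)
Lemma integral_exp_normal_pdf s : 0 < s ->
  (\int[lebesgue_measure]_x ((expR `|x / s|)%:E * (normal_pdf 0 s x)%:E) <= (2 * expR 2^-1)%:E)%E.
Proof.
move=> s0.
have mn c : measurable_fun setT (fun x => (normal_pdf c s x)%:E).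
  by apply/measurable_EFinP; exact: measurable_normal_pdf.
have p0 c x : (0 <= (normal_pdf c s x)%:E)%E by rewrite lee_fin normal_pdf_ge0.
apply: (@le_trans _ _ (\int[lebesgue_measure]_x
   ((expR 2^-1)%:E * (normal_pdf s s x)%:E + (expR 2^-1)%:E * (normal_pdf (- s) s x)%:E))%E).
  apply: ge0_le_integral => //.
  - by move=> x _; rewrite mule_ge0 ?lee_fin ?expR_ge0 ?normal_pdf_ge0.
  - apply: emeasurable_funM => //; apply/measurable_EFinP; last exact: measurable_normal_pdf.
    apply: measurableT_comp => //; apply: measurableT_comp => //.
    exact: measurable_funM.
  - by apply: emeasurable_funD; apply: measurable_EFinZ; exact: measurable_normal_pdf.
  move=> x _; rewrite -!EFinM -EFinD lee_fin.
  have := normal_pdf_shift x s0 (expr1n _ 2); have := @normal_pdf_shift s (-1) x s0 (sqrr_sign _ 1).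
  rewrite !mulN1r !mul1r => <- <-; rewrite -mulrDl ler_wpM2r ?normal_pdf_ge0//.
  have [h|h] := leP 0 (x / s); first by rewrite ger0_norm// lerDl expR_ge0.
  by rewrite ltr0_norm// lerDr expR_ge0.
rewrite ge0_integralD//; last 4 first.
- by move=> x _; rewrite mule_ge0 ?lee_fin ?expR_ge0 ?normal_pdf_ge0.
- by apply: measurable_EFinZ; exact: measurable_normal_pdf.
- by move=> x _; rewrite mule_ge0 ?lee_fin ?expR_ge0 ?normal_pdf_ge0.
- by apply: measurable_EFinZ; exact: measurable_normal_pdf.
have E c : (\int[lebesgue_measure]_x ((expR 2^-1)%:E * (normal_pdf c s x)%:E) = (expR 2^-1)%:E)%E.
  rewrite ge0_integralZl_EFin ?expR_ge0//; first by rewrite integral_normal_pdf mule1.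
  exact: mn.
rewrite !E -EFinD lee_fin.
by rewrite mulrDl mul1r.
Qed.

(* On each shell [n <= |x / s| < n + 1] the exponential varies by a factor at
   most e, which lets its integral be compared with the one against the
   density. *)
Lemma integral_exp_normal_prob s : 0 < s ->
  (\int[normal_prob 0 s]_x (expR `|x / s|)%:E <= (2 * expR (3 / 2))%:E)%E.
Proof.
move=> s0; have mz : measurable_fun [set: measurableTypeR R] (fun x : measurableTypeR R => `|x / s|).
  by apply: measurableT_comp => //; exact: measurable_funM.
have me : measurable_fun [set: measurableTypeR R] (fun x : measurableTypeR R => (expR `|x / s|)%:E).
  by apply/measurable_EFinP; exact: measurableT_comp.
have mn : measurable_fun [set: measurableTypeR R] (fun x : measurableTypeR R => (normal_pdf 0 s x)%:E).
  by apply/measurable_EFinP; exact: measurable_normal_pdf.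
have mep := emeasurable_funM me mn.
have p0 x : (0 <= (normal_pdf 0 s x)%:E)%E by rewrite lee_fin normal_pdf_ge0.
have e0 x : (0 <= (expR `|x / s|)%:E)%E by rewrite lee_fin expR_ge0.
pose A n : set (measurableTypeR R) := [set x | n%:R <= `|x / s| < n.+1%:R].
have mA n : measurable (A n).
  have := mz measurableT _ (measurable_itv `[n%:R, n.+1%:R[).
  by rewrite setTI; congr measurable; apply/seteqP; split=> x /=; rewrite in_itv.
have tA : trivIset setT A.
  move=> i j _ _ [x [/andP[i1 i2] /andP[j1 j2]]].
  have := le_lt_trans j1 i2; have := le_lt_trans i1 j2; rewrite !ltr_nat !ltnS => ij ji.
  by apply/eqP; rewrite eqn_leq ij ji.
have UA : \bigcup_n A n = setT.
  apply/seteqP; split=> // x _; exists (Num.truncn `|x / s|) => //.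
  by rewrite /A /=; exact: truncn_itv.
rewrite -UA ge0_integral_bigcup//; last by rewrite UA.
apply: (@le_trans _ _ (\sum_(0 <= n <oo) (expR 1)%:E *
    \int[lebesgue_measure]_(x in A n) ((expR `|x / s|)%:E * (normal_pdf 0 s x)%:E))%E).
  apply: lee_nneseries => [n _ _|n _]; first exact: integral_ge0.
  apply: (@le_trans _ _ (\int[normal_prob 0 s]_(x in A n) (expR n.+1%:R)%:E)%E).
    apply: ge0_le_integral => //; first exact: measurable_funTS.
    by move=> x /andP[_ h]; rewrite lee_fin ler_expR ltW.
  rewrite integral_cst// /normal_prob -ge0_integralZl_EFin//; last exact: measurable_funTS.
  rewrite -ge0_integralZl_EFin//; last 2 first.
  - by move=> x _; rewrite mule_ge0.
  - exact: measurable_funTS.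
  apply: ge0_le_integral => //.
  - by move=> x _; rewrite mule_ge0 ?lee_fin ?expR_ge0 ?normal_pdf_ge0.
  - by apply: measurable_funTS; apply: measurable_EFinZ; exact: measurable_normal_pdf.
  - apply: measurable_funTS; under eq_fun do rewrite -EFinM; apply: measurable_EFinZ.
    by apply: measurable_funM; [exact: measurableT_comp|exact: measurable_normal_pdf].
  move=> x /andP[h _]; rewrite muleA lee_wpmul2r//.
  by rewrite -EFinM -expRD lee_fin ler_expR -natr1 addrC lerD2l.
rewrite nneseriesZl//; last by move=> n _; apply: integral_ge0 => x _; rewrite mule_ge0.
rewrite -ge0_integral_bigcup//; last 2 first.
- by rewrite UA; exact: emeasurable_funM.
- by move=> x _; rewrite mule_ge0.
(* The factor exp 1 lost on the shells times exp (1/2) gives exp (3/2). *)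
rewrite UA; apply: (@le_trans _ _ ((expR 1)%:E * (2 * expR 2^-1)%:E)%E).
  by rewrite lee_wpmul2l ?lee_fin ?expR_ge0//; exact: integral_exp_normal_pdf.
rewrite -EFinM lee_fin mulrCA -expRD le_eqVlt; apply/orP; left; apply/eqP.
by congr (_ * expR _); lra.
Qed.

(** exp |z| is the n-th power of exp (|z| / n), which is at least 1 + |z| / n. *)
Lemma pow_le_expR n z : (0 < n)%N -> (1 + `|z|) ^+ n <= n%:R ^+ n * expR `|z|.
Proof.
move=> n0; have n0' : 0 < n%:R :> R by rewrite ltr0n.
have -> : expR `|z| = expR (`|z| / n%:R) ^+ n.
  by rewrite -expRM_natl mulrC divfK// gt_eqF.
rewrite -exprMn lerXn2r ?nnegrE ?addr_ge0 ?mulr_ge0 ?expR_ge0//.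
apply: (@le_trans _ _ (n%:R * (1 + `|z| / n%:R))); last first.
  by rewrite ler_pM2l//; exact: expR_ge1Dx.
by rewrite mulrDr mulr1 mulrCA divff ?gt_eqF// mulr1 lerD2r ler1n.
Qed.

(** The remainders satisfy r_(n+1) = (1 + y) r_n + n y^2, and n^2 + n <= (n + 1)^2. *)
Lemma binomial_remainder n y :
  `|(1 + y) ^+ n - 1 - n%:R * y| <= n%:R ^+ 2 * y ^+ 2 * (1 + `|y|) ^+ n.
Proof.
elim: n => [|n IH]; first by rewrite expr0 subrr mul0r subrr normr0 expr0n !mul0r.
have -> : (1 + y) ^+ n.+1 - 1 - n.+1%:R * y =
    (1 + y) * ((1 + y) ^+ n - 1 - n%:R * y) + n%:R * y ^+ 2.
  by rewrite exprS -natr1; ring.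
apply: le_trans (ler_normD _ _) _; rewrite normrM [`|_ * y ^+ 2|]ger0_norm ?(mulr_ge0 (ler0n _ _) (sqr_ge0 _))//.
have h1 : `|1 + y| <= 1 + `|y| by rewrite (le_trans (ler_normD _ _))// normr1.
have y0 : 0 <= 1 + `|y| by rewrite addr_ge0.
have P1 : 1 <= (1 + `|y|) ^+ n.+1 by rewrite exprn_ege1// lerDl.
have := ler_pM (normr_ge0 _) (normr_ge0 _) h1 IH; rewrite exprS in P1 *.
have n0 : 0 <= n%:R :> R by [].
rewrite -natr1; move: P1 n0; move: (n%:R : R) ((1 + `|y|) ^+ n) (1 + `|y|) y0 => N E F F0 P1 N0.
have := sqr_ge0 y; move: (y ^+ 2) (`|_| * `|_|) => Y X Y0 hX.
have NY : 0 <= N * Y by exact: mulr_ge0.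
have := ler_wpM2l NY P1; have := mulr_ge0 (mulr_ge0 N0 Y0) (le_trans ler01 P1).
have := mulr_ge0 Y0 (le_trans ler01 P1).
by move: hX; lra.
Qed.

(* Averaging over x and - x removes the first order term in [2 * xi * x], which
   is only of order sqrt tau. *)
Lemma gaussian_growth (a b C T : R) n : 0 <= a -> 0 <= b -> 0 <= C -> 0 <= T ->
  exists2 K, 0 <= K & forall tau xi : R, 0 < tau <= T -> `|xi| <= C ->
    (\int[normal_prob 0 (Num.sqrt tau)]_x
       ((1 + (a * tau + b * x ^+ 2 + 2 * xi * x)) ^+ n.*2)%:E <= (1 + K * tau)%:E)%E.
Proof.
move=> a0 b0 C0 T0; set N := n.*2; set S := Num.sqrt T; have S0 : 0 <= S by exact: sqrtr_ge0.
(* In the scaled variable z = x / sqrt tau, the perturbation of 1 is at most sqrt tau A (1 +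
   z^2). *)
pose A := a * S + b * S + 2 * C; have A0 : 0 <= A by rewrite !addr_ge0 ?mulr_ge0.
(* The first-order part left after averaging, plus the quadratic remainder. Both are of order tau (1
   + z^2)^(N + 2), and [M] is the exponent that trades this power for exp |z|. *)
pose B0 := N%:R * (a + b) + N%:R ^+ 2 * A ^+ 2 * (1 + S * A) ^+ N.
pose M := (2 * N.+2)%N; pose B := B0 * M%:R ^+ M.
have B00 : 0 <= B0.
  by rewrite addr_ge0 ?mulr_ge0 ?addr_ge0 ?sqr_ge0 ?exprn_ge0 ?addr_ge0 ?mulr_ge0.
have Bge0 : 0 <= B by rewrite mulr_ge0 ?exprn_ge0.
exists (2 * B * expR (3 / 2)); first by apply: mulr_ge0; [exact: mulr_ge0|exact: expR_ge0].
move=> tau xi /andP[t0 tT] xiC; set s := Num.sqrt tau.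
have s0 : 0 < s by rewrite sqrtr_gt0.
have sS : s <= S by rewrite ler_wsqrtr.
have tE : tau = s ^+ 2 by rewrite sqr_sqrtr// ltW.
pose y x := a * tau + b * x ^+ 2 + 2 * xi * x.
pose h x := (1 + y x) ^+ N.
have h0 x : 0 <= h x by rewrite /h /N -muln2 exprM sqr_ge0.
have key x : h x + h (- x) <= 2 + 2 * tau * B * expR `|x / s|.
  set z := x / s; have xE : x = s * z by rewrite mulrC divfK// gt_eqF.
  have z1 : 1 <= 1 + z ^+ 2 by rewrite lerDl sqr_ge0.
  have zz : `|z| <= 1 + z ^+ 2.
    by rewrite -[z ^+ 2]real_normK ?num_real//; have := sqr_ge0 (`|z| - 1); have := normr_ge0 z; nra.
  have yb (w : R) : `|w| = `|z| -> `|a * tau + b * (s * w) ^+ 2 + 2 * xi * (s * w)| <= s * A * (1 + z ^+ 2).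
    move=> wz; have ww : w ^+ 2 = z ^+ 2 by rewrite -real_normK ?num_real// wz real_normK ?num_real.
    apply: le_trans (ler_normD _ _) _.
    have w0 : 0 <= a * tau + b * (s * w) ^+ 2.
      by apply: addr_ge0; apply: mulr_ge0 => //; [exact: ltW|exact: sqr_ge0].
    rewrite (ger0_norm w0).
    rewrite !normrM wz (gtr0_norm s0) (ger0_norm (ler0n _ 2)) exprMn ww tE /A.
    have i1 : a * s ^+ 2 <= s * (a * S).
      by rewrite expr2 mulrCA ler_wpM2l ?(ltW s0)// ler_wpM2l.
    have i2 : b * (s ^+ 2 * z ^+ 2) <= s * (b * S) * z ^+ 2.
      by rewrite mulrA ler_wpM2r ?sqr_ge0// expr2 mulrCA ler_wpM2l ?(ltW s0)// ler_wpM2l.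
    have i3 : 2 * `|xi| * (s * `|z|) <= s * (2 * C) * (1 + z ^+ 2).
      rewrite mulrCA mulrA; apply: ler_pM => //; rewrite ?mulr_ge0 ?(ltW s0)//.
      by rewrite ler_wpM2l ?(ltW s0)// ler_wpM2l.
    have j1 : 0 <= s * (a * S) * z ^+ 2.
      by apply: mulr_ge0; [rewrite !mulr_ge0 ?(ltW s0)|exact: sqr_ge0].
    have j2 : 0 <= s * (b * S) by rewrite !mulr_ge0 ?(ltW s0).
    by move: i1 i2 i3 j1 j2; lra.
  have hb (w : R) : `|w| = `|z| -> h (s * w) <= 1 + N%:R * y (s * w) +
      N%:R ^+ 2 * (tau * A ^+ 2 * (1 + S * A) ^+ N * (1 + z ^+ 2) ^+ N.+2).
    move=> wz; have := binomial_remainder N (y (s * w)).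
    rewrite ler_norml => /andP[_]; rewrite -/(h (s * w)) => h1.
    have yw := yb w wz; rewrite -/(y (s * w)) in yw.
    have e1 : y (s * w) ^+ 2 <= tau * A ^+ 2 * (1 + z ^+ 2) ^+ 2.
      rewrite -real_normK ?num_real// tE -!exprMn lerXn2r ?nnegrE//.
      by rewrite !mulr_ge0 ?(ltW s0)// (le_trans ler01).
    have e2 : (1 + `|y (s * w)|) ^+ N <= (1 + S * A) ^+ N * (1 + z ^+ 2) ^+ N.
      have z0 := le_trans ler01 z1; have A1 : 0 <= 1 + S * A by rewrite addr_ge0// mulr_ge0.
      rewrite -exprMn lerXn2r ?nnegrE ?addr_ge0 ?(mulr_ge0 A1 z0)//.
      rewrite mulrDl mul1r lerD//; apply: le_trans yw _.
      by rewrite ler_wpM2r ?(le_trans ler01)// ler_wpM2r.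
    have e3 := ler_pM (sqr_ge0 _) (exprn_ge0 N (addr_ge0 ler01 (normr_ge0 _))) e1 e2.
    have := ler_wpM2l (sqr_ge0 (N%:R : R)) e3.
    have -> : (1 + z ^+ 2) ^+ N.+2 = (1 + z ^+ 2) ^+ N * (1 + z ^+ 2) ^+ 2 by rewrite -exprD addn2.
    by move: h1; lra.
  have h1 := hb z erefl; have := hb (- z) (normrN z).
  rewrite mulrN -xE => h2; rewrite -xE in h1.
  have ys : y x + y (- x) = 2 * (tau * (a + b * z ^+ 2)) by rewrite /y tE {1 3}xE; ring.
  have P1 : 1 + z ^+ 2 <= (1 + z ^+ 2) ^+ N.+2 by rewrite -[leLHS]expr1 ler_weXn2l.
  have e1 : a + b * z ^+ 2 <= (a + b) * (1 + z ^+ 2) ^+ N.+2.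
    apply: le_trans (ler_wpM2l (addr_ge0 a0 b0) P1).
    by have := mulr_ge0 a0 (sqr_ge0 z); lra.
  have e2 : (1 + z ^+ 2) ^+ N.+2 <= M%:R ^+ M * expR `|z|.
    apply: le_trans (pow_le_expR z _) => //.
    rewrite exprM lerXn2r ?nnegrE ?(le_trans ler01 z1) ?sqr_ge0//.
    by rewrite -[z ^+ 2]real_normK ?num_real//; have := normr_ge0 z; nra.
  have e3 : B0 * (1 + z ^+ 2) ^+ N.+2 <= B * expR `|z| by rewrite /B -[leRHS]mulrA ler_wpM2l.
  have e4 := ler_wpM2l (ltW t0) e3.
  have e5 := ler_wpM2l (ler0n R N) (ler_wpM2l (ltW t0) e1).
  have ys' : N%:R * y x + N%:R * y (- x) = 2 * (N%:R * (tau * (a + b * z ^+ 2))).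
    by rewrite -mulrDr ys mulrCA.
  move: h1 h2 e4 e5 ys'; rewrite /B0.
  move: ((1 + z ^+ 2) ^+ N.+2) ((1 + S * A) ^+ N) (A ^+ 2) (N%:R : R) => F H A2 r.
  move: (r * y x) (r * y (- x)) (r * (tau * (a + b * z ^+ 2))) (h x) (h (- x)) => v1 v2 v3 v4 v5.
  by lra.
have mh : measurable_fun [set: measurableTypeR R] (fun x : measurableTypeR R => (h x)%:E).
  apply/measurable_EFinP; apply: measurable_funX; apply: measurable_funD => //.
  apply: measurable_funD; last exact: measurable_funM.
  by apply: measurable_funD => //; apply: measurable_funM => //; exact: measurable_funX.
have mz : measurable_fun [set: measurableTypeR R] (fun x : measurableTypeR R => `|x / s|).
  by apply: measurableT_comp => //; exact: measurable_funM.
have me : measurable_fun [set: measurableTypeR R] (fun x : measurableTypeR R => (expR `|x / s|)%:E).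
  by apply/measurable_EFinP; exact: measurableT_comp.
have hh : (\int[normal_prob 0 s]_x (h x)%:E + \int[normal_prob 0 s]_x (h x)%:E <=
    (2 + 2 * tau * B * (2 * expR (3 / 2)))%:E)%E.
  have E : (\int[normal_prob 0 s]_x (h x)%:E = \int[normal_prob 0 s]_x (h (- x)%R)%:E)%E.
    by apply: (normal_integral_opp (f := EFin \o h)) => //; rewrite gt_eqF.
  have mh' : measurable_fun [set: measurableTypeR R] (fun x : measurableTypeR R => (h (- x))%:E).
    by apply: (measurableT_comp mh); exact: oppr_measurable.
  rewrite {2}E.
  rewrite -ge0_integralD//; last 2 first.
  - by move=> x _; rewrite lee_fin.
  - by move=> x _; rewrite lee_fin.
  apply: (@le_trans _ _ (\int[normal_prob 0 s]_x (2%:E + (2 * tau * B)%:E * (expR `|x / s|)%:E))%E).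
    apply: ge0_le_integral => //.
    - by move=> x _; rewrite -EFinD lee_fin addr_ge0.
    - by apply: emeasurable_funD.
    - by apply: emeasurable_funD => //; apply: measurable_EFinZ; exact: measurableT_comp.
    by move=> x _; rewrite -EFinM -!EFinD lee_fin.
  have c0 : 0 <= 2 * tau * B by apply: mulr_ge0 => //; rewrite mulr_ge0// ltW.
  rewrite ge0_integralD//; last 2 first.
  - by move=> x _; rewrite -EFinM lee_fin mulr_ge0 ?expR_ge0.
  - by apply: measurable_EFinZ; exact: measurableT_comp.
  rewrite [leRHS]EFinD; apply: leeD.
    rewrite integral_cst// -[leRHS]mule1; apply: lee_wpmul2l; first by rewrite lee_fin.
    exact: (@probability_le1 _ _ _ (normal_prob 0 s)).
  rewrite ge0_integralZl_EFin// [leRHS]EFinM lee_wpmul2l ?lee_fin//.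
  exact: integral_exp_normal_prob.
move: hh; rewrite -/(h _); move: (\int[_]_x _)%E => [r| |] //=; last first.
  by move=> _; rewrite leNye.
rewrite -EFinD !lee_fin; lra.
Qed.

End gaussian.

(** * Integrating out an increment independent of the past *)

Section independence.
Context {R : realType} {dO : measure_display} {Omega : measurableType dO} (P : probability Omega R).
Context (G : set (set Omega)) (sG : sigma_algebra setT G) (mG : G `<=` measurable).
Local Notation OG := (g_sigma_algebraType G).

Lemma measurable_OG (A : set OG) : measurable A <-> G A.
Proof. by rewrite /measurable /= sigma_algebra_id. Qed.

Lemma measurable_idOG : measurable_fun setT (idfun : Omega -> OG).
Proof. by move=> _ A /measurable_OG GA; rewrite setTI; exact: mG. Qed.

Lemma adapted_measurable (Y : Omega -> R) : adapted_at G Y -> measurable_fun setT (Y : OG -> R).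
Proof. by move=> hY _ B mB; rewrite setTI; apply/measurable_OG; exact: hY. Qed.

(** P restricted to the sub-sigma-algebra G, as its image under the identity. The measurability
    proof is an argument so that the measure structure can depend on it. *)
Definition restricted_prob (_ : measurable_fun setT (idfun : Omega -> OG)) : set OG -> \bar R :=
  pushforward P (idfun : Omega -> OG).

HB.instance Definition _ (mid : measurable_fun setT (idfun : Omega -> OG)) :=
  Measure.copy (restricted_prob mid) (pushforward_measure P mid).

Let restricted_prob_setT (mid : measurable_fun setT (idfun : Omega -> OG)) :
  restricted_prob mid [set: OG] = 1%E.
Proof. exact: (@probability_setT _ _ _ P). Qed.

HB.instance Definition _ (mid : measurable_fun setT (idfun : Omega -> OG)) :=
  Measure_isProbability.Build _ _ _ (restricted_prob mid) (restricted_prob_setT mid).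

Context (X : Omega -> R) (mX : measurable_fun setT X) (mu : probability (measurableTypeR R) R).
Context (indep : forall (A : set Omega) (B : set R), G A -> measurable B ->
  P (A `&` X @^-1` B) = (P A * mu B)%E).

(** By uniqueness of the product measure, independence makes the law of (om, X om) on G times the
    Borel sets a product; Fubini's theorem then integrates X with the past frozen. *)
Lemma independent_integral (f : OG * measurableTypeR R -> \bar R) :
  measurable_fun setT f -> (forall z, 0 <= f z)%E ->
  (\int[P]_om f (om, X om) = \int[P]_om \int[mu]_x f (om, x))%E.
Proof.
move=> mf f0; have mphi : measurable_fun setT (fun om : Omega => (om, X om) : OG * measurableTypeR R).
  by apply: measurable_fun_pair => //; exact: measurable_idOG.
pose m1 := restricted_prob measurable_idOG.
transitivity (\int[pushforward_measure P mphi]_z f z)%E.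
  by rewrite (ge0_integral_pushforward mphi P measurableT).
transitivity (\int[(m1 \x mu)%E]_z f z)%E.
  apply: eq_measure_integral => A mA _; apply/esym.
  apply: product_measure_unique => // A1 B /measurable_OG GA1 mB.
  rewrite /= /pushforward /m1 /restricted_prob /pushforward /=.
  by rewrite -(indep GA1 mB).
rewrite fubini_tonelli1// (ge0_integral_pushforward measurable_idOG P measurableT)//.
  exact: measurable_fun_fubini_tonelli_F.
by move=> x _; apply: integral_ge0.
Qed.

(** Y and xi depend only on the past, so the growth factor is integrated in x first, for each fixed
    value of xi, where [hK] applies. *)
Lemma moment_step n (a b K tau : R) (Y Y' xi : Omega -> R) :
  (forall om, (\int[mu]_x
     ((1 + (a * tau + b * x ^+ 2 + 2 * xi om * x)) ^+ n.*2)%:E <= (1 + K * tau)%:E)%E) ->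
  adapted_at G Y -> adapted_at G xi -> measurable_fun setT Y' ->
  {ae P, forall om, 0 <= Y' om <= Y om * (1 + (a * tau + b * X om ^+ 2 + 2 * xi om * X om))} ->
  (\int[P]_om (Y' om ^+ n.*2)%:E <= (1 + K * tau)%:E * \int[P]_om (Y om ^+ n.*2)%:E)%E.
Proof.
move=> hK aY axi mY' hY.
have even0 (r : R) : 0 <= r ^+ n.*2 by rewrite -muln2 exprM sqr_ge0.
have mY := adapted_measurable aY; have mxi := adapted_measurable axi.
pose h (z : OG * measurableTypeR R) : R := 1 + (a * tau + b * z.2 ^+ 2 + 2 * xi z.1 * z.2).
pose f (z : OG * measurableTypeR R) : \bar R := (Y z.1 ^+ n.*2 * h z ^+ n.*2)%:E.
have mh : measurable_fun setT h.
  have m2 : measurable_fun setT (fun z : OG * measurableTypeR R => z.2) by exact: measurable_snd.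
  apply: measurable_funD => //; apply: measurable_funD.
    by apply: measurable_funD => //; apply: measurable_funM => //; exact: measurable_funX.
  apply: measurable_funM => //; apply: measurable_funM => //.
  exact: (measurableT_comp mxi measurable_fst).
have mf : measurable_fun setT f.
  apply/measurable_EFinP; apply: measurable_funM; apply: measurable_funX => //.
  exact: (measurableT_comp mY measurable_fst).
have f0 z : (0 <= f z)%E by rewrite lee_fin mulr_ge0.
have mphi : measurable_fun setT (fun om : Omega => (om, X om) : OG * measurableTypeR R).
  by apply: measurable_fun_pair => //; exact: measurable_idOG.
have mYO : measurable_fun setT Y by exact: (measurableT_comp mY measurable_idOG).
apply: (@le_trans _ _ (\int[P]_om f (om, X om))%E).
  apply: ae_ge0_le_integral => //.
  - by move=> om _; rewrite lee_fin.
  - by apply/measurable_EFinP; exact: measurable_funX.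
  - exact: (measurableT_comp mf mphi).
  apply: filterS hY => om /andP[y0 yY] _; rewrite lee_fin -exprMn.
  by rewrite lerXn2r// nnegrE// (le_trans y0).
rewrite independent_integral//.
apply: (@le_trans _ _ (\int[P]_om ((1 + K * tau)%:E * (Y om ^+ n.*2)%:E))%E); last first.
  rewrite ge0_integralZl_EFin//.
  - by move=> om _; rewrite lee_fin.
  - by apply/measurable_EFinP; exact: measurable_funX.
  (* The sign of 1 + K tau is read off from [hK], whose left-hand side is nonnegative. *)
  rewrite -lee_fin; apply: le_trans (hK point); apply: integral_ge0 => x _.
  by rewrite lee_fin.
apply: ge0_le_integral => //.
- by move=> om _; exact: integral_ge0.
- have mF : measurable_fun setT (fun om : OG => \int[mu]_x f (om, x))%E.
    exact: measurable_fun_fubini_tonelli_F.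
  exact: (measurableT_comp mF measurable_idOG).
- under eq_fun do rewrite -EFinM.
  by apply/measurable_EFinP; apply: measurable_funM => //; exact: measurable_funX.
move=> om _; rewrite /f /=; under eq_integral do rewrite EFinM.
rewrite ge0_integralZl_EFin//.
- by rewrite muleC; apply: lee_wpmul2r; [rewrite lee_fin|exact: hK].
- by move=> x _; rewrite lee_fin.
- apply/measurable_EFinP; apply: measurable_funX.
  apply: (@measurableT_comp _ _ _ _ _ _ h _ (fun x => (om, x)) mh); exact: measurable_pair1.
Qed.

End independence.

(** * The scheme *)

Lemma lipschitz_continuous_rV (R : realType) n (f : 'rV[R]_n -> R) (L : R) :
  (forall x y, `|f x - f y| <= L * \sum_i `|x ord0 i - y ord0 i|) -> continuous f.
Proof.
move=> lf x; apply/(@cvgrPdist_le _ _ _ (nbhs (x : 'rV[R]_n)) _ f (f x)) => e e0.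
pose M := `|L| * n%:R + 1; have M0 : 0 < M by rewrite ltr_wpDl// mulr_ge0.
have eM : 0 < e / M by rewrite divr_gt0.
near=> y; apply: le_trans (lf _ _) _.
apply: (@le_trans _ _ (`|L| * \sum_(i < n) (e / M))).
  apply: (@le_trans _ _ (`|L| * \sum_i `|x ord0 i - y ord0 i|)).
    by rewrite ler_wpM2r ?sumr_ge0 ?ler_norm.
  rewrite ler_wpM2l//; apply: ler_sum => i _; apply: ltW; move: i.
  near: y; apply: (@filterS _ (nbhs (x : 'rV[R]_n)) _ (ball (x : 'rV[R]_n) (e / M))).
    by move=> z /(rV_ballP _ _ eM) h; exact: h.
  exact: nbhsx_ballx.
rewrite [leRHS](_ : e = M * (e / M)); last by rewrite mulrCA divff ?gt_eqF// mulr1.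
move: (e / M) (ltW eM) => r r0.
by rewrite sumr_const card_ord -[r *+ n]mulr_natl /M mulrDl mul1r mulrA lerDl.
Unshelve. all: by end_near.
Qed.

Lemma bil_measurable (R : realType) (I : finType) (w : I -> I -> R) d (S : measurableType d)
    (f h : S -> I -> R) :
  (forall i, measurable_fun setT (fun s => f s i)) ->
  (forall i, measurable_fun setT (fun s => h s i)) ->
  measurable_fun setT (fun s => bil w (f s) (h s)).
Proof.
move=> mf mh; apply: measurable_sum => i; apply: measurable_sum => j.
by apply: measurable_funM => //; exact: measurable_funM.
Qed.

Section scheme.
Context {R : realType} {d : nat} (Th : mesh R d) (D : set 'rV[R]_d).
Local Notation index := ('I_(nvert Th)).
Local Notation a := (vert (m := Th)).
Context (d0 : (0 < d)%N) (cD : conforming_triangulation Th D) (oD : open D) (bD : bounded_set D).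
Context (Dn0 : D !=set0).
Context (g g' : R -> R) (gD : forall y : R, is_derive y 1 g (g' y)) (cg' : continuous g').
Context (kappa : R) (glip : forall s t, `|g s - g t| <= kappa * `|s - t|).
Implicit Types (U V : index -> R).

Let mD : measurable D := open_measurable_rV oD.
Let fD : (leb d D < +oo)%E := leb_bounded_lty mD bD.

Let in_L2_gfe U : in_L2 D (g \o fe U).
Proof. by have [b hb] := fe_offset cD U; exact: (in_L2_comp cD oD bD hb gD glip). Qed.

Definition noise U : index -> R := Ph D Th (g \o fe U) \o a.

Lemma mass_noise U V : mass D (noise U) V = ip D (g \o fe U) (fe V).
Proof. by have [_] := Ph_spec d0 cD oD bD (in_L2_gfe U). Qed.

(** An explicit formula replacing the choice [Ph], from which measurability in the nodal values can
    be seen. *)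
Lemma noiseE U : noise U = mass_solve D (fun i => ip D (g \o fe U) (hat (Th := Th) i)).
Proof.
apply: (mass_inj d0 cD oD bD) => V.
by rewrite mass_noise (mass_solveP d0 cD oD bD) (ip_fe_sum cD oD bD).
Qed.

Let hat_bounds i x : D x -> 0 <= hat (Th := Th) i x <= 1.
Proof.
move=> Dx; have [K KS Kx] := sub_mesh_domain cD Dx.
have gK := mesh_good cD KS; rewrite (hat_hull cD _ KS Kx) (lam_bounds cD)//=.
by rewrite -(lam_sum x gK) (bigD1 i)//= lerDl sumr_ge0// => j _; rewrite (lam_bounds cD).
Qed.

(** Serves the continuity, hence the measurability, of the noise as a function of the nodal values;
    hat functions lie between 0 and 1. *)
Lemma load_lipschitz U V j :
  `|ip D (g \o fe U) (hat (Th := Th) j) - ip D (g \o fe V) (hat (Th := Th) j)| <=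
    kappa * (\sum_i `|U i - V i|) * fine (leb d D).
Proof.
have k0 : 0 <= kappa.
  by have := glip 1 0; rewrite subr0 normr1 mulr1; apply: le_trans.
have hj := in_L2_hat cD oD bD j; have hB := in_L2B mD (in_L2_gfe U) (in_L2_gfe V).
rewrite -(ipBl mD (in_L2_gfe U) (in_L2_gfe V) hj).
have i1 := in_L2_integrableM mD hB hj.
apply: le_trans (le_normr_Rintegral mD i1) _.
have -> : kappa * (\sum_i `|U i - V i|) * fine (leb d D) =
    \int[leb d]_(x in D) (kappa * (\sum_i `|U i - V i|)).
  by rewrite /Rintegral integral_cst// fineM// ge0_fin_numE.
apply: le_Rintegral => //.
- exact: integrable_norm i1.
- by have := in_L2_integrableM mD (in_L2_cst oD bD (kappa * (\sum_i `|U i - V i|))) (in_L2_cst oD bD 1);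
    under eq_fun do rewrite mulr1.
move=> x Dx; rewrite normrM; have /andP[h0 h1] := hat_bounds j Dx.
rewrite (ger0_norm h0); apply: le_trans (ler_wpM2l (normr_ge0 _) h1) _; rewrite mulr1.
apply: le_trans (glip _ _) _; rewrite ler_wpM2l//.
rewrite /fe -sumrB; apply: le_trans (ler_norm_sum _ _ _) _; apply: ler_sum => i _.
have /andP[hi0 hi1] := hat_bounds i Dx.
by rewrite -mulrBl normrM (ger0_norm hi0) ler_piMr.
Qed.

Lemma noise_measurable i : measurable_fun setT (fun x : 'rV[R]_(nvert Th) => noise (fun k => x ord0 k) i).
Proof.
under eq_fun do rewrite noiseE /mass_solve mxE.
apply: measurable_sum => j; apply: measurable_funM => //.
under eq_fun do rewrite mxE; apply: continuous_measurable_rV.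
apply: (lipschitz_continuous_rV (L := kappa * fine (leb d D))) => x y.
by apply: le_trans (load_lipschitz _ _ _) _; rewrite [leRHS]mulrAC.
Qed.

Definition noise_const (CP : R) : R :=
  Ph_const (d := d) CP * (2 * kappa ^+ 2 + 2 * (g 0 ^+ 2 * fine (leb d D))).

Lemma Ph_const_ge0 CP : 0 <= Ph_const (R := R) (d := d) CP.
Proof.
have c1 : 0 <= (c0 (R := R) (d := d))^-1 by rewrite invr_ge0 ltW ?c0_gt0.
rewrite /Ph_const mulr_ge0 ?addr_ge0//.
by rewrite mulr_ge0// addr_ge0// mulr_ge0// sqr_ge0.
Qed.

Lemma noise_const_ge0 CP : 0 <= noise_const CP.
Proof.
have k2 := sqr_ge0 kappa; have g2 := sqr_ge0 (g 0).
have m0 : 0 <= fine (leb d D) by exact: fine_ge0.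
apply: mulr_ge0; first exact: Ph_const_ge0.
by apply: addr_ge0; apply: mulr_ge0 => //; exact: mulr_ge0.
Qed.

Lemma energy_noise_le CP U : Ph_estimates D Th CP ->
  energy (noise U) (noise U) <= noise_const CP * (1 + energy U U).
Proof.
move=> hP; have [sw gw] := sobolev_comp_fe d0 cD oD bD gD cg' glip U.
apply: le_trans (energy_Ph_le d0 cD oD bD Dn0 sw hP) _.
rewrite /noise_const -mulrA ler_wpM2l ?Ph_const_ge0//; apply: le_trans gw _.
have E0 := energy_ge0 d0 cD U; have k2 := sqr_ge0 kappa.
have g2 : 0 <= g 0 ^+ 2 * fine (leb d D) by rewrite mulr_ge0 ?sqr_ge0 ?fine_ge0.
have := mulr_ge0 g2 E0; move: k2; move: (kappa ^+ 2) (_ * fine _) => k G k2 GE.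
by have := mulr_ge0 k2 E0; lra.
Qed.

(** The total lumped weight is replaced by its bound through the volume of D, so that the constant
    does not see the mesh. *)
Definition drift_const : R :=
  2 * ((growth (R := R) (d := d) + growth (R := R) (d := d) ^+ 2) *
       ((c0 (R := R) (d := d))^-1 * fine (leb d D))).

Lemma growth_ge0 : 0 <= growth (R := R) (d := d).
Proof. by rewrite addr_ge0// invr_ge0 mulr_ge0// ltW ?c0_gt0. Qed.

Lemma drift_const_ge0 : 0 <= drift_const.
Proof.
have g0 := growth_ge0.
rewrite /drift_const mulr_ge0// mulr_ge0//; first by rewrite addr_ge0// sqr_ge0.
by rewrite mulr_ge0 ?fine_ge0// invr_ge0 ltW ?c0_gt0.
Qed.

(** The coefficient xi, defined by Q(G, U) = xi (1 + Q(U, U)); the 1 keeps the denominator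
    positive. *)
Definition relative_noise U : R := energy (noise U) U / (1 + energy U U).

Lemma relative_noise_le CP U : Ph_estimates D Th CP ->
  `|relative_noise U| <= noise_const CP + 1.
Proof.
move=> hP; have E0 := energy_ge0 d0 cD U; have Y0 : 0 < 1 + energy U U by rewrite ltr_wpDr.
rewrite /relative_noise normrM normfV (gtr0_norm Y0) ler_pdivrMr//.
have psd V : 0 <= bil (energym (Th := Th)) V V by rewrite -energy_bil (energy_ge0 d0 cD).
have := bil_cauchy (@energymC _ _ _) psd U (noise U) ltr01.
rewrite -!energy_bil invr1 !mul1r normrM ger0_norm// => h.
have := energy_noise_le U hP; have := noise_const_ge0 CP.
move: h; move: (energy (noise U) (noise U)) (energy U U) E0 (noise_const CP) (`|_|) Y0.
move=> e1 e2 e20 c n _ h c0 h1; have := mulr_ge0 c0 e20.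
by move: h h1; lra.
Qed.

Lemma energy_growth CP q (tau Delta : R) U U' : mesh_assumption Th -> Ph_estimates D Th CP ->
  (3 <= q)%N -> odd q -> 0 < tau ->
  (forall V, mass D U' V + tau * stiff U' V =
     mass D U V + tau * mass D (fun i => U' i - U' i ^+ q) V + Delta * mass D (noise U) V) ->
  1 + energy U' U' <= (1 + energy U U) *
    (1 + (drift_const * tau + noise_const CP * Delta ^+ 2 + 2 * relative_noise U * Delta)).
Proof.
move=> mA hP q3 oq t0 hU; have := energy_step d0 cD oD bD mA q3 oq t0 hU.
have E0 := energy_ge0 d0 cD U; have Y0 : 0 < 1 + energy U U by rewrite ltr_wpDr.
have eN : energy (noise U) U = relative_noise U * (1 + energy U U).
  by rewrite /relative_noise divfK// gt_eqF.
have := ler_wpM2l (sqr_ge0 Delta) (energy_noise_le U hP).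
have h1 : 2 * tau * ((growth (d := d) + growth (d := d) ^+ 2) * \sum_i lumpw (Th := Th) i) <= drift_const * tau.
  rewrite /drift_const [leRHS]mulrAC; apply: ler_wpM2l; first by rewrite mulr_ge0// ltW.
  apply: ler_wpM2l; last exact: (lumpw_sum_le cD oD bD).
  by rewrite addr_ge0 ?growth_ge0// sqr_ge0.
have h2 := mulr_ge0 (mulr_ge0 drift_const_ge0 (ltW t0)) E0.
rewrite eN; move: h1 h2.
move: (2 * tau * _) (energy U' U') (energy U U) (energy (noise U) (noise U)) => v1 v2 v3 v4.
move: (relative_noise U) (noise_const CP) drift_const => r c b.
by lra.
Qed.

Section solution.
Context {dO : measure_display} {Omega : measurableType dO} (P : probability Omega R).
Context (F : R -> set (set Omega)) (hF : filtration F) (W : R -> Omega -> R).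
Context (q : nat) (u0 : 'rV[R]_d -> R) (T : R) (N : nat) (u : nat -> Omega -> 'rV[R]_d -> R).
Context (hu : fe_solution P D Th F W q g u0 T N u).

Let tau := T / N%:R.

Definition nodal n om : index -> R := u n om \o a.

Lemma nodal_adapted n i : (n <= N)%N -> adapted_at (F (n%:R * tau)) (fun om => nodal n om i).
Proof. by have [_ h _ _] := hu; move=> nN; apply: h => //; exact: vert_closure cD _. Qed.

Lemma scheme_nodal : {ae P, forall om, forall n, (n < N)%N -> forall V,
  mass D (nodal n.+1 om) V + tau * stiff (nodal n.+1 om) V =
  mass D (nodal n om) V + tau * mass D (fun i => nodal n.+1 om i - nodal n.+1 om i ^+ q) V +
  (W (n.+1%:R * tau) om - W (n%:R * tau) om) * mass D (noise (nodal n om)) V}.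
Proof.
have [vh _ _ h] := hu; apply: filterS h => om hom n nN V.
have feV : Vh D Th (fe V) by exact: (Vh_fe d0 cD oD bD).
have v1 := vh n.+1 om nN; have v0 := vh n om (ltnW nN).
have VE : fe V \o a = V by apply/funext => i; exact: (fe_vert cD).
have := hom n nN _ feV.
rewrite (ip_Vh cD v1 feV) (ip_Vh cD v0 feV) (grad_ip_Vh d0 cD oD bD v1 feV) VE.
have -> : ip D (Ih D Th (fun x => u n.+1 om x - u n.+1 om x ^+ q)) (fe V) =
    mass D (fun i => nodal n.+1 om i - nodal n.+1 om i ^+ q) V.
  by apply: ip_eqD => // x /set_mem Dx; rewrite (IhE d0 cD oD bD)//; exact: (sub_mesh_domain cD).
have -> : ip D (g \o u n om) (fe V) = mass D (noise (nodal n om)) V.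
  by rewrite mass_noise; apply: ip_eqD => // x Dx; rewrite /= (VhE_in cD v0).
by rewrite [_ * (W _ _ - _)]mulrC.
Qed.

Let OF n := g_sigma_algebraType (F (n%:R * tau)).

Lemma nodal_measurable n i : (n <= N)%N -> 0 <= tau ->
  measurable_fun setT (fun om : OF n => nodal n om i).
Proof.
move=> nN t0; apply: adapted_measurable; last exact: nodal_adapted.
by have [h _] := hF; have [] := h (n%:R * tau) (mulr_ge0 (ler0n _ _) t0).
Qed.

Lemma measurable_adapted n (Y : Omega -> R) : 0 <= tau ->
  measurable_fun setT (Y : OF n -> R) -> adapted_at (F (n%:R * tau)) Y.
Proof.
move=> t0 mY B mB; have [h _] := hF; have [sF _] := h (n%:R * tau) (mulr_ge0 (ler0n _ _) t0).
by apply/(measurable_OG sF); have := mY measurableT B mB; rewrite setTI.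
Qed.

Lemma energy_adapted n : (n <= N)%N -> 0 <= tau ->
  adapted_at (F (n%:R * tau)) (fun om => 1 + energy (nodal n om) (nodal n om)).
Proof.
move=> nN t0; apply: measurable_adapted => //; apply: measurable_funD => //.
under eq_fun do rewrite energy_bil.
by apply: (@bil_measurable _ _ _ _ (OF n)) => i; exact: nodal_measurable.
Qed.

Lemma relative_noise_adapted n : (n <= N)%N -> 0 <= tau ->
  adapted_at (F (n%:R * tau)) (fun om => relative_noise (nodal n om)).
Proof.
move=> nN t0; apply: measurable_adapted => //.
have mN i := @nodal_measurable n i nN t0.
have mU : measurable_fun setT (fun om : OF n => \row_i nodal n om i).
  by apply: measurable_fun_rV => i; under eq_fun do rewrite mxE; exact: mN.
apply: measurable_funM; last first.
  (* Nonnegativity lets the inverse be read as the power -1, a measurable function. *)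
  have Y0 om : 0 <= 1 + energy (nodal n om) (nodal n om).
    by rewrite addr_ge0// (energy_ge0 d0 cD).
  under eq_fun do rewrite -powR_inv1//; apply: (measurableT_comp (measurable_powR _)).
  apply: measurable_funD => //; under eq_fun do rewrite energy_bil.
  by apply: (@bil_measurable _ _ _ _ (OF n)) => i; exact: mN.
under eq_fun do rewrite energy_bil.
apply: (@bil_measurable _ _ _ _ (OF n)) => // i.
have := measurableT_comp (noise_measurable i) mU.
by rewrite (_ : _ \o _ = fun om => noise (nodal n om) i)//; apply/funext => om /=;
  congr (noise _ i); apply/funext => k; rewrite mxE.
Qed.

End solution.
End scheme.

(** * Propagation of the moments in time *)

Section moments.
Context {R : realType} {d : nat} (Th : mesh R d) (D : set 'rV[R]_d).
Local Notation a := (vert (m := Th)).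
Context (d0 : (0 < d)%N) (cD : conforming_triangulation Th D) (oD : open D) (bD : bounded_set D).
Context (Dn0 : D !=set0) (mA : mesh_assumption Th).
Context (g g' : R -> R) (gD : forall y : R, is_derive y 1 g (g' y)) (cg' : continuous g').
Context (kappa : R) (glip : forall s t, `|g s - g t| <= kappa * `|s - t|).
Context (CP : R) (hP : Ph_estimates D Th CP).
Context {dO : measure_display} {Omega : measurableType dO} (P : probability Omega R).
Context (F : R -> set (set Omega)) (hF : filtration F) (W : R -> Omega -> R) (hW : wiener P F W).
Context (q : nat) (q3 : (3 <= q)%N) (oq : odd q).
Context (u0 : 'rV[R]_d -> R) (hu0 : sobolev D 1 u0) (T : R) (T0 : 0 < T) (N : nat) (N0 : (0 < N)%N).
Context (u : nat -> Omega -> 'rV[R]_d -> R) (hu : fe_solution P D Th F W q g u0 T N u).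

Let tau := T / N%:R.

Let tau0 : 0 < tau.
Proof. by rewrite divr_gt0// ltr0n. Qed.

Let tauT : tau <= T.
Proof. by rewrite ler_pdivrMr ?ltr0n// ler_peMr ?(ltW T0)// ler1n. Qed.

Let Y n om := 1 + energy (nodal (Th := Th) u n om) (nodal u n om).

Let Y1 n om : 1 <= Y n om.
Proof. by rewrite lerDl (energy_ge0 d0 cD). Qed.

Let time_ge0 n : 0 <= n%:R * tau.
Proof. by rewrite mulr_ge0// ltW. Qed.

Let Fsig n : sigma_algebra setT (F (n%:R * tau)) /\ F (n%:R * tau) `<=` measurable.
Proof. by have [h _] := hF; exact: h (time_ge0 n). Qed.

Let measurable_Y n : (n <= N)%N -> measurable_fun setT (Y n).
Proof.
move=> nN _ B mB; rewrite setTI; apply: (Fsig n).2.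
exact: (energy_adapted cD hF hu nN (ltW tau0) mB).
Qed.

Let X n om := W (n.+1%:R * tau) om - W (n%:R * tau) om.

Let measurable_W n : measurable_fun setT (W (n%:R * tau)).
Proof.
move=> _ B mB; rewrite setTI; apply: (Fsig n).2.
by have [h _ _ _ _] := hW; exact: (h _ (time_ge0 n) _ mB).
Qed.

Let increment_indep n (A : set Omega) (B : set R) : F (n%:R * tau) A -> measurable B ->
  P (A `&` X n @^-1` B) = (P A * normal_prob 0 (Num.sqrt tau) B)%E.
Proof.
move=> FA mB; have [_ _ _ h4 h5] := hW.
have st : n%:R * tau < n.+1%:R * tau by rewrite ltr_pM2r// ltr_nat.
rewrite -[X n]/((W (n.+1%:R * tau) \- W (n%:R * tau))).
rewrite (h5 _ _ _ _ (time_ge0 n) st FA mB) (h4 _ _ _ (time_ge0 n) st mB).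
by rewrite -mulrBl -natr1 addrAC subrr add0r mul1r.
Qed.

Definition initial_const : R := Ph_const (d := d) CP * (ip D u0 u0 + grad_ip D u0 u0).

Lemma moment_bound m K : 0 <= K ->
  (forall s xi : R, 0 < s <= T -> `|xi| <= noise_const D g kappa CP + 1 ->
    (\int[normal_prob 0 (Num.sqrt s)]_x
       ((1 + (drift_const D * s + noise_const D g kappa CP * x ^+ 2 + 2 * xi * x)) ^+ m.*2)%:E <=
      (1 + K * s)%:E)%E) ->
  forall n, (n <= N)%N ->
  (\int[P]_om (Y n om ^+ m.*2)%:E <= ((1 + K * tau) ^+ n * (1 + initial_const) ^+ m.*2)%:E)%E.
Proof.
move=> K0 hK; have even0 (r : R) : 0 <= r ^+ m.*2 by rewrite -muln2 exprM sqr_ge0.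
elim=> [_|n IH nN].
  rewrite expr0 mul1r; apply: (@le_trans _ _ (\int[P]_om ((1 + initial_const) ^+ m.*2)%:E)%E); last first.
    rewrite integral_cst// -[leRHS]mule1; apply: lee_wpmul2l; first by rewrite lee_fin.
    exact: probability_le1.
  apply: ge0_le_integral => //.
  - by move=> om _; rewrite lee_fin.
  - by apply/measurable_EFinP; apply: measurable_funX; exact: measurable_Y.
  move=> om _; rewrite lee_fin.
  (* The initial nodal values are deterministic, and the H^1 stability of the projection bounds
     their energy uniformly in the mesh. *)
  have e0 : energy (nodal (Th := Th) u 0 om) (nodal u 0 om) <= initial_const.
    have -> : nodal (Th := Th) u 0 om = Ph D Th u0 \o a.
      by have [_ _ h _] := hu; apply/funext => i; apply: h; exact: vert_closure cD _.
    exact: (energy_Ph_le d0 cD oD bD Dn0 hu0 hP).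
  have E0 := energy_ge0 d0 cD (nodal (Th := Th) u 0 om).
  have YI : Y 0 om <= 1 + initial_const by rewrite lerD2l.
  by have := le_trans ler01 (Y1 0 om) => y0; rewrite lerXn2r ?nnegrE// (le_trans y0).
have nN' := ltnW nN.
have step : (\int[P]_om (Y n.+1 om ^+ m.*2)%:E <= (1 + K * tau)%:E * \int[P]_om (Y n om ^+ m.*2)%:E)%E.
  apply: (moment_step (Fsig n).1 (Fsig n).2 (X := X n) _ (mu := normal_prob 0 (Num.sqrt tau))
    (@increment_indep n) (a := drift_const D) (b := noise_const D g kappa CP)
    (xi := fun om => relative_noise D g (nodal u n om))).
  - by apply: measurable_funB; exact: measurable_W.
  - move=> om; apply: hK; first by rewrite tau0 tauT.
    exact: (relative_noise_le d0 cD oD bD Dn0 gD cg' glip).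
  - exact: (energy_adapted cD hF hu nN' (ltW tau0)).
  - exact: (relative_noise_adapted d0 cD oD bD gD glip hF hu nN' (ltW tau0)).
  - exact: measurable_Y.
  apply: filterS (scheme_nodal d0 cD oD bD gD glip hu) => om hom.
  rewrite (le_trans ler01 (Y1 _ _))/=.
  exact: (energy_growth d0 cD oD bD Dn0 gD cg' glip mA hP q3 oq tau0 (hom n nN)).
have Kt : 0 <= 1 + K * tau by rewrite addr_ge0// mulr_ge0// ltW.
apply: le_trans step _; rewrite exprS -mulrA EFinM; apply: lee_wpmul2l; first by rewrite lee_fin.
exact: IH.
Qed.

(** The gradient norm is at most the square root of Y, hence at most Y because Y >= 1; for the same
    reason Y^p <= Y^(2m). The n steps cost (1 + K tau)^n <= exp (K T). *)
Lemma gradient_moment_bound m K p : 0 <= K -> 0 <= p <= m.*2%:R ->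
  (forall s xi : R, 0 < s <= T -> `|xi| <= noise_const D g kappa CP + 1 ->
    (\int[normal_prob 0 (Num.sqrt s)]_x
       ((1 + (drift_const D * s + noise_const D g kappa CP * x ^+ 2 + 2 * xi * x)) ^+ m.*2)%:E <=
      (1 + K * s)%:E)%E) ->
  forall n, (n <= N)%N ->
  ('E_P[fun om => (grad_norm D (u n om) `^ p)%R] <= (expR (K * T) * (1 + initial_const) ^+ m.*2)%:E)%E.
Proof.
move=> K0 /andP[p0 pm] hK n nN; rewrite unlock.
have even0 (r : R) : 0 <= r ^+ m.*2 by rewrite -muln2 exprM sqr_ge0.
have gE om : grad_norm D (u n om) = Num.sqrt (stiff (nodal (Th := Th) u n om) (nodal u n om)).
  have [h _ _ _] := hu; have hv := h n om nN.
  by rewrite /grad_norm (grad_ip_Vh d0 cD oD bD hv hv).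
apply: (@le_trans _ _ (\int[P]_om (Y n om ^+ m.*2)%:E)%E).
  apply: ge0_le_integral => //.
  - by move=> om _; rewrite lee_fin powR_ge0.
  - apply/measurable_EFinP; apply: (measurableT_comp (measurable_powR _)).
    have mU i : measurable_fun setT (fun om => nodal (Th := Th) u n om i).
      move=> _ B mB; rewrite setTI; apply: (Fsig n).2; exact: (nodal_adapted cD hu i nN mB).
    rewrite (_ : (fun om => _) = Num.sqrt \o (fun om => bil (stiffm (Th := Th)) (nodal u n om) (nodal u n om))); last first.
      by apply/funext => om; rewrite /= gE stiff_bil.
    apply: measurableT_comp; last exact: bil_measurable.
    by apply: continuous_measurable_fun; exact: sqrt_continuous.
  - by apply/measurable_EFinP; apply: measurable_funX; exact: measurable_Y.
  move=> om _; rewrite lee_fin; have y1 := Y1 n om; have y0 := le_trans ler01 y1.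
  apply: (@le_trans _ _ (Y n om `^ p)).
    apply: ge0_ler_powR => //; rewrite ?nnegrE ?gE ?sqrtr_ge0//.
    apply: (@le_trans _ _ (Num.sqrt (Y n om ^+ 2))); last by rewrite sqrtr_sqr ger0_norm.
    rewrite ler_wsqrtr//; apply: (@le_trans _ _ (Y n om)); last by rewrite expr2 ler_peMr.
    rewrite /Y /energy; have := lump_ge0 d0 cD (nodal u n om); lra.
  by rewrite -powR_mulrn//; apply: ler_powR.
apply: le_trans (moment_bound K0 hK nN) _; rewrite lee_fin ler_wpM2r//.
have Kt : 0 <= K * tau by rewrite mulr_ge0// ltW.
apply: (@le_trans _ _ (expR (K * tau) ^+ n)).
  by rewrite lerXn2r ?nnegrE ?addr_ge0 ?expR_ge0// expR_ge1Dx.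
rewrite -expRM_natl ler_expR mulrCA ler_wpM2l//.
rewrite /tau mulrCA ler_piMr ?(ltW T0)// ler_pdivrMr ?ltr0n// mul1r ler_nat.
exact: nN.
Qed.

End moments.


Theorem theorem3p2 (R : realType) (d : nat) (hd : (1 <= d <= 3)%N)
    (D : set 'rV[R]_d) (hD : bounded_domain D)
    (T : R) (hT : 0 < T)
    (dO : measure_display) (Omega : measurableType dO)
    (P : probability Omega R)
    (F : R -> set (set Omega)) (hF : filtration F)
    (W : R -> Omega -> R) (hW : wiener P F W)
    (q : nat) (hq : (3 <= q)%N) (hq_odd : odd q)
    (g : R -> R) (hg : C1 g) (kappa1 : R) (hkappa1 : 0 < kappa1)
    (hg_lip : forall x y, `|g x - g y| <= kappa1 * `|x - y|)
    (u0 : 'rV[R]_d -> R) (hu0 : sobolev D 1 u0)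
    (CP : R) (p : R) (hp : 2 <= p) :
  exists C : R, 0 < C /\
    forall (Th : mesh R d),
      conforming_triangulation Th D -> mesh_assumption Th ->
      Ph_estimates D Th CP ->
    forall (N : nat), (0 < N)%N ->
    forall (u : nat -> Omega -> 'rV[R]_d -> R),
      fe_solution P D Th F W q g u0 T N u ->
      (ereal_sup [set 'E_P[fun om => (grad_norm D (u n om) `^ p)%R]
                 | n in [set n | (n <= N)%N]] <= C%:E)%E.
Proof.
have [Dn0 oD _ bD] := hD; have [d0 _] := andP hd.
have [gder cg'] := hg.
have gD (y : R) : is_derive y 1 g (derive1 g y) by rewrite derive1E; apply: derivableP.
have l0 : 0 <= noise_const D g kappa1 CP + 1 by rewrite addr_ge0 ?noise_const_ge0.
(* Makes the even integer 2 m at least p. *)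
pose m := (Num.truncn p).+1.
have pm : 0 <= p <= m.*2%:R.
  apply/andP; split; first by rewrite (le_trans _ hp).
  apply: (@le_trans _ _ m%:R); first exact/ltW/truncnS_gt.
  by rewrite ler_nat -addnn leq_addr.
(* The bounds on the drift and on the noise involve only D, g, kappa1 and CP, so K is available
   before the mesh and the time step. *)
have [K K0 hK] := gaussian_growth m (drift_const_ge0 D) (noise_const_ge0 D g kappa1 CP) l0 (ltW hT).
(* The added 1 secures strict positivity. *)
exists (expR (K * T) * (1 + initial_const D CP u0) ^+ m.*2 + 1).
have even0 (r : R) : 0 <= r ^+ m.*2 by rewrite -muln2 exprM sqr_ge0.
split=> [|Th cD mA hP N N0 u hu]; first by rewrite ltr_wpDl// mulr_ge0 ?expR_ge0.
apply: ge_ereal_sup => _ [n nN <-].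
apply: le_trans (gradient_moment_bound d0 cD oD bD Dn0 mA gD cg' hg_lip hP hF hW hq hq_odd hu0 hT
  N0 hu K0 pm hK nN) _.
by rewrite lee_fin lerDl.
Qed.
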